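(* Let $V_1$ be a complex superspace of superdimension $m_1|m_1$ with $m_1\ge1$, let $n\ge1$ and $V=V_1\otimes\Lambda(n)$. The Lie superalgebra $\mathfrak g=\mathfrak q(V_1)\otimes\Lambda(n)\rtimes\mathfrak{vect}(0|n)$ is a maximal Lie subsuperalgebra of $\mathfrak{sq}(V)$.
   Context: For an odd operator $J$ with $J^2=-\mathrm{id}$ on $V$, $\mathfrak q(V)=C(J)=\{X\in\mathfrak{gl}(V)\mid[X,J]=0\}$ (supercommutator). In a basis where $J=\begin{pmatrix} 0 & 1 \\ -1 & 0 \end{pmatrix}$ it consists of $\begin{pmatrix} A & B \\ B & A \end{pmatrix}$, with queer trace $\mathrm{tr}\,B$; $\mathfrak{sq}(V)$ is the subalgebra of elements of zero queer trace. Here $\mathfrak q(V_1)=C(J_1)$ and $\mathfrak q(V)=C(J_1\otimes1)$. $\Lambda(n)=\Lambda(\xi_1,\dots,\xi_n)$ is the Grassmann superalgebra and $\mathfrak{vect}(0|n)=\mathfrak{der}\,\Lambda(n)$. $\mathfrak g$ is the semidirect sum of the ideal $\mathfrak q(V_1)\otimes\Lambda(n)$ and $\mathfrak{vect}(0|n)$, acting faithfully on $V$ by $(A\otimes\varphi)(v\otimes\psi)=(-1)^{p(\varphi)p(v)}Av\otimes\varphi\psi$, $D(v\otimes\psi)=(-1)^{p(D)p(v)}v\otimes D(\psi)$. Maximal means proper and not contained in a strictly larger proper Lie subsuperalgebra. *)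

(* Defs.v *)
From HB Require Import structures.
From mathcomp Require Import all_boot all_order all_algebra.

Set Implicit Arguments.
Unset Strict Implicit.
Unset Printing Implicit Defensive.

Import GRing.Theory.
Local Open Scope ring_scope.

Lemma linear_lfunE (K : fieldType) (aT rT : vectType K) (f : aT -> rT) :
  linear f -> linfun f =1 f.
Proof.
move=> lin_f; pose F := GRing.isLinear.Build K aT rT _ f lin_f.
by pose g : {linear aT -> rT} := HB.pack f F; apply: (lfunE g).
Qed.

(* Parities are booleans, [true] being odd, and they add up with [(+)]. *)
Record superspace (K : fieldType) := Superspace {
  carrier :> vectType K;
  part : bool -> {vspace carrier};
  part_full : (part false + part true = fullv)%VS;
  part_cap : (part false :&: part true = 0)%VS }.

Section Operators.
Variables (K : fieldType) (V : superspace K).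
Implicit Types (X Y : 'End(V)) (a b : bool).

(* The projection of V onto its part of parity a, along the other part. *)
Definition proj a : 'End(V) := daddv_pi (part V a) (part V (~~ a)).

Lemma part_capE a : (part V a :&: part V (~~ a) = 0)%VS.
Proof. by case: a; rewrite //= ?(capvC (part V true)) part_cap. Qed.

Lemma mem_proj a v : proj a v \in part V a.
Proof. exact: memv_pi. Qed.

Lemma proj_id a v : v \in part V a -> proj a v = v.
Proof. by apply: daddv_pi_id; apply: part_capE. Qed.

Lemma proj_sum v : \sum_a proj a v = v.
Proof.
rewrite big_bool /= addrC daddv_pi_add ?part_cap // part_full; exact: memvf.
Qed.

Lemma proj_neq a v : v \in part V (~~ a) -> proj a v = 0.
Proof.
move=> Vv; have := proj_sum v; rewrite big_bool.
case: a Vv => /= Vv; rewrite (proj_id Vv).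
  by move/eqP; rewrite -subr_eq0 addrK => /eqP.
by move/eqP; rewrite addrC -subr_eq0 addrK => /eqP.
Qed.

Lemma projE a b v : v \in part V b -> proj a v = if a == b then v else 0.
Proof.
case: eqP => [-> /proj_id // | /eqP neq_ab Vv]; apply: proj_neq.
by case: a b neq_ab Vv => [] [].
Qed.

Definition has_parity b X := forall a, (X @: part V a <= part V (a (+) b))%VS.

Definition op_part b X : 'End(V) :=
  \sum_a (proj (a (+) b) \o X \o proj a)%VF.

Lemma op_partE b X a v :
  v \in part V a -> op_part b X v = proj (a (+) b) (X v).
Proof.
move=> Vv; rewrite sum_lfunE big_bool !comp_lfunE !(projE _ Vv).
by case: a Vv; rewrite /= !linear0 ?addr0 ?add0r.
Qed.

Lemma op_part_sum X : op_part false X + op_part true X = X.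
Proof.
apply/lfunP=> v; rewrite -(proj_sum v) big_bool !linearD /= !add_lfunE.
rewrite !(op_partE _ _ (mem_proj _ _)) /=.
have h w : proj true w + proj false w = w by rewrite -{3}(proj_sum w) big_bool.
by rewrite ![proj false _ + proj true _]addrC !h.
Qed.

Lemma has_parity_part b X : has_parity b (op_part b X).
Proof.
move=> a; apply/subvP=> _ /memv_imgP[v Vv ->].
by rewrite (op_partE _ _ Vv) mem_proj.
Qed.

Lemma op_part_id b c X :
  has_parity c X -> op_part b X = if b == c then X else 0.
Proof.
move=> pX; apply/lfunP=> v; rewrite -(proj_sum v) big_bool !linearD /=.
have op_proj a : op_part b X (proj a v) = (if b == c then X else 0) (proj a v).
  rewrite (op_partE _ _ (mem_proj a v)).
  have /subvP/(_ _ (memv_img X (mem_proj a v)))/projE-> := pX a.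
  by rewrite (inj_eq (@addbI a)); case: ifP; rewrite ?zero_lfunE.
by rewrite !op_proj.
Qed.

Fact op_part_is_linear b : linear (op_part b).
Proof.
move=> k X Y; rewrite /op_part scaler_sumr -big_split; apply: eq_bigr => a _.
by rewrite comp_lfunDr comp_lfunDl -comp_lfunZr -comp_lfunZl.
Qed.
HB.instance Definition _ b := GRing.isLinear.Build K 'End(V) 'End(V) _
  (op_part b) (op_part_is_linear b).

(* The bilinear extension of XY - (-1)^(p(X)p(Y)) YX. *)
Definition supercomm X Y : 'End(V) :=
  \sum_a \sum_b ((op_part a X \o op_part b Y)
                 - (-1) ^+ (a && b) *: (op_part b Y \o op_part a X))%VF.

Lemma supercommE a b X Y : has_parity a X -> has_parity b Y ->
  supercomm X Y = (X \o Y - (-1) ^+ (a && b) *: (Y \o X))%VF.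
Proof.
move=> pX pY; rewrite /supercomm (bigD1 a) //= (bigD1 b) //=.
rewrite !(op_part_id _ pX) !(op_part_id _ pY) !eqxx.
rewrite big1 => [|c /negPf nc]; last first.
  by rewrite (op_part_id _ pY) nc comp_lfun0r comp_lfun0l scaler0 subr0.
rewrite addr0 big1 ?addr0 // => c /negPf nc; rewrite big1 // => d _.
by rewrite (op_part_id _ pX) nc comp_lfun0r comp_lfun0l scaler0 subr0.
Qed.

Fact supercomm_is_linear Y : linear (supercomm^~ Y).
Proof.
move=> k X Z; rewrite /supercomm scaler_sumr -big_split; apply: eq_bigr => a _.
rewrite scaler_sumr -big_split; apply: eq_bigr => b _ /=.
rewrite linearP comp_lfunDl comp_lfunDr -comp_lfunZl -comp_lfunZr scalerDr.
by rewrite opprD addrACA scalerBr !scalerA (mulrC k).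
Qed.

Definition Lie_subsuperalgebra (H : {vspace 'End(V)}) : Prop :=
  (forall b X, X \in H -> op_part b X \in H) /\
  (forall X Y, X \in H -> Y \in H -> supercomm X Y \in H).

Definition maximal_Lie_subsuperalgebra (G L : {vspace 'End(V)}) : Prop :=
  [/\ Lie_subsuperalgebra G, (G <= L)%VS, G != L
    & forall H, Lie_subsuperalgebra H ->
        (G <= H)%VS -> (H <= L)%VS -> H != L -> H = G].

Definition queer (J : 'End(V)) : {vspace 'End(V)} := lker (linfun (supercomm^~ J)).

Lemma queerP J X : reflect (supercomm X J = 0) (X \in queer J).
Proof. by rewrite memv_ker (linear_lfunE (supercomm_is_linear J)); apply: eqP. Qed.

(* If J is odd and J^2 = -1, then (e_i) followed by (- J e_i) is a basis of V
   in which J is [[0, 1], [-1, 0]] (acting on column vectors); the lower left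
   block of X collects the coordinates along - J e_i of the odd part of X e_j. *)
Definition queer_even : (\dim (part V false)).-tuple V := vbasis (part V false).

Definition queer_odd (J : 'End(V)) : (\dim (part V false)).-tuple V :=
  [tuple - J (tnth queer_even i) | i < \dim (part V false)].

Definition queer_block (J X : 'End(V)) : 'M[K]_(\dim (part V false)) :=
  \matrix_(i, j) coord (queer_odd J) i (proj true (X (tnth queer_even j))).

Definition queer_trace (J X : 'End(V)) : K^o := \tr (queer_block J X).

Fact queer_trace_is_linear J : linear (queer_trace J).
Proof.
move=> k X Y; rewrite /queer_trace -linearP; congr (\tr _).
by apply/matrixP=> i j; rewrite !mxE add_lfunE scale_lfunE !linearP.
Qed.

Definition squeer (J : 'End(V)) : {vspace 'End(V)} :=
  (queer J :&: lker (linfun (queer_trace J)))%VS.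

Lemma squeerP J X :
  reflect (supercomm X J = 0 /\ queer_trace J X = 0) (X \in squeer J).
Proof.
rewrite memv_cap memv_ker (linear_lfunE (queer_trace_is_linear J)).
by apply: (iffP andP) => [[/queerP-> /eqP] | [/queerP-> /eqP]].
Qed.

Section QueerBasis.
Variables (J : 'End(V)).
Hypotheses (J_odd : has_parity true J) (J_sq : (J \o J)%VF = - \1%VF).

Lemma J_invol v : J (J v) = - v.
Proof. by rewrite -comp_lfunE J_sq opp_lfunE id_lfunE. Qed.

Lemma queer_odd_basis (e : (\dim (part V false)).-tuple V) :
  basis_of (part V false) e ->
  basis_of (part V true) [tuple - J (tnth e i) | i < \dim (part V false)].
Proof.
move=> e_basis.
have kerJ : (part V false :&: lker (- J) = 0)%VS.
  suff -> : lker (- J) = 0%VS by rewrite capv0.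
  apply/eqP; rewrite -subv0; apply/subvP=> v; rewrite memv_ker memv0 opp_lfunE oppr_eq0.
  by move/eqP=> Jv; rewrite -oppr_eq0 -J_invol Jv linear0.
have imJ : ((- J)%R @: part V false = part V true)%VS.
  apply/eqP; rewrite eqEsubv; apply/andP; split; apply/subvP=> v.
    case/memv_imgP=> u u0 ->; rewrite opp_lfunE memvN.
    exact: (subvP (J_odd false) _ (memv_img J u0)).
  move=> v1; apply/memv_imgP; exists (J v).
    exact: (subvP (J_odd true) _ (memv_img J v1)).
  by rewrite opp_lfunE J_invol opprK.
rewrite -imJ; have := limg_basis_of kerJ e_basis.
congr (basis_of _ _); apply: (@eq_from_nth _ 0); first by rewrite size_map !size_tuple.
rewrite size_map size_tuple => i lti.
rewrite (nth_map 0) ?size_tuple // -[RHS](tnth_nth 0 _ (Ordinal lti)) tnth_mktuple.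
by rewrite opp_lfunE (tnth_nth 0).
Qed.

(* The queer trace does not depend on the choice of the basis. *)
Lemma queer_traceE (e : (\dim (part V false)).-tuple V) X :
  basis_of (part V false) e ->
  queer_trace J X =
  \sum_i coord [tuple - J (tnth e j) | j < \dim (part V false)] i
           (proj true (X (tnth e i))).
Proof.
move=> e_basis; pose e' := queer_even; pose f' := queer_odd J.
set f := [tuple - J (tnth e j) | j < _].
have e'_basis : basis_of (part V false) e' by apply: vbasisP.
have f_basis : basis_of (part V true) f by apply: queer_odd_basis.
have f'_basis : basis_of (part V true) f' by apply: queer_odd_basis.
pose p j i := coord e' j (tnth e i); pose q i k := coord e i (tnth e' k).
have eE i : tnth e i = \sum_j p j i *: tnth e' j.
  rewrite {1}(coord_basis e'_basis (basis_mem e_basis (mem_tnth i e))).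
  by apply: eq_bigr => j _; rewrite -tnth_nth.
have e'E k : tnth e' k = \sum_i q i k *: tnth e i.
  rewrite {1}(coord_basis e_basis (basis_mem e'_basis (mem_tnth k e'))).
  by apply: eq_bigr => j _; rewrite -tnth_nth.
have f'E k : tnth f' k = \sum_i q i k *: tnth f i.
  rewrite tnth_mktuple -/e' e'E linear_sum -sumrN; apply: eq_bigr => i _.
  by rewrite linearZ -scalerN tnth_mktuple.
have qp k j : \sum_i p j i * q i k = (k == j)%:R.
  have /basis_free := e'_basis => /coord_free.
  move=> /(_ k j); rewrite -(tnth_nth 0) e'E linear_sum => <-.
  by apply: eq_bigr => i _; rewrite linearZ mulrC.
have fE i w : w \in part V true -> coord f i w = \sum_k q i k * coord f' k w.
  move=> w1; rewrite {1}(coord_basis f'_basis w1) linear_sum.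
  apply: eq_bigr => k _; rewrite linearZ -tnth_nth.
  suff qE : coord f i (tnth f' k) = q i k.
    by transitivity (coord f' k w * coord f i (tnth f' k)); rewrite // qE mulrC.
  have f_coord l : coord f i (tnth f l) = (l == i)%:R.
    by rewrite (tnth_nth 0) coord_free // (basis_free f_basis).
  rewrite f'E linear_sum (bigD1 i) //= linearZ /= f_coord eqxx.
  rewrite big1 ?addr0 => [|l /negPf nl]; first by rewrite [LHS]mulr1.
  by rewrite linearZ /= f_coord nl [LHS]mulr0.
have XE i w : coord f' i (proj true (X (tnth e w)))
            = \sum_j p j w * queer_block J X i j.
  by rewrite eE !linear_sum; apply: eq_bigr => j _; rewrite !linearZ mxE.
rewrite /queer_trace /mxtrace.
under [RHS]eq_bigr => i _.
  rewrite (fE _ _ (mem_proj true _)).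
  under eq_bigr => k _ do rewrite XE mulr_sumr.
  over.
rewrite exchange_big /=; apply: eq_bigr => k _.
rewrite exchange_big /= (bigD1 k) //= [X in _ + X]big1 ?addr0.
  under eq_bigr => i _ do rewrite mulrA (mulrC (q _ _)).
  by rewrite -mulr_suml qp eqxx mul1r.
move=> j /negPf njk; under eq_bigr => i _ do rewrite mulrA (mulrC (q _ _)).
by rewrite -mulr_suml qp eq_sym njk mul0r.
Qed.

End QueerBasis.

End Operators.

(* The one-dimensional superspace K^(1|0). *)
Definition scalars_part (K : fieldType) (b : bool) : {vspace K^o} :=
  if b then 0%VS else fullv.

Fact scalars_full (K : fieldType) :
  (scalars_part K false + scalars_part K true = fullv)%VS.
Proof. exact: addv0. Qed.

Fact scalars_cap (K : fieldType) :
  (scalars_part K false :&: scalars_part K true = 0)%VS.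
Proof. exact: capv0. Qed.

Definition scalars (K : fieldType) : superspace K :=
  Superspace (scalars_full K) (scalars_cap K).

(* Elements of U (x) Lambda(n) are given by their U-valued coordinates along
   the monomials xi_S = xi_i1 ... xi_ik, where S = {i1 < ... < ik}. *)
Section TensorLambda.
Variables (K : fieldType) (U : superspace K) (n : nat).
Implicit Types (S T : {set 'I_n}) (u v : U).

Definition monomial S : {ffun {set 'I_n} -> K^o} := [ffun T => (T == S)%:R].

Definition pure u (phi : {ffun {set 'I_n} -> K^o}) : {ffun {set 'I_n} -> U} :=
  [ffun S => phi S *: u].

Definition tensor_part b : {vspace {ffun {set 'I_n} -> U}} :=
  (\sum_S (linfun (pure^~ (monomial S)) @: part U (b (+) odd #|S|)))%VS.

Fact pure_is_linear_l phi : linear (pure^~ phi).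
Proof.
by move=> k u v; apply/ffunP=> S; rewrite !ffunE scalerDr !scalerA mulrC.
Qed.

Fact pure_is_linear_r u : linear (pure u).
Proof.
by move=> k phi psi; apply/ffunP=> S; rewrite !ffunE scalerDl scalerA.
Qed.

Lemma tensor_sum (w : {ffun {set 'I_n} -> U}) :
  w = \sum_S pure (w S) (monomial S).
Proof.
apply/ffunP=> T; rewrite sum_ffunE (bigD1 T) //= !ffunE eqxx scale1r.
by rewrite big1 ?addr0 // => S /negPf nST; rewrite !ffunE eq_sym nST scale0r.
Qed.

Lemma tensor_partP b (w : {ffun {set 'I_n} -> U}) :
  reflect (forall S, w S \in part U (b (+) odd #|S|)) (w \in tensor_part b).
Proof.
apply: (iffP memv_sumP) => [[f f_in ->] S | w_in].
  rewrite sum_ffunE memv_suml // => T _; have /memv_imgP[v v_in ->] := f_in T isT.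
  rewrite (linear_lfunE (pure_is_linear_l _)) !ffunE.
  by case: eqP => [-> | _]; rewrite ?scale1r ?scale0r ?mem0v.
exists (fun S => pure (w S) (monomial S)) => [S _ |]; last exact: tensor_sum.
apply/memv_imgP; exists (w S) => //.
by rewrite (linear_lfunE (pure_is_linear_l _)).
Qed.

Fact tensor_full : (tensor_part false + tensor_part true = fullv)%VS.
Proof.
apply/vspaceP=> w; rewrite memvf; apply/memv_addP.
exists [ffun S : {set 'I_n} => proj U (odd #|S|) (w S)].
  by apply/tensor_partP=> S; rewrite ffunE mem_proj.
exists [ffun S : {set 'I_n} => proj U (~~ odd #|S|) (w S)].
  by apply/tensor_partP=> S; rewrite ffunE mem_proj.
apply/ffunP=> S; rewrite !ffunE -[LHS]proj_sum big_bool.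
by case: odd => //=; rewrite addrC.
Qed.

Fact tensor_cap : (tensor_part false :&: tensor_part true = 0)%VS.
Proof.
apply/vspaceP=> w; rewrite memv0.
apply/idP/eqP=> [/memv_capP[/tensor_partP w0 /tensor_partP w1]| ->]; last exact: mem0v.
apply/ffunP=> S; rewrite ffunE; apply/eqP; rewrite -memv0.
by rewrite -(part_capE U (odd #|S|)) memv_cap -[~~ _]addTb w1 (w0 S).
Qed.

Definition tensor_Lambda : superspace K := Superspace tensor_full tensor_cap.

End TensorLambda.

Definition Lambda (K : fieldType) (n : nat) : superspace K :=
  tensor_Lambda (scalars K) n.

Section Grassmann.
Variables (K : fieldType) (n : nat).
Implicit Types (S T : {set 'I_n}) (phi psi : {ffun {set 'I_n} -> K^o}).

Definition xi S : {ffun {set 'I_n} -> K^o} := monomial K S.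

(* The sign in xi_S xi_T = +- xi_(S :|: T) for disjoint S and T. *)
Definition xi_sign S T : K :=
  (-1) ^+ #|[set x : 'I_n * 'I_n in setX S T | (x.2 < x.1)%N]|.

Definition gmul phi psi : {ffun {set 'I_n} -> K^o} :=
  [ffun S : {set 'I_n} => \sum_(T : {set 'I_n} | T \subset S)
     xi_sign T (S :\: T) * phi T * psi (S :\: T)].

Fact gmul_is_linear_l psi : linear (gmul^~ psi).
Proof.
move=> k phi1 phi2; apply/ffunP=> S; rewrite !ffunE scaler_sumr -big_split.
apply: eq_bigr => T _ /=; rewrite !ffunE mulrDr mulrDl; congr (_ + _).
by rewrite -[k *: phi1 T]/(k * phi1 T) -[RHS]/(k * _) (mulrCA _ k) !mulrA.
Qed.

Fact gmul_is_linear_r phi : linear (gmul phi).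
Proof.
move=> k psi1 psi2; apply/ffunP=> S; rewrite !ffunE scaler_sumr -big_split.
apply: eq_bigr => T _ /=; rewrite !ffunE mulrDr; congr (_ + _).
by rewrite -[k *: psi1 _]/(k * psi1 _) -[RHS]/(k * _) mulrCA.
Qed.

Lemma gmul_xi S T :
  gmul (xi S) (xi T) =
  if [disjoint S & T] then xi_sign S T *: xi (S :|: T) else 0.
Proof.
apply/ffunP=> I; rewrite !ffunE; have [dST | ndST] := boolP [disjoint S & T].
  rewrite !ffunE; have [-> | neqI] := eqVneq I (S :|: T).
    rewrite (bigD1 S) ?subsetUl //= big1 => [|A /andP[_ /negPf nA]].
      rewrite !ffunE setDUl setDv set0U.
      have /setDidPl-> : [disjoint T & S] by rewrite disjoint_sym.
      by rewrite !eqxx addr0 -[RHS]/(_ * _) !mulr1.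
    by rewrite !ffunE nA mulr0 mul0r.
  rewrite big1 ?scaler0 // => A sAI; rewrite !ffunE.
  case: eqP => [eAS | _]; last by rewrite mulr0 mul0r.
  case: eqP => [eT | _]; last by rewrite mulr0.
  by case/eqP: neqI; rewrite -eT -eAS setDE setUIr setUCr setIT; apply/esym/setUidPr.
rewrite !ffunE big1 // => A sAI; rewrite !ffunE.
case: eqP => [eAS | _]; last by rewrite mulr0 mul0r.
case: eqP => [eT | _]; last by rewrite mulr0.
by case/negP: ndST; rewrite -eT -eAS disjoint_sym disjoints_subset setDE subsetIr.
Qed.

Lemma gmul1 phi : gmul (xi set0) phi = phi.
Proof.
apply/ffunP=> S; rewrite !ffunE (bigD1 set0) ?sub0set //= big1.
  rewrite !ffunE eqxx setD0 addr0 mulr1 /xi_sign.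
  rewrite (_ : [set _ in _ | _] = set0) ?cards0 ?mul1r //.
  by apply/setP=> x; rewrite !inE.
by move=> T /andP[_ /negPf nT]; rewrite !ffunE nT mulr0 mul0r.
Qed.

Lemma gmul_xi1_anticomm (i j : 'I_n) :
  gmul (xi [set i]) (xi [set j]) = - gmul (xi [set j]) (xi [set i]).
Proof.
rewrite !gmul_xi [RHS]fun_if oppr0 disjoint_sym !disjoints1 inE setUC.
case: eqP => //= neq_ij; rewrite -scaleNr; congr (_ *: _); rewrite /xi_sign.
have sgn1 (k l : 'I_n) : [set x in setX [set k] [set l] | (x.2 < x.1)%N] =
    if (l < k)%N then [set (k, l)] else set0.
  apply/setP=> -[x y]; rewrite !inE /=.
  case: (boolP (l < k)%N) => lk; rewrite ?inE ?xpair_eqE.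
    by case: eqP => //= ->; case: eqP => //= ->.
  by apply/negP=> /andP[/andP[/eqP-> /eqP->]]; apply/negP.
rewrite !sgn1; case: ltngtP => [lt | lt | /val_inj //];
by rewrite ?cards1 ?cards0 ?opprK.
Qed.

Lemma xi_set (i : 'I_n) (S : {set 'I_n}) : (forall j, j \in S -> i < j)%N ->
  gmul (xi [set i]) (xi S) = xi (i |: S).
Proof.
move=> ltiS; have niS : i \notin S by apply/negP=> /ltiS; rewrite ltnn.
rewrite gmul_xi disjoints1 niS /xi_sign (_ : [set _ in _ | _] = set0).
  by rewrite cards0 scale1r.
apply/setP=> -[x y]; rewrite !inE /=; apply/negP=> /andP[/andP[/eqP-> /ltiS]].
by move=> lt1 /ltnW; rewrite leqNgt lt1.
Qed.

Lemma xi_part S : xi S \in part (Lambda K n) (odd #|S|).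
Proof.
apply/tensor_partP=> T; rewrite ffunE; case: eqP => [-> | _]; last exact: mem0v.
by rewrite addbb; apply: memvf.
Qed.

Definition lmul phi : 'End(Lambda K n) := linfun (gmul phi).

Lemma lmulE phi psi : lmul phi psi = gmul phi psi.
Proof. exact: (linear_lfunE (gmul_is_linear_r phi)). Qed.

Lemma lmul_parity b phi : phi \in part (Lambda K n) b -> has_parity b (lmul phi).
Proof.
move=> /tensor_partP phi_b a; apply/subvP=> _ /memv_imgP[psi /tensor_partP psi_a ->].
rewrite lmulE; apply/tensor_partP=> S /=; rewrite ffunE.
case: (boolP (_ (+) odd #|S|)) => [odd_S | _]; last exact: memvf.
rewrite /= memv0; apply/eqP/big1 => T sTS.
have: (b (+) odd #|T|) || (a (+) odd #|S :\: T|).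
  move: odd_S; rewrite cardsD (setIidPr sTS) oddB ?subset_leq_card //.
  by case: a b (odd #|S|) (odd #|T|) {phi_b psi_a} => [] [] [] [].
case/orP=> odd_T.
  have := phi_b T; rewrite odd_T memv0 => /eqP phi0.
  have {}phi0 : (phi T : K) = 0 by exact: phi0.
  by rewrite phi0 mulr0 mul0r.
have := psi_a (S :\: T); rewrite odd_T memv0 => /eqP psi0.
have {}psi0 : ((psi : {ffun _ -> K^o}) (S :\: T) : K) = 0 by exact: psi0.
by rewrite psi0 mulr0.
Qed.

(* A superderivation is an operator whose homogeneous components satisfy the
   super Leibniz rule; by bilinearity it is enough to impose it on monomials. *)
Definition leibniz b S T (D : 'End(Lambda K n)) : Lambda K n :=
  op_part b D (gmul (xi S) (xi T))
  - (gmul (op_part b D (xi S)) (xi T)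
     + (-1) ^+ (b && odd #|S|) *: gmul (xi S) (op_part b D (xi T))).

Definition vect : {vspace 'End(Lambda K n)} :=
  (\bigcap_b \bigcap_S \bigcap_T lker (linfun (leibniz b S T)))%VS.

Lemma eq_on_part (W : vectType K) (f g : 'Hom(Lambda K n, W)) a :
  (forall S, odd #|S| = a -> f (xi S) = g (xi S)) ->
  {in part (Lambda K n) a, f =1 g}.
Proof.
move=> eq_fg phi /tensor_partP phi_a.
rewrite (tensor_sum (phi : {ffun _ -> scalars K})) !linear_sum.
apply: eq_bigr => S _.
have -> : pure ((phi : {ffun _ -> scalars K}) S) (monomial K S)
        = (phi : {ffun _ -> K^o}) S *: (xi S : Lambda K n).
  by apply/ffunP=> T; rewrite !ffunE; exact: mulrC.
rewrite !linearZ; have [odd_S | odd_S] := eqVneq (odd #|S|) a.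
  by congr (_ *: _); apply: eq_fg.
have odd_Sa : a (+) odd #|S| = true by case: (a) (odd _) odd_S => [] [].
have phiS0 : ((phi : {ffun _ -> K^o}) S : K) = 0.
  by have := phi_a S; rewrite odd_Sa memv0 => /eqP.
by rewrite phiS0; transitivity (0 : W); [apply: scale0r | apply/esym/scale0r].
Qed.

Lemma eq_on_xi (W : vectType K) (f g : 'Hom(Lambda K n, W)) :
  (forall S, f (xi S) = g (xi S)) -> f = g.
Proof.
move=> eq_fg; apply/lfunP=> phi; rewrite -(proj_sum phi) !linear_sum.
by apply: eq_bigr => a _; apply: eq_on_part (mem_proj a phi) => S _.
Qed.

Fact leibniz_is_linear b S T : linear (leibniz b S T).
Proof.
move=> k D E; rewrite /leibniz linearP !add_lfunE !scale_lfunE.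
rewrite gmul_is_linear_l gmul_is_linear_r.
rewrite scalerDr scalerA (mulrC _ k) -scalerA (addrACA (k *: _)) -scalerDr.
by rewrite opprD addrACA -scalerBr.
Qed.

Lemma vectP (D : 'End(Lambda K n)) :
  D \in vect <->
  forall a b (phi psi : Lambda K n), phi \in part (Lambda K n) a ->
    op_part b D (gmul phi psi) =
    gmul (op_part b D phi) psi + (-1) ^+ (b && a) *: gmul phi (op_part b D psi).
Proof.
have mem_vect : D \in vect <-> forall b S T, leibniz b S T D = 0.
  split=> [D_vect b S T | D0]; last first.
    rewrite memvE; apply/subv_bigcapP=> b _; apply/subv_bigcapP=> S _.
    apply/subv_bigcapP=> T _; rewrite -memvE memv_ker.
    by rewrite (linear_lfunE (@leibniz_is_linear b S T)) D0.
  apply/eqP; rewrite -(linear_lfunE (@leibniz_is_linear b S T)) -memv_ker memvE.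
  by move: D_vect; rewrite memvE => /subv_bigcapP/(_ b isT)
    /subv_bigcapP/(_ S isT)/subv_bigcapP/(_ T isT).
apply: (iff_trans mem_vect); split=> [D0 a b phi psi phi_a | Dleib b S T]; last first.
  by apply/eqP; rewrite subr_eq0; apply/eqP/Dleib/xi_part.
pose E := op_part b D.
have E_xi S (chi : Lambda K n) : E (gmul (xi S) chi) =
    gmul (E (xi S)) chi + (-1) ^+ (b && odd #|S|) *: gmul (xi S) (E chi).
  pose f := (E \o lmul (xi S))%VF.
  pose g := (lmul (E (xi S))
            + (-1) ^+ (b && odd #|S|) *: (lmul (xi S) \o E))%VF.
  have /lfunP/(_ chi) : f = g.
    apply: eq_on_xi => T; rewrite comp_lfunE add_lfunE scale_lfunE comp_lfunE.
    by rewrite !lmulE; apply/eqP; rewrite -subr_eq0; apply/eqP/D0.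
  by rewrite comp_lfunE add_lfunE scale_lfunE comp_lfunE !lmulE.
pose rmul chi : 'End(Lambda K n) := linfun (gmul^~ chi).
have rmulE chi theta : rmul chi theta = gmul theta chi.
  exact: (linear_lfunE (gmul_is_linear_l chi)).
pose f := (E \o rmul psi)%VF.
pose g := (rmul psi \o E + (-1) ^+ (b && a) *: rmul (E psi))%VF.
have := @eq_on_part _ f g a _ phi phi_a.
rewrite !comp_lfunE add_lfunE scale_lfunE comp_lfunE !rmulE; apply=> S odd_S.
by rewrite comp_lfunE add_lfunE scale_lfunE comp_lfunE !rmulE E_xi odd_S.
Qed.

End Grassmann.

Section Semidirect.
Variables (K : fieldType) (U : superspace K) (n : nat).
Implicit Types (A : 'End(U)) (X : 'End(Lambda K n)).

(* A (x) X sends v (x) psi to (-1)^(p(X)p(v)) A v (x) X psi. *)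
Definition tens_fun A X (w : {ffun {set 'I_n} -> U}) : {ffun {set 'I_n} -> U} :=
  \sum_S \sum_a \sum_b
    (-1) ^+ (a && b) *: pure (A (proj U a (w S))) (op_part b X (xi K S)).

Definition tens A X : 'End(tensor_Lambda U n) := linfun (tens_fun A X).

Fact tens_fun_is_linear A X : linear (tens_fun A X).
Proof.
move=> k w w'; rewrite /tens_fun scaler_sumr -big_split; apply: eq_bigr => S _.
rewrite scaler_sumr -big_split; apply: eq_bigr => a _.
rewrite scaler_sumr -big_split; apply: eq_bigr => b _ /=.
rewrite !ffunE !linearP pure_is_linear_l scalerDr !scalerA.
by rewrite (mulrC k).
Qed.

Lemma tensE A X a b v (psi : Lambda K n) : v \in part U a -> has_parity b X ->
  tens A X (pure v psi) = (-1) ^+ (a && b) *: pure (A v) (X psi).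
Proof.
move=> v_a X_b.
pose pr u : 'Hom(Lambda K n, tensor_Lambda U n) := linfun (pure u).
have prE u chi : pr u chi = pure u chi by apply: (linear_lfunE (pure_is_linear_r _)).
pose f := (tens A X \o pr v)%VF.
pose g := ((-1) ^+ (a && b) *: (pr (A v) \o X))%VF.
have /lfunP/(_ psi) : f = g.
  apply: eq_on_xi => S; rewrite scale_lfunE !comp_lfunE !prE.
  rewrite (linear_lfunE (@tens_fun_is_linear A X)) /tens_fun (bigD1 S) //=.
  rewrite [X in _ + X]big1 ?addr0 => [|T /negPf nTS]; last first.
    apply: big1 => c _; apply: big1 => d _.
    by rewrite !ffunE nTS scale0r !linear0 -(prE 0) /pr; apply/ffunP=> I; rewrite prE !ffunE !scaler0.
  rewrite (bigD1 a) //= [X in _ + X]big1 ?addr0 => [|c /negPf nca]; last first.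
    apply: big1 => d _; rewrite !ffunE eqxx scale1r (projE c v_a) nca linear0.
    by apply/ffunP=> I; rewrite !ffunE !scaler0.
  rewrite (bigD1 b) //= [X in _ + X]big1 ?addr0 => [|d /negPf ndb]; last first.
    rewrite (op_part_id d X_b) ndb zero_lfunE.
    by apply/ffunP=> I; rewrite !ffunE scale0r scaler0.
  by rewrite (op_part_id b X_b) eqxx !ffunE eqxx scale1r (proj_id v_a).
by rewrite scale_lfunE !comp_lfunE !prE.
Qed.

Fact tens_is_linear_l X : linear (tens^~ X).
Proof.
move=> k A B; apply/lfunP=> w; rewrite add_lfunE scale_lfunE.
rewrite !(linear_lfunE (@tens_fun_is_linear _ X)) /tens_fun.
rewrite scaler_sumr -big_split; apply: eq_bigr => S _.
rewrite scaler_sumr -big_split; apply: eq_bigr => a _.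
rewrite scaler_sumr -big_split; apply: eq_bigr => b _ /=.
by rewrite add_lfunE scale_lfunE pure_is_linear_l scalerDr !scalerA (mulrC k).
Qed.

Fact tens_is_linear_r A : linear (tens A).
Proof.
move=> k X Y; apply/lfunP=> w; rewrite add_lfunE scale_lfunE.
rewrite !(linear_lfunE (@tens_fun_is_linear A _)) /tens_fun.
rewrite scaler_sumr -big_split; apply: eq_bigr => S _.
rewrite scaler_sumr -big_split; apply: eq_bigr => a _.
rewrite scaler_sumr -big_split; apply: eq_bigr => b _ /=.
rewrite linearP add_lfunE scale_lfunE pure_is_linear_r scalerDr !scalerA.
by rewrite (mulrC k).
Qed.

(* The image in gl(V) of the semidirect sum of q(V_1) (x) Lambda(n) and vect(0|n):
   A (x) phi acts as A (x) (left multiplication by phi), and D as 1 (x) D. *)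
Definition queer_vect (J : 'End(U)) : {vspace 'End(tensor_Lambda U n)} :=
  (\sum_S (linfun (fun A => tens A (lmul (xi K S))) @: queer J)
   + (linfun (tens \1) @: vect K n))%VS.

Lemma queer_vectP J Z :
  Z \in queer_vect J <->
  exists (A : {set 'I_n} -> 'End(U)) (D : 'End(Lambda K n)),
    [/\ forall S, A S \in queer J, D \in vect K n
      & Z = \sum_S tens (A S) (lmul (xi K S)) + tens \1 D].
Proof.
have linl S := linear_lfunE (@tens_is_linear_l (lmul (xi K S))).
have linr := linear_lfunE (@tens_is_linear_r \1%VF).
split=> [/memv_addP[Z1 /memv_sumP[F F_in ->] [_ /memv_imgP[D D_in ->] ->]] |].
  have /fin_all_exists[A AP] S : exists A, A \in queer J /\ F S = tens A (lmul (xi K S)).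
    by have /memv_imgP[A A_in ->] := F_in S isT; exists A; rewrite linl.
  exists A, D; split=> // [S|]; first by case: (AP S).
  by rewrite linr; congr (_ + _); apply: eq_bigr => S _; case: (AP S).
case=> A [D [A_in D_in ->]]; apply: memv_add; last by rewrite -linr memv_img.
by apply: memv_sumr => S _; rewrite -linl memv_img.
Qed.

End Semidirect.

(* Main.v *)
Require Import Defs.
From HB Require Import structures.
From mathcomp Require Import all_boot all_order all_algebra falgebra.
From mathcomp Require Import reals complex.
From Stdlib Require Import Classical.

Set Implicit Arguments.
Unset Strict Implicit.
Unset Printing Implicit Defensive.

Import GRing.Theory.
Local Open Scope ring_scope.

(** The supercentralizer q(V) of [J1 (x) 1] is q(V_1) (x) D, where D = End Lambda(n)
is generated by the multiplications xi_i and the derivations d_i, which satisfy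
the Clifford relations; its elements are thus differential operators in the
xi_i with coefficients in q(V_1).  In q(V) the algebra g is the set of operators
of order at most one whose first order part has scalar coefficients.  Said
without coordinates, g is the normalizer of Lambda(n): an element Z of q(V) is
in g if and only if all the brackets [xi_i, Z] are in Lambda(n)
([normalizer_queer_vect], [queer_vect_normalizer]).  In this form it is closed
under the bracket by the Jacobi identity.

The queer trace vanishes on brackets of q(V).  An element killed by ad xi_i or
by ad d_i is such a bracket ([gen_homotopy]), and so is one that supercommutes
with the odd central element eps of q(V_1), because [eps, eps Z] = 2 Z.  Every
element of g is a sum of two such elements ([trace_normalizer]), so g lies in
sq(V).

For maximality let H be a subalgebra of sq(V) that contains g strictly.  The 2n
operators ad xi_i and ad d_i preserve H and g, anticommute and have square
zero; hence the nonzero space H / g has a vector that they all kill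
([singular_vector]).  Modulo g such a vector is
sum c_ij d_i d_j + sum a_i d_i with c_ij scalar and a_i in q(V_1), and
bracketing with the Euler operators xi_i d_i isolates one term.  If some c_ij
is nonzero, then d_i d_j is in H, and [a xi_i, d_i d_j] = +- a d_j shows that
q(V_1) d_j is in H.  Otherwise some a_i is not scalar; the set of all a such
that a d_i is in H is then stable under enough operations to be the whole of
q(V_1) ([queer_ideal_full]).  So H contains q(V_1) d_j for all j
([saturated_d]).

Next, if X, Y and their multiples by eps are in H, then [X, Y] and
[eps X, eps Y] combine to 2 X Y; in this way H contains all of D.  Bracketing D
with q(V_1) xi_i and q(V_1) d_i, one finds in H every element of q(V) that is
killed by some ad xi_i or some ad d_i ([killed_in_H]).  Modulo these, an element
of q(V) is a multiple c E of E = prod_i xi_i d_i with c in q(V_1), and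
[q(V_1), q(V_1)] E is in H as well.  What is left of q(V) / H is at most
one-dimensional ([H_codim1]).  Since the queer trace does not vanish on q(V),
H has codimension one and equals sq(V). *)

(** * Identities in noncommutative rings *)

Inductive nc_expr :=
  | NCvar of nat | NCzero | NCone
  | NCadd of nc_expr & nc_expr | NCopp of nc_expr | NCmul of nc_expr & nc_expr.

Section NoncommutativeRing.
Variable R : pzRingType.
Implicit Types (e : nc_expr) (s : seq (bool * seq nat)).

Fixpoint nc_eval (env : seq R) e : R :=
  match e with
  | NCvar i => env`_i
  | NCzero => 0
  | NCone => 1
  | NCadd e1 e2 => nc_eval env e1 + nc_eval env e2
  | NCopp e1 => - nc_eval env e1
  | NCmul e1 e2 => nc_eval env e1 * nc_eval env e2
  end.

Fixpoint nc_norm e : seq (bool * seq nat) :=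
  match e with
  | NCvar i => [:: (false, [:: i])]
  | NCzero => [::]
  | NCone => [:: (false, [::])]
  | NCadd e1 e2 => nc_norm e1 ++ nc_norm e2
  | NCopp e1 => [seq (~~ x.1, x.2) | x <- nc_norm e1]
  | NCmul e1 e2 =>
      [seq (x.1 (+) y.1, x.2 ++ y.2) | x <- nc_norm e1, y <- nc_norm e2]
  end.

(** A signed monomial cancels against its opposite, so that the normal form of
zero is the empty sequence. *)
Definition nc_insert (x : bool * seq nat) s :=
  if (~~ x.1, x.2) \in s then rem (~~ x.1, x.2) s else x :: s.

Definition nc_monomial (env : seq R) (x : bool * seq nat) : R :=
  (-1) ^+ x.1 * \prod_(i <- x.2) env`_i.

Lemma nc_normE env e :
  nc_eval env e = \sum_(x <- nc_norm e) nc_monomial env x.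
Proof.
elim: e => [i|||e1 IH1 e2 IH2|e1 IH1|e1 IH1 e2 IH2] /=.
- by rewrite big_seq1 /nc_monomial big_seq1 mul1r.
- by rewrite big_nil.
- by rewrite big_seq1 /nc_monomial big_nil mul1r.
- by rewrite big_cat IH1 IH2.
- rewrite IH1 big_map -sumrN; apply: eq_bigr => -[b w] _.
  by rewrite /nc_monomial /=; case: b; rewrite !mulNr ?opprK mul1r.
rewrite IH1 IH2 big_allpairs_dep mulr_suml; apply: eq_bigr => -[b w] _.
rewrite mulr_sumr; apply: eq_bigr => -[c v] _; rewrite /nc_monomial /= big_cat /=.
by case: b c => [] []; rewrite /= ?(mulN1r, mul1r, mulNr, mulrN, opprK).
Qed.

Lemma nc_insertE env x s : \sum_(y <- nc_insert x s) nc_monomial env y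
  = nc_monomial env x + \sum_(y <- s) nc_monomial env y.
Proof.
rewrite /nc_insert; case: ifP => [s_x|_]; last by rewrite big_cons.
rewrite (perm_big _ (perm_to_rem s_x)) big_cons /= addrA.
have -> : nc_monomial env x + nc_monomial env (~~ x.1, x.2) = 0.
  case: x {s_x} => -[] w; rewrite /nc_monomial /= mulN1r mul1r; first exact: addNr.
  exact: subrr.
by rewrite add0r.
Qed.

Lemma nc_insert_allE env s : \sum_(y <- foldr nc_insert [::] s) nc_monomial env y
  = \sum_(y <- s) nc_monomial env y.
Proof. by elim: s => // x s IHs; rewrite big_cons -IHs -nc_insertE. Qed.

(** The condition is decided by computation: this is what [ncring] runs. *)
Lemma nc_eq env e1 e2 :
  nilp (foldr nc_insert [::] (nc_norm (NCadd e1 (NCopp e2)))) ->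
  nc_eval env e1 = nc_eval env e2.
Proof.
move=> /nilP s_nil; apply/eqP; rewrite -subr_eq0.
rewrite -[_ - _]/(nc_eval env (NCadd e1 (NCopp e2))).
by rewrite nc_normE -nc_insert_allE s_nil big_nil.
Qed.

End NoncommutativeRing.

Ltac nc_index x l :=
  lazymatch l with
  | cons x _ => constr:(O)
  | cons _ ?t => let i := nc_index x t in constr:(S i)
  end.

Ltac nc_mem x l :=
  lazymatch l with
  | nil => constr:(false)
  | cons x _ => constr:(true)
  | cons _ ?t => nc_mem x t
  end.

Ltac nc_atoms R t l :=
  lazymatch t with
  | (?a + ?b)%R => let l := nc_atoms R a l in nc_atoms R b l
  | (- ?a)%R => nc_atoms R a l
  | (?a * ?b)%R => let l := nc_atoms R a l in nc_atoms R b l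
  | 0%R => l
  | 1%R => l
  | _ => lazymatch nc_mem t l with true => l | false => constr:(@cons R t l) end
  end.

Ltac nc_reify t l :=
  lazymatch t with
  | (?a + ?b)%R =>
      let u := nc_reify a l in let v := nc_reify b l in constr:(NCadd u v)
  | (- ?a)%R => let u := nc_reify a l in constr:(NCopp u)
  | (?a * ?b)%R =>
      let u := nc_reify a l in let v := nc_reify b l in constr:(NCmul u v)
  | 0%R => constr:(NCzero)
  | 1%R => constr:(NCone)
  | _ => let i := nc_index t l in constr:(NCvar i)
  end.

(** Commutation rules are not part of the normal form.  An identity that needs
some is proved by exposing the products to be exchanged with [ncring], and then
by rewriting. *)
Ltac ncring :=
  lazymatch goal with
  | |- @eq ?R ?a ?b =>
      let l := nc_atoms R a (@nil R) in
      let l := nc_atoms R b l in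
      let u := nc_reify a l in
      let v := nc_reify b l in
      refine (@nc_eq _ l u v _); vm_compute; reflexivity
  end.

(** * Matrix units *)

Section MatrixUnits.
Variables (K : fieldType) (m : nat).
Implicit Types (A B : 'M[K]_m) (i j k l r s t : 'I_m).
Local Notation e i j := (delta_mx i j : 'M[K]_m).

Lemma delta_mulmxE i j A k l : (e i j *m A) k l = (k == i)%:R * A j l.
Proof.
rewrite !mxE (bigD1 j) //= big1 => [|r /negPf nrj].
  by rewrite !mxE eqxx andbT addr0.
by rewrite !mxE nrj andbF mul0r.
Qed.

Lemma mulmx_deltaE A i j k l : (A *m e i j) k l = A k i * (l == j)%:R.
Proof.
rewrite !mxE (bigD1 i) //= big1 => [|r /negPf nri].
  by rewrite !mxE eqxx addr0.
by rewrite !mxE nri mulr0.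
Qed.

Lemma delta_mulmx_delta i j A k l : e i j *m A *m e k l = A j k *: e i l.
Proof.
apply/matrixP=> a b; rewrite mulmx_deltaE delta_mulmxE !mxE.
by case: (a == i); case: (b == l); rewrite ?(mul0r, mulr0, mul1r, mulr1).
Qed.

Lemma mul_deltaE i j k l : e i j *m e k l = (j == k)%:R *: e i l.
Proof. by rewrite mul_delta_mx_cond scaler_nat. Qed.

Variable U : 'M[K]_m -> Prop.
Hypotheses (UB : forall A B, U A -> U B -> U (A - B))
           (UZ : forall (k : K) A, U A -> U (k *: A)).

Lemma stable_div (k : K) A : k != 0 -> U (k *: A) -> U A.
Proof. by move=> k0 /(UZ k^-1); rewrite scalerA mulVf // scale1r. Qed.

Lemma stable_add A B : U A -> U B -> U (A + B).
Proof.
move=> UA UB'; have -> : A + B = A - (-1) *: B by rewrite scaleN1r opprK.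
by apply: UB => //; apply: UZ.
Qed.

Lemma stable_sum A (I : finType) (F : I -> 'M_m) :
  U A -> (forall x, U (F x)) -> U (\sum_x F x).
Proof.
move=> UA UF; elim/big_ind: _ => // [|X Y]; last exact: stable_add.
by rewrite -(scale0r A); apply: UZ.
Qed.

(** If [A t s] is a nonzero off-diagonal entry, then [[e_st, [e_st, A]]] is
[- 2 A_ts e_st]; if [A] is diagonal, then [[e_st, A] = (A_tt - A_ss) e_st]. *)
Lemma lie_ideal_delta (two : (2%:R : K) != 0) :
  (forall B A, U A -> U (B *m A - A *m B)) ->
  forall A, U A -> ~~ is_scalar_mx A -> exists s t, s != t /\ U (e s t).
Proof.
move=> Uad A UA nscalA.
have [Adiag | /is_diag_mxP] := boolP (is_diag_mx A); last first.
  move=> nd; have [/forallP h|] := boolP [forall i, forall j, (i != j) ==> (A i j == 0)].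
    by case: nd => i j nij; apply/eqP/(implyP (forallP (h i) j)).
  case/forallPn=> t /forallPn[s]; rewrite negb_imply => /andP[nts Ats].
  exists s, t; split; first by rewrite eq_sym.
  have Uc := Uad (e s t) _ (Uad (e s t) _ UA); apply: (@stable_div (- (2%:R * A t s))).
    by rewrite oppr_eq0 mulf_neq0.
  move: Uc; congr U; rewrite mulmxBr mulmxBl !mulmxA mul_deltaE (negPf nts) scale0r.
  rewrite mul0mx -!mulmxA mul_deltaE (negPf nts) scale0r !mulmx0.
  rewrite mulmxA delta_mulmx_delta sub0r subr0 -opprD -scalerDl scaleNr.
  by congr (- (_ *: _)); rewrite mulr_natl.
have [/forallP h|] := boolP [forall i, forall j, A i i == A j j].
  case/is_scalar_mxP: nscalA; have [m0|m_gt0] := posnP m.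
    by exists 0; apply/matrixP=> -[i lti]; exfalso; move: lti; rewrite m0.
  pose r0 := Ordinal m_gt0; exists (A r0 r0); apply/matrixP=> i j; rewrite !mxE.
  have [<-|nij] := eqVneq i j; first exact/eqP/(forallP (h i)).
  by move/is_diag_mxP: Adiag => ->.
case/forallPn=> s /forallPn[t nst]; exists s, t; split.
  by apply: contraNneq nst => ->.
apply: (@stable_div (A t t - A s s)); first by rewrite subr_eq0 eq_sym.
have AE i j : A i j = A i i * (i == j)%:R.
  have [<-|nij] := eqVneq i j; first by rewrite mulr1.
  by move/is_diag_mxP: Adiag => ->; rewrite ?mulr0.
move: (Uad (e s t) _ UA); congr U; apply/matrixP=> i j.
have subE (X Y : 'M[K]_m) : (X - Y) i j = X i j - Y i j by rewrite !mxE.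
rewrite subE delta_mulmxE mulmx_deltaE AE (AE i) !mxE.
have [->|nis] := eqVneq i s; last by rewrite mul0r mulr0 mul0r subr0 mulr0.
by rewrite mul1r mulr1 eq_sym -mulrBl.
Qed.

End MatrixUnits.

(** The algebra q(m) consists of the [A + eps B] with [A], [B] in gl(m).  Here [P0]
and [P1] describe the even elements [A] and the odd elements [eps B] such that
[A d] and [eps B d] are in a given subalgebra, [d] being a derivation; the
hypotheses of stability are the brackets with q(m) and with q(m) [xi].  From a
nonscalar element one obtains a matrix unit [e_st] in [P1], then [e_ss] in [P0],
then all the [e_rr] in [P1], and so [eps] itself, which generates the rest. *)
Lemma queer_ideal_full (K : fieldType) (m : nat) (P0 P1 : 'M[K]_m -> Prop) :
  (2%:R : K) != 0 ->
  (forall A B, P0 A -> P0 B -> P0 (A - B)) ->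
  (forall (k : K) A, P0 A -> P0 (k *: A)) ->
  (forall A B, P1 A -> P1 B -> P1 (A - B)) ->
  (forall (k : K) A, P1 A -> P1 (k *: A)) ->
  (forall B A, P0 A -> P0 (B *m A - A *m B)) ->
  (forall B A, P1 A -> P1 (B *m A - A *m B)) ->
  (forall B A, P0 A -> P1 (B *m A - A *m B)) ->
  (forall B A, P1 A -> P0 (B *m A + A *m B)) ->
  (forall C B A, P0 C -> P0 A -> P1 (C *m (B *m A - A *m B))) ->
  P0 1%:M ->
  forall A B, P0 A -> P1 B -> ~~ is_scalar_mx A \/ B != 0 ->
  forall C, P0 C /\ P1 C.
Proof.
move=> two P0B P0Z P1B P1Z ad00 ad11 ad01 ad10 mul01 P0_1 A B P0A P1B' AB.
have P0_div := stable_div P0Z; have P1_div := stable_div P1Z.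
have two_scale (X : 'M[K]_m) : X + X = 2%:R *: X by rewrite scaler_nat mulr2n.
(* Once eps is there: [eps b, eps] = 2 b gives P0, and then c [b, a] gives P1. *)
suff P1_1 : P1 1%:M.
  have P0C C : P0 C.
    apply: (@P0_div 2%:R) => //; rewrite -two_scale.
    by move: (ad10 C _ P1_1); rewrite mulmx1 mul1mx.
  have P1e s t : P1 (delta_mx s t).
    (* e_kt is a commutator when k <> t; when m = 1 there is nothing but eps. *)
    have [k /= nkt|all_t] := pickP (fun k => k != t).
      rewrite -(mul_delta_mx k).
      have -> : delta_mx k t = delta_mx k t *m delta_mx t t - delta_mx t t *m delta_mx k t :> 'M[K]_m.
        by rewrite !mul_deltaE eqxx scale1r eq_sym (negPf nkt) scale0r subr0.
      exact: mul01.
    have -> : delta_mx s t = 1%:M :> 'M[K]_m; last by [].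
    apply/matrixP=> i j; rewrite !mxE.
    have allE k : k = t by apply/eqP/negPn; rewrite all_t.
    by rewrite (allE i) (allE j) (allE s) !eqxx.
  move=> C; split=> //; rewrite (matrix_sum_delta C).
  by apply: (stable_sum P1B P1Z P1_1) => i; apply: (stable_sum P1B P1Z P1_1) => j; apply: P1Z.
have P1_1_of s t : s != t -> P1 (delta_mx s t) -> P1 1%:M.
  move=> nst P1st; have nts : t != s by rewrite eq_sym.
  have P0s : P0 (delta_mx s s).
    apply: (@P0_div (- 2%:R)); first by rewrite oppr_eq0.
    have := ad10 (delta_mx s s) _ (ad11 (delta_mx t s) _ P1st).
    rewrite mulmxBr mulmxBl !mul_deltaE !eqxx !scale1r !mul_deltaE eqxx.
    rewrite (negPf nst) (negPf nts) !scale0r scale1r !sub0r -opprD two_scale.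
    by rewrite scaleNr.
  have P0rs r : r != s -> P0 (delta_mx r s).
    move=> nrs; have := ad00 (delta_mx r s) _ P0s.
    by rewrite !mul_deltaE eqxx scale1r eq_sym (negPf nrs) scale0r subr0.
  have P0sr r : r != s -> P0 (delta_mx s r).
    move=> nrs; apply: (@P0_div (-1)); first by rewrite oppr_eq0 oner_eq0.
    have := ad00 (delta_mx s r) _ P0s.
    by rewrite !mul_deltaE eqxx scale1r (negPf nrs) scale0r sub0r scaleN1r.
  rewrite mx1_sum_delta; apply: (stable_sum P1B P1Z P1st) => r.
  have [->|nrs] := eqVneq r s.
    have := mul01 _ (delta_mx t s) _ (P0sr t nts) P0s.
    rewrite !mul_deltaE eqxx (negPf nst) scale0r scale1r subr0.
    by rewrite mul_deltaE eqxx scale1r.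
  apply: (@P1_div (-1)); first by rewrite oppr_eq0 oner_eq0.
  have := mul01 _ (delta_mx s r) _ (P0rs r nrs) P0s.
  rewrite !mul_deltaE eqxx (negPf nrs) scale0r scale1r sub0r mulmxN.
  by rewrite mul_deltaE eqxx scale1r scaleN1r.
have [/is_scalar_mxP[k Bk] | Bnscal] := boolP (is_scalar_mx B); last first.
  have [s [t [nst P1st]]] := lie_ideal_delta P1Z two ad11 P1B' Bnscal.
  exact: P1_1_of nst P1st.
case: AB => [Anscal | B0].
  have [s [t [nst P0st]]] := lie_ideal_delta P0Z two ad00 P0A Anscal.
  apply: (P1_1_of s t nst); have := ad01 (delta_mx s s) _ P0st.
  by rewrite !mul_deltaE eqxx scale1r eq_sym (negPf nst) scale0r subr0.
apply: (@P1_div k); last by rewrite scalemx1 -Bk.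
by apply: contraNneq B0 => k0; rewrite Bk k0 raddf0.
Qed.

(** [e_ij = [e_ij, e_jj]] if [i] and [j] differ, and
[e_jj - e_00 = [e_j0, e_0j]]: modulo commutators, a matrix is determined by its
trace. *)
Lemma commutators_span (K : fieldType) (m : nat) (U : 'M[K]_m -> Prop) (r0 : 'I_m) :
  (forall A B, U A -> U B -> U (A - B)) ->
  (forall (k : K) A, U A -> U (k *: A)) ->
  (forall A B, U (A *m B - B *m A)) ->
  forall A, U (A - \tr A *: delta_mx r0 r0).
Proof.
move=> UB UZ Ucomm A; have U0 : U 0 by move: (Ucomm 0 0); rewrite !mulmx0 subr0.
have -> : A - \tr A *: delta_mx r0 r0
    = \sum_i \sum_j A i j *: (delta_mx i j - (i == j)%:R *: delta_mx r0 r0).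
  under eq_bigr => i _.
    under eq_bigr => j _ do rewrite scalerBr.
    rewrite sumrB; over.
  rewrite sumrB -matrix_sum_delta; congr (_ - _); rewrite /mxtrace scaler_suml.
  apply: eq_bigr => i _; rewrite (bigD1 i) //= eqxx scale1r big1 ?addr0 // => j.
  by rewrite eq_sym => /negPf->; rewrite scale0r scaler0.
apply: (stable_sum UB UZ U0) => i; apply: (stable_sum UB UZ U0) => j; apply: UZ.
have [->|nij] := eqVneq i j.
  rewrite scale1r; move: (Ucomm (delta_mx j r0) (delta_mx r0 j)).
  by rewrite !mul_delta_mx.
rewrite scale0r subr0; move: (Ucomm (delta_mx i j) (delta_mx j j)).
by rewrite mul_delta_mx mul_deltaE eq_sym (negPf nij) scale0r subr0.
Qed.

(** * Differential operators with coefficients in a queer superalgebra *)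

(** What the argument uses of the algebra q(V) = q(m) (x) End Lambda(n) inside
[E = End V].  The automorphism [sg] is 1 on the even part and -1 on the odd
part.  [gen false i] is the multiplication by xi_i and [gen true i] the
derivation d_i: with both kinds in one family, each statement that is symmetric
under their exchange is proved once.  [iota] embeds gl(m) as the even part of
q(m), and [eps] is the odd involution of q(m) that commutes with gl(m).  The last
field says that q(m) is the supercommutant of the generators in q(V). *)
Record queer_clifford (K : fieldType) (E : falgType K) (m n : nat) :=
  QueerClifford {
  sg : E -> E;
  gen : bool -> 'I_n -> E;
  iota : 'M[K]_m -> E;
  eps : E;
  queer_alg : {vspace E};
  two_neq0 : (2%:R : K) != 0;
  sg_is_linear : linear sg;
  sg_is_monoid : monoid_morphism sg;
  sgK : involutive sg;
  sg_gen : forall b i, sg (gen b i) = - gen b i;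
  genM : forall b c i j,
    gen b i * gen c j + gen c j * gen b i = ((b != c) && (i == j))%:R;
  iota_is_linear : linear iota;
  iota1 : iota 1%:M = 1;
  iotaM : forall A B, iota (A *m B) = iota A * iota B;
  sg_iota : forall A, sg (iota A) = iota A;
  iota_gen : forall A b i, gen b i * iota A = iota A * gen b i;
  sg_eps : sg eps = - eps;
  eps2 : eps * eps = 1;
  eps_iota : forall A, iota A * eps = eps * iota A;
  eps_gen : forall b i, gen b i * eps = - (eps * gen b i);
  queer_algM : forall X Y, X \in queer_alg -> Y \in queer_alg -> X * Y \in queer_alg;
  queer_alg_sg : forall X, X \in queer_alg -> sg X \in queer_alg;
  queer_alg_gen : forall b i, gen b i \in queer_alg;
  queer_alg_iota : forall A, iota A \in queer_alg;
  queer_alg_eps : eps \in queer_alg;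
  queer_alg_coef : forall Z, Z \in queer_alg ->
    (forall b i, gen b i * Z = sg Z * gen b i) ->
    exists A B, Z = iota A + eps * iota B }.

HB.instance Definition _ (K : fieldType) (E : falgType K) m n
  (S : queer_clifford E m n) :=
  GRing.isLinear.Build K E E *:%R (sg S) (sg_is_linear S).
HB.instance Definition _ (K : fieldType) (E : falgType K) m n
  (S : queer_clifford E m n) :=
  GRing.isMonoidMorphism.Build E E (sg S) (sg_is_monoid S).
HB.instance Definition _ (K : fieldType) (E : falgType K) m n
  (S : queer_clifford E m n) :=
  GRing.isLinear.Build K 'M[K]_m E *:%R (iota S) (iota_is_linear S).

Section Theory.
Variables (K : fieldType) (E : falgType K) (m n : nat).
Variable S : queer_clifford E m n.
Local Notation sg := (sg S).
Local Notation gen := (gen S).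
Local Notation xi := (gen false).
Local Notation d := (gen true).
Local Notation iota := (iota S).
Local Notation eps := (eps S).
Local Notation Q := (queer_alg S).
Implicit Types (X Y Z : E) (H : {vspace E}).

Let two := two_neq0 S.

Lemma opp_eq0 X : X = - X -> X = 0.
Proof.
move/eqP; rewrite -subr_eq0 opprK -mulr2n -scaler_nat scaler_eq0 (negPf two) /=.
by move/eqP.
Qed.

(** The super bracket with an odd [x].  Writing the sign by means of [sg] allows [Y]
to be inhomogeneous. *)
Definition odd_comm x Y := x * Y - sg Y * x.
Local Notation oc := odd_comm.

Fact oc_is_linear x : linear (oc x).
Proof.
move=> k Y Z; rewrite /oc linearP mulrDr mulrDl -scalerAr -scalerAl.
by rewrite scalerBr opprD addrACA.
Qed.
HB.instance Definition _ x :=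
  GRing.isLinear.Build K E E *:%R (oc x) (oc_is_linear x).

Lemma ocM x Y Z : oc x (Y * Z) = oc x Y * Z + sg Y * oc x Z.
Proof. by rewrite /oc rmorphM mulrBl mulrBr !mulrA addrA subrK. Qed.

Lemma sg_oc x Y : sg x = - x -> sg (oc x Y) = - oc x (sg Y).
Proof. by move=> sx; rewrite /oc rmorphB !rmorphM /= sx sgK mulNr mulrN opprK opprB addrC. Qed.

Lemma sg_oc_gen b i Y : sg (oc (gen b i) Y) = - oc (gen b i) (sg Y).
Proof. by rewrite sg_oc ?sg_gen. Qed.

Lemma oc_gen b i c j : oc (gen b i) (gen c j) = ((b != c) && (i == j))%:R.
Proof. by rewrite /oc sg_gen mulNr opprK genM. Qed.

Lemma oc_genM b i c j Z : oc (gen b i) (gen c j * Z)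
  = ((b != c) && (i == j))%:R * Z - gen c j * oc (gen b i) Z.
Proof. by rewrite ocM oc_gen sg_gen mulNr. Qed.

Lemma gen_sq b i : gen b i * gen b i = 0.
Proof.
apply: opp_eq0; apply/eqP; rewrite -subr_eq0 opprK genM.
by rewrite eqxx.
Qed.

(** By the Jacobi identity, because the bracket of two generators is scalar. *)
Lemma oc_anticomm b i c j Y :
  oc (gen b i) (oc (gen c j) Y) = - oc (gen c j) (oc (gen b i) Y).
Proof.
set r := gen b i * gen c j + gen c j * gen b i.
have r_central : r * Y = Y * r.
  by rewrite /r genM; case: (_ && _); rewrite ?mul1r ?mulr1 ?mul0r ?mulr0.
rewrite {1 3}/oc !sg_oc_gen /oc !sgK.
apply/eqP; rewrite -subr_eq0; apply/eqP; transitivity (r * Y - Y * r).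
  rewrite /r; ncring.
by rewrite r_central subrr.
Qed.

Lemma oc_sq b i Y : oc (gen b i) (oc (gen b i) Y) = 0.
Proof. exact/opp_eq0/oc_anticomm. Qed.

Lemma oc_gen0P b i Z : oc (gen b i) Z = 0 <-> gen b i * Z = sg Z * gen b i.
Proof. by split=> [/eqP | h]; [rewrite subr_eq0 => /eqP | rewrite /oc h subrr]. Qed.

(** The bracket with a generator is a differential, and the multiplication by the
conjugate generator is a contracting homotopy. *)
Lemma gen_homotopy b i Z :
  oc (gen b i) Z = 0 -> Z = oc (gen b i) (gen (~~ b) i * Z).
Proof. by move=> Z0; rewrite oc_genM Z0 mulr0 subr0 eqxx; case: b {Z0} => /=; rewrite mul1r. Qed.

Lemma sg_gen0 b i Z : oc (gen b i) Z = 0 -> oc (gen b i) (sg Z) = 0.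
Proof. by move=> Z0; rewrite -[LHS]opprK -sg_oc_gen Z0 rmorph0 oppr0. Qed.

Lemma oc_iota b i A : oc (gen b i) (iota A) = 0.
Proof. by rewrite /oc sg_iota iota_gen subrr. Qed.

Lemma oc_eps b i : oc (gen b i) eps = 0.
Proof. by rewrite /oc sg_eps mulNr opprK eps_gen addNr. Qed.

Lemma oc_coef b i A B : oc (gen b i) (iota A + eps * iota B) = 0.
Proof. by rewrite linearD /= ocM !oc_iota oc_eps mul0r mulr0 !addr0. Qed.

Lemma queer_alg1 : 1 \in Q.
Proof. by rewrite -(iota1 S) queer_alg_iota. Qed.

Lemma queer_alg_oc x Y : x \in Q -> Y \in Q -> oc x Y \in Q.
Proof. by move=> Qx QY; rewrite memvB ?queer_algM ?queer_alg_sg. Qed.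

Lemma queer_alg_coefs A B : iota A + eps * iota B \in Q.
Proof. by rewrite memvD ?queer_algM ?queer_alg_iota ?queer_alg_eps. Qed.

(** The element [Z] is the sum of [Z - g' [g, Z]] and [g' [g, Z]], where [g'] is the
generator conjugate to [g]; the first summand and [[g, Z]] are killed by [g].
Repeating this for every generator of the list [s], one writes [Z] in terms of
products by the conjugates and of elements that are killed by all of [s]. *)
Lemma gen_ind (P U : E -> Prop) (s : seq (bool * 'I_n)) :
  (forall X Y, P X -> P Y -> P (X - Y)) ->
  (forall X Y, U X -> U Y -> U (X + Y)) ->
  (forall p Z, p \in s -> P Z ->
     P (oc (gen p.1 p.2) Z) /\ P (gen (~~ p.1) p.2 * oc (gen p.1 p.2) Z)) ->
  (forall p Z, p \in s -> P Z -> U (oc (gen p.1 p.2) Z) ->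
     U (gen (~~ p.1) p.2 * oc (gen p.1 p.2) Z)) ->
  (forall Z, P Z -> {in s, forall p, oc (gen p.1 p.2) Z = 0} -> U Z) ->
  forall Z, P Z -> U Z.
Proof.
move=> PB UD; elim: s => [|p s IHs] Pstep Ustep base; first by move=> Z PZ; apply: base.
apply: IHs => [q Z sq|q Z sq|Z PZ Z0].
- by apply: Pstep; rewrite inE sq orbT.
- by apply: Ustep; rewrite inE sq orbT.
have [PZ1 PZ2] := Pstep p Z (mem_head _ _) PZ.
set Z1 := oc _ Z in PZ1 PZ2 *; set g := gen (~~ p.1) p.2 in PZ2 *.
have Z1_0 : {in p :: s, forall q, oc (gen q.1 q.2) Z1 = 0}.
  move=> q; rewrite inE => /predU1P[-> | /Z0 q0]; first exact: oc_sq.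
  by rewrite oc_anticomm q0 linear0 oppr0.
have UZ1 : U Z1 by apply: base.
have UZ2 : U (g * Z1) by apply: Ustep; rewrite ?mem_head.
rewrite -(subrK (g * Z1) Z); apply: UD => //; apply: base; first exact: PB.
move=> q; rewrite inE => q_s; rewrite linearB /= oc_genM (Z1_0 _ q_s) mulr0 subr0.
have [-> | neq_qp] := eqVneq q p.
  have -> : p.1 != ~~ p.1 by case: p.1.
  by rewrite eqxx mul1r subrr.
move: q_s; rewrite (negPf neq_qp) => /Z0->.
case: (boolP (_ && _)) => [/andP[neq /eqP eq2]|]; last by rewrite mul0r subrr.
by case/eqP: neq_qp; apply/eqP; rewrite -pair_eqE /pair_eq eq2 eqxx andbT; case: q.1 p.1 neq => [] [].
Qed.

Record supercentral (Z : E) : Prop := BuildSupercentral {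
  supercentral_iota : forall A, iota A * Z = Z * iota A;
  supercentral_eps : eps * Z = sg Z * eps }.

Lemma supercentralB X Y : supercentral X -> supercentral Y -> supercentral (X - Y).
Proof.
case=> Xi Xe [Yi Ye]; split=> [A|]; first by rewrite mulrBr Xi Yi mulrBl.
by rewrite mulrBr Xe Ye linearB mulrBl.
Qed.

Lemma supercentralM X Y : supercentral X -> supercentral Y -> supercentral (X * Y).
Proof.
case=> Xi Xe [Yi Ye]; split=> [A|]; first by rewrite mulrA Xi -mulrA Yi mulrA.
by rewrite mulrA Xe -mulrA Ye mulrA rmorphM.
Qed.

Lemma supercentralZ k X : supercentral X -> supercentral (k *: X).
Proof.
case=> Xi Xe; split=> [A|]; first by rewrite -scalerAr Xi scalerAl.
by rewrite -scalerAr Xe linearZ scalerAl.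
Qed.

Lemma supercentral1 : supercentral 1.
Proof. by split=> [A|]; rewrite ?rmorph1; ncring. Qed.

Lemma supercentral_sg X : supercentral X -> supercentral (sg X).
Proof.
case=> Xi Xe; split=> [A|]; first by rewrite -(sg_iota S A) -!rmorphM Xi.
move: (congr1 sg Xe); rewrite !rmorphM /= sgK sg_eps mulNr mulrN.
exact: oppr_inj.
Qed.

Lemma supercentral_gen b i : supercentral (gen b i).
Proof. by split=> [A|]; rewrite ?iota_gen // sg_gen mulNr eps_gen opprK. Qed.

Lemma supercentral_oc b i X : supercentral X -> supercentral (oc (gen b i) X).
Proof.
move=> cX; apply: supercentralB; apply: supercentralM => //; try exact: supercentral_gen.
exact: supercentral_sg.
Qed.

(** The multiplications by elements of Lambda(n).  In the Clifford algebra they are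
the supercommutant of the xi_i; the second condition excludes coefficients in
q(m). *)
Record Grassmann (Z : E) : Prop := BuildGrassmann {
  GrassmannQ : Z \in Q;
  Grassmann_central : supercentral Z;
  Grassmann_xi : forall i, oc (xi i) Z = 0 }.

(** The normalizer of Lambda(n), stated on generators only; it is the algebra g.  See
[normalizer_Grassmann_even] and [normalizer_Grassmann_odd] for the stability of
the whole of Lambda(n). *)
Record normalizer (Z : E) : Prop := BuildNormalizer {
  normalizerQ : Z \in Q;
  normalizer_xi : forall i, Grassmann (oc (xi i) Z) }.

Lemma GrassmannB X Y : Grassmann X -> Grassmann Y -> Grassmann (X - Y).
Proof.
move=> [QX cX X0] [QY cY Y0]; split; [by rewrite memvB | exact: supercentralB |].
by move=> i; rewrite linearB /= X0 Y0 subrr.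
Qed.

Lemma GrassmannZ k X : Grassmann X -> Grassmann (k *: X).
Proof.
move=> [QX cX X0]; split; [by rewrite memvZ | exact: supercentralZ |].
by move=> i; rewrite linearZ /= X0 scaler0.
Qed.

Lemma GrassmannN X : Grassmann X -> Grassmann (- X).
Proof. by rewrite -scaleN1r; apply: GrassmannZ. Qed.

Lemma GrassmannD X Y : Grassmann X -> Grassmann Y -> Grassmann (X + Y).
Proof. by move=> LX LY; rewrite -[Y]opprK; apply/GrassmannB/GrassmannN. Qed.

Lemma Grassmann1 : Grassmann 1.
Proof.
split; [exact: queer_alg1 | exact: supercentral1 |].
by move=> i; rewrite /oc rmorph1; ncring.
Qed.

Lemma Grassmann0 : Grassmann 0.
Proof. by rewrite -(scale0r 1); apply/GrassmannZ/Grassmann1. Qed.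

Lemma GrassmannM X Y : Grassmann X -> Grassmann Y -> Grassmann (X * Y).
Proof.
move=> [QX cX X0] [QY cY Y0]; split; [exact: queer_algM | exact: supercentralM |].
by move=> i; rewrite ocM X0 Y0 mul0r mulr0 addr0.
Qed.

Lemma Grassmann_sg X : Grassmann X -> Grassmann (sg X).
Proof.
by move=> [QX cX X0]; split; [exact: queer_alg_sg | exact: supercentral_sg | move=> i; apply: sg_gen0].
Qed.

Lemma Grassmann_gen i : Grassmann (xi i).
Proof. by split=> [||j]; [exact: queer_alg_gen | exact: supercentral_gen | rewrite oc_gen]. Qed.

Lemma Grassmann_oc b i X : Grassmann X -> Grassmann (oc (gen b i) X).
Proof.
move=> [QX cX X0]; split; [by apply: queer_alg_oc; first exact: queer_alg_gen | exact: supercentral_oc |].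
by move=> j; rewrite oc_anticomm X0 linear0 oppr0.
Qed.

(** The supercenter of q(m) consists of scalars: [eps] excludes the odd part, and an
even element that commutes with the matrix units is a multiple of 1. *)
Lemma coef_scalar A B : supercentral (iota A + eps * iota B) ->
  exists k : K, iota A + eps * iota B = k%:A.
Proof.
case=> ci ce; have B0 : eps * iota B = 0.
  move: ce; rewrite linearD rmorphM /= !sg_iota sg_eps mulrDr mulrDl eps_iota.
  move/addrI; rewrite -mulrA eps_iota !mulNr !mulrA eps2 mul1r => /opp_eq0->.
  by rewrite mulr0.
rewrite B0 addr0; have {}ci (X : 'M_m) : iota (X *m A) = iota (A *m X).
  by move: (ci X); rewrite B0 addr0 !iotaM.
have [m0|m_gt0] := posnP m.
  exists 0; rewrite scale0r -(linear0 iota); congr (iota _).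
  by apply/matrixP=> -[i lti]; exfalso; move: lti; rewrite m0.
pose r0 := Ordinal m_gt0; exists (A r0 r0).
rewrite -(iota1 S) -linearZ /= scalemx1.
(* Averaging A over matrix units yields both A and a scalar. *)
have -> : (A r0 r0)%:M = \sum_r delta_mx r r0 *m A *m delta_mx r0 r :> 'M_m.
  by rewrite scalar_mx_sum_delta; apply: eq_bigr => r _; rewrite delta_mulmx_delta.
rewrite linear_sum /=; under eq_bigr => r _ do rewrite iotaM ci -iotaM -mulmxA mul_delta_mx.
by rewrite -linear_sum -mulmx_sumr -mx1_sum_delta mulmx1.
Qed.

Lemma coef_of_oc0 Z : Z \in Q -> (forall b i, oc (gen b i) Z = 0) ->
  exists A B, Z = iota A + eps * iota B.
Proof. by move=> QZ Z0; apply: queer_alg_coef => // b i; apply/oc_gen0P/Z0. Qed.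

Lemma Grassmann_scalar Z : Grassmann Z -> (forall i, oc (d i) Z = 0) -> exists k : K, Z = k%:A.
Proof.
case=> QZ cZ Z0 dZ; have [|A [B ZE]] := coef_of_oc0 QZ; first by case.
by rewrite ZE; apply: coef_scalar; rewrite -ZE.
Qed.

Definition gens b : seq (bool * 'I_n) := [seq (b, i) | i <- enum 'I_n].

Lemma gensP b p : p \in gens b -> exists i, p = (b, i).
Proof. by case/mapP=> i _ ->; exists i. Qed.

Lemma mem_gens b i : (b, i) \in gens b.
Proof. by apply: map_f; rewrite mem_enum. Qed.

(** Lambda(n) is generated by the xi_i: an element of it that is killed by all the d_i
is supercentral in q(m). *)
Lemma Grassmann_ind (U : E -> Prop) :
  (forall X Y, U X -> U Y -> U (X + Y)) -> (forall k : K, U k%:A) ->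
  (forall i X, Grassmann X -> U X -> U (xi i * X)) -> forall Z, Grassmann Z -> U Z.
Proof.
move=> UD U1 Ugen; apply: (@gen_ind Grassmann U (gens true)) => //.
- exact: GrassmannB.
- move=> p Z /gensP[i ->] LZ /=; split; first exact: Grassmann_oc.
  by apply: GrassmannM; [apply: Grassmann_gen | apply: Grassmann_oc].
- by move=> p Z /gensP[i ->] LZ UZ; apply: Ugen => //; apply: Grassmann_oc.
move=> Z LZ Z0; have [|k ->] := Grassmann_scalar LZ; last exact: U1.
by move=> i; apply: (Z0 (true, i)); apply: mem_gens.
Qed.

(** The supercommutant of the xi_i in q(V) is q(m) (x) Lambda(n). *)
Lemma xi_kernel_ind (U : E -> Prop) :
  (forall X Y, U X -> U Y -> U (X + Y)) -> (forall A B, U (iota A + eps * iota B)) ->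
  (forall i X, U X -> U (xi i * X)) ->
  forall Z, Z \in Q -> (forall i, oc (xi i) Z = 0) -> U Z.
Proof.
move=> UD Ucoef Ugen Z QZ Z0; pose P X := X \in Q /\ forall i, oc (xi i) X = 0.
suff : forall X, P X -> U X by apply.
apply: (@gen_ind P U (gens true)) => //.
- move=> X Y [QX X0] [QY Y0]; split=> [|i]; first exact: memvB.
  by rewrite linearB /= X0 Y0 subrr.
- move=> p X /gensP[i ->] [QX X0] /=.
  have QX1 : oc (d i) X \in Q by apply: queer_alg_oc; first exact: queer_alg_gen.
  have X10 j : oc (xi j) (oc (d i) X) = 0 by rewrite oc_anticomm X0 linear0 oppr0.
  split; split=> //; first by apply: queer_algM; first exact: queer_alg_gen.
  by move=> j; rewrite oc_genM X10 /= mul0r mulr0 subr0.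
- by move=> p X /gensP[i ->] _; apply: Ugen.
move=> X [QX X0] X1; have [|A [B ->]] := coef_of_oc0 QX; last exact: Ucoef.
by case=> // i; apply: (X1 (true, i)); apply: mem_gens.
Qed.

Lemma normalizerB X Y : normalizer X -> normalizer Y -> normalizer (X - Y).
Proof.
move=> [QX gX] [QY gY]; split=> [|i]; first exact: memvB.
by rewrite linearB /=; apply: GrassmannB.
Qed.

Lemma normalizerZ k X : normalizer X -> normalizer (k *: X).
Proof.
by move=> [QX gX]; split=> [|i]; [exact: memvZ | rewrite linearZ /=; apply: GrassmannZ].
Qed.

Lemma normalizerN X : normalizer X -> normalizer (- X).
Proof. by rewrite -scaleN1r; apply: normalizerZ. Qed.

Lemma normalizerD X Y : normalizer X -> normalizer Y -> normalizer (X + Y).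
Proof. by move=> gX gY; rewrite -[Y]opprK; apply/normalizerB/normalizerN. Qed.

Lemma normalizer_sg X : normalizer X -> normalizer (sg X).
Proof.
move=> [QX gX]; split=> [|i]; first exact: queer_alg_sg.
by rewrite -[oc _ _]opprK -sg_oc_gen; apply/GrassmannN/Grassmann_sg.
Qed.

Lemma normalizer_oc b i X : normalizer X -> normalizer (oc (gen b i) X).
Proof.
move=> [QX gX]; split=> [|j]; first by apply: queer_alg_oc => //; apply: queer_alg_gen.
by rewrite oc_anticomm; apply/GrassmannN/Grassmann_oc.
Qed.

Lemma normalizer_xiM i X : normalizer X -> normalizer (xi i * X).
Proof.
move=> [QX gX]; split=> [|j]; first by apply: queer_algM => //; apply: queer_alg_gen.
by rewrite oc_genM /= mul0r sub0r; apply/GrassmannN/GrassmannM => //; apply: Grassmann_gen.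
Qed.

Lemma normalizer_xi0 X : X \in Q -> (forall i, oc (xi i) X = 0) -> normalizer X.
Proof. by move=> QX X0; split=> // i; rewrite X0; apply: Grassmann0. Qed.

Lemma Grassmann_normalizer X : Grassmann X -> normalizer X.
Proof. by case=> QX _; apply: normalizer_xi0. Qed.

Lemma normalizer_d X i : Grassmann X -> normalizer (X * d i).
Proof.
move=> LX; split=> [|j]; first by apply: queer_algM; [exact: GrassmannQ LX | exact: queer_alg_gen].
rewrite ocM (Grassmann_xi LX) mul0r add0r oc_gen /=.
by apply: GrassmannM; [exact: Grassmann_sg | case: (_ == _); [exact: Grassmann1 | exact: Grassmann0]].
Qed.

Lemma coefM_normalizer A B X : Grassmann X -> normalizer ((iota A + eps * iota B) * X).
Proof.
move=> LX; apply: normalizer_xi0 => [|i].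
  by apply: queer_algM; [exact: queer_alg_coefs | exact: GrassmannQ LX].
by rewrite ocM oc_coef (Grassmann_xi LX) mul0r mulr0 addr0.
Qed.

(** ** Homogeneous parts *)

Definition part0 X := 2%:R^-1 *: (X + sg X).
Definition part1 X := 2%:R^-1 *: (X - sg X).

Lemma part01 X : part0 X + part1 X = X.
Proof.
rewrite -scalerDr addrACA subrr addr0 -mulr2n -scaler_nat scalerA mulVf ?scale1r //.
Qed.

Lemma sg_part0 X : sg (part0 X) = part0 X.
Proof. by rewrite linearZ linearD /= sgK addrC. Qed.

Lemma sg_part1 X : sg (part1 X) = - part1 X.
Proof. by rewrite linearZ linearB /= sgK -scalerN opprB. Qed.

Lemma normalizer_part0 X : normalizer X -> normalizer (part0 X).
Proof. by move=> gX; apply/normalizerZ/normalizerD => //; apply: normalizer_sg. Qed.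

Lemma normalizer_part1 X : normalizer X -> normalizer (part1 X).
Proof. by move=> gX; apply/normalizerZ/normalizerB => //; apply: normalizer_sg. Qed.

(** ** The normalizer of the Grassmann algebra *)

Lemma normalizer_Grassmann_even X L : normalizer X -> sg X = X -> Grassmann L -> Grassmann (X * L - L * X).
Proof.
move=> gX sX; move: L.
apply: (@Grassmann_ind (fun L => Grassmann (X * L - L * X))) => [L L' hL hL'|k|i L LL hL].
- have -> : X * (L + L') - (L + L') * X = X * L - L * X + (X * L' - L' * X) by ncring.
  exact: GrassmannD.
- by rewrite -scalerAr -scalerAl mulr1 mul1r subrr; apply: Grassmann0.
have -> : X * (xi i * L) - xi i * L * X = xi i * (X * L - L * X) - oc (xi i) X * L.
  by rewrite /oc sX; ncring.
by apply: GrassmannB; apply: GrassmannM => //; [exact: Grassmann_gen | exact: normalizer_xi].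
Qed.

Lemma normalizer_Grassmann_odd X L : normalizer X -> sg X = - X -> Grassmann L -> Grassmann (oc X L).
Proof.
move=> gX sX; move: L.
apply: (@Grassmann_ind (fun L => Grassmann (oc X L))) => [L L' hL hL'|k|i L LL hL].
- by rewrite linearD /=; apply: GrassmannD.
- by rewrite linearZ /= /oc rmorph1 mulr1 mul1r subrr scaler0; apply: Grassmann0.
have -> : oc X (xi i * L) = oc (xi i) X * L - xi i * oc X L.
  by rewrite ocM sg_gen mulNr /oc sg_gen sX; ncring.
by apply: GrassmannB; apply: GrassmannM => //; [exact: normalizer_xi | exact: Grassmann_gen].
Qed.

Lemma Grassmann_normalizer_even X L : normalizer X -> Grassmann L -> sg L = L -> Grassmann (L * X - X * L).
Proof.
move=> gX LL sL; rewrite -(part01 X).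
set X0 := part0 X; set X1 := part1 X.
have -> : L * (X0 + X1) - (X0 + X1) * L = - (X0 * L - L * X0) - oc X1 L.
  by rewrite /oc sL; ncring.
apply: GrassmannB.
  by apply/GrassmannN/normalizer_Grassmann_even; [exact: normalizer_part0 | exact: sg_part0 |].
by apply: normalizer_Grassmann_odd; [exact: normalizer_part1 | exact: sg_part1 |].
Qed.

Lemma Grassmann_normalizer_odd X L : normalizer X -> Grassmann L -> sg L = - L -> Grassmann (oc L X).
Proof.
move=> gX LL sL; rewrite -(part01 X).
set X0 := part0 X; set X1 := part1 X.
have -> : oc L (X0 + X1) = oc X1 L - (X0 * L - L * X0).
  by rewrite /oc sL rmorphD /= sg_part0 sg_part1 -/X0 -/X1; ncring.
apply: GrassmannB; first by apply: normalizer_Grassmann_odd; [exact: normalizer_part1 | exact: sg_part1 |].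
by apply: normalizer_Grassmann_even; [exact: normalizer_part0 | exact: sg_part0 |].
Qed.

Lemma normalizer_bracket_even X Y : normalizer X -> normalizer Y -> sg X = X -> normalizer (X * Y - Y * X).
Proof.
move=> gX gY sX; split=> [|i]; first by rewrite memvB // queer_algM ?(normalizerQ gX) ?(normalizerQ gY).
have -> : oc (xi i) (X * Y - Y * X)
    = oc (oc (xi i) X) Y + (X * oc (xi i) Y - oc (xi i) Y * X).
  by rewrite linearB /= !ocM sX [oc _ Y in RHS]/oc; ncring.
apply: GrassmannD.
  apply: Grassmann_normalizer_odd => //; first exact: normalizer_xi.
  by rewrite sg_oc_gen sX.
by apply: normalizer_Grassmann_even => //; apply: normalizer_xi.
Qed.

Lemma normalizer_bracket_odd X Y : normalizer X -> normalizer Y -> sg X = - X -> normalizer (oc X Y).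
Proof.
move=> gX gY sX; split=> [|i].
  by apply: queer_alg_oc; [exact: normalizerQ gX | exact: normalizerQ gY].
have -> : oc (xi i) (oc X Y)
    = (oc (xi i) X * Y - Y * oc (xi i) X) - oc X (oc (xi i) Y).
  rewrite [oc X Y]/oc linearB /= !ocM sX sgK [oc X _]/oc sg_oc_gen; ncring.
apply: GrassmannB.
  apply: Grassmann_normalizer_even => //; first exact: normalizer_xi.
  by rewrite sg_oc_gen sX linearN opprK.
by apply: normalizer_Grassmann_odd => //; apply: normalizer_xi.
Qed.

(** ** Traces on the normalizer *)

(** With [L = [xi, X]] for one of the generators, [X - d L] is killed by [xi], hence
is a bracket, while [d L] supercommutes with [eps], and therefore
[2 d L = [eps, eps d L]]. *)
Lemma trace_normalizer (tau : 'Hom(E, K^o)) (i0 : 'I_n) :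
  (forall X Y, X \in Q -> Y \in Q -> sg X = - X -> tau (oc X Y) = 0) ->
  forall X, normalizer X -> tau X = 0.
Proof.
move=> tau0 X gX; have LX := normalizer_xi gX i0; set L := oc (xi i0) X in LX *.
have QL := GrassmannQ LX.
rewrite -(subrK (d i0 * L) X) linearD /=.
have -> : tau (X - d i0 * L) = 0.
  rewrite [X - _](@gen_homotopy false i0).
    apply: tau0; rewrite ?sg_gen //; first exact: queer_alg_gen.
    by rewrite queer_algM ?memvB ?queer_algM ?queer_alg_gen ?(normalizerQ gX).
  by rewrite linearB /= oc_genM eqxx mul1r oc_sq mulr0 subr0 subrr.
have [_ cL] := supercentralM (supercentral_gen true i0) (Grassmann_central LX).
have : tau (oc eps (eps * (d i0 * L))) = 0.
  by apply: tau0; rewrite ?sg_eps ?queer_alg_eps ?queer_algM ?queer_alg_gen ?queer_alg_eps.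
have -> : oc eps (eps * (d i0 * L)) = 2%:R *: (d i0 * L).
  rewrite /oc; set W := d i0 * L in cL *; rewrite rmorphM /= sg_eps !mulNr opprK.
  by rewrite -(mulrA eps (sg W)) -cL !mulrA eps2 !mul1r scaler_nat mulr2n.
rewrite linearZ /= => /eqP; rewrite mulf_eq0 (negPf two) /= => /eqP->.
by rewrite addr0.
Qed.

(** Its symbol [eps] is not scalar.  This element separates g from sq(V). *)
Lemma eps_d_notin_normalizer i : ~ normalizer (eps * d i).
Proof.
case=> _ /(_ i); rewrite ocM oc_eps oc_gen eqxx mul0r add0r mulr1 sg_eps.
case=> _ [_ e_sg] _; have := e_sg; rewrite linearN /= sg_eps opprK mulrN eps2.
move/esym/opp_eq0/eqP; exact/negP/oner_neq0.
Qed.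

End Theory.

(** * Subalgebras that contain the normalizer strictly *)

(** Graded subalgebras, with the super bracket expressed for a homogeneous first
argument. *)
Record Lie_closed (K : fieldType) (E : falgType K) (m n : nat)
    (S : queer_clifford E m n) (H : {vspace E}) : Prop := LieClosed {
  Lie_sg : forall X, X \in H -> sg S X \in H;
  Lie_even : forall X Y, X \in H -> Y \in H -> sg S X = X -> X * Y - Y * X \in H;
  Lie_odd : forall X Y, X \in H -> Y \in H -> sg S X = - X -> odd_comm S X Y \in H }.

Section Maximality.
Variables (K : fieldType) (E : falgType K) (m n : nat).
Variable S : queer_clifford E m n.
Local Notation sg := (sg S).
Local Notation gen := (gen S).
Local Notation xi := (gen false).
Local Notation d := (gen true).
Local Notation iota := (iota S).
Local Notation eps := (eps S).
Local Notation Q := (queer_alg S).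
Local Notation oc := (odd_comm S).
Local Notation Grassmann := (Grassmann S).
Local Notation normalizer := (normalizer S).
Local Notation supercentral := (supercentral S).
Implicit Types (X Y Z : E).

Let two := two_neq0 S.

Variable H : {vspace E}.
Hypotheses (H_lie : Lie_closed S H) (H_Q : (H <= Q)%VS)
  (G_H : forall Z, normalizer Z -> Z \in H).

Let Hsg := Lie_sg H_lie.
Let Heven := Lie_even H_lie.
Let Hodd := Lie_odd H_lie.

Lemma Hgen b i : gen b i \in H.
Proof.
apply: G_H; case: b; last exact/Grassmann_normalizer/Grassmann_gen.
by rewrite -[gen _ _]mul1r; apply/normalizer_d/Grassmann1.
Qed.

Lemma Hoc b i Z : Z \in H -> oc (gen b i) Z \in H.
Proof. by move=> HZ; apply: Hodd => //; [exact: Hgen | exact: sg_gen]. Qed.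

(** ** Reduction to a singular vector *)

(** Treat the generators one after the other: if [Z] is not killed modulo g by the
next one, replace it by its bracket, which the previous ones still kill because
the brackets anticommute, and which the new one kills because its square is
zero. *)
Lemma singular_vector Z : Z \in H -> ~ normalizer Z ->
  exists Z', [/\ Z' \in H, ~ normalizer Z' & forall b i, normalizer (oc (gen b i) Z')].
Proof.
move=> HZ nGZ.
suff [Z' [HZ' nGZ' sing]] : exists Z', [/\ Z' \in H, ~ normalizer Z' &
    forall p, p \in gens n false ++ gens n true -> normalizer (oc (gen p.1 p.2) Z')].
  exists Z'; split=> // b i; apply: (sing (b, i)); rewrite mem_cat.
  by case: b; rewrite mem_gens ?orbT.
elim: (gens n false ++ gens n true) => [|p s [Z1 [HZ1 nGZ1 sing]]]; first by exists Z.
have [GpZ1 | nGpZ1] := classic (normalizer (oc (gen p.1 p.2) Z1)).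
  by exists Z1; split=> // q; rewrite inE => /predU1P[-> | /sing].
exists (oc (gen p.1 p.2) Z1); split=> //; first exact: Hoc.
move=> q; rewrite inE => /predU1P[-> | /sing Gq].
  by rewrite oc_sq; apply/Grassmann_normalizer/Grassmann0.
by rewrite oc_anticomm; apply/normalizerN/normalizer_oc.
Qed.

(** ** Symbols of singular vectors *)

(** The bracket with the Euler operator [xi_i d_i]: modulo g and up to sign, it
extracts the part of a singular vector that involves [d_i]. *)
Lemma weightE i Y : xi i * d i * Y - Y * (xi i * d i)
  = xi i * oc (d i) Y - sg (oc (xi i) Y) * d i.
Proof. by rewrite sg_oc_gen /oc sgK; ncring. Qed.

Lemma weight_H i Y : Y \in H -> xi i * oc (d i) Y - sg (oc (xi i) Y) * d i \in H.
Proof.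
move=> HY; rewrite -weightE; apply: Heven => //.
  by apply/G_H/normalizer_d/Grassmann_gen.
by rewrite rmorphM /= !sg_gen mulrN mulNr opprK.
Qed.

Lemma weight_sym i Y : normalizer (oc (d i) Y) -> Y \in H -> oc (xi i) Y * d i \in H.
Proof.
move=> GY HY; have := Hsg (weight_H i HY).
rewrite linearB /= [sg (sg _ * _)]rmorphM /= sgK sg_gen mulrN opprK => h.
rewrite -(addKr (sg (xi i * oc (d i) Y)) (_ * _)) memvD // memvN.
exact/Hsg/G_H/normalizer_xiM.
Qed.

(** The elements of q(m) (x) Lambda(n) whose derivatives all have scalar coefficients
are a constant plus an element of Lambda(n). *)
Lemma symbol_split Y : Y \in Q -> (forall i, oc (xi i) Y = 0) ->
  (forall i, Grassmann (oc (d i) Y)) ->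
  exists A B L, Grassmann L /\ Y = iota A + eps * iota B + L.
Proof.
move=> QY Y0 dY.
pose P Z := [/\ Z \in Q, forall i, oc (xi i) Z = 0 & forall i, Grassmann (oc (d i) Z)].
pose U Z := exists A B L, Grassmann L /\ Z = iota A + eps * iota B + L.
have LamP Z : Grassmann Z -> P Z.
  by move=> LZ; split=> [|i|i]; [exact: GrassmannQ LZ | exact: (Grassmann_xi LZ) | exact: Grassmann_oc].
have LamU Z : Grassmann Z -> U Z.
  by move=> LZ; exists 0, 0, Z; rewrite !linear0 mulr0 !add0r.
apply: (@gen_ind _ _ _ _ S P U (gens n true)) => //.
- move=> X Z [QX X0 dX] [QZ Z0 dZ]; split=> [|i|i]; first exact: memvB.
    by rewrite linearB /= X0 Z0 subrr.
  by rewrite linearB /=; apply: GrassmannB.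
- move=> X Z [A [B [L [LL ->]]]] [A' [B' [L' [LL' ->]]]].
  exists (A + A'), (B + B'), (L + L'); split; first exact: GrassmannD.
  by rewrite !linearD /=; ncring.
- move=> p Z /gensP[i ->] [QZ Z0 dZ] /=; split; apply: LamP => //.
  by apply: GrassmannM => //; apply: Grassmann_gen.
- move=> p Z /gensP[i ->] [QZ Z0 dZ] _ /=; apply: LamU.
  by apply: GrassmannM => //; apply: Grassmann_gen.
move=> Z [QZ Z0 dZ] dZ0; have [|A [B ZE]] := coef_of_oc0 QZ.
  by case=> // i; apply: (dZ0 (true, i)); apply: mem_gens.
by exists A, B, 0; rewrite addr0; split=> //; apply: Grassmann0.
Qed.

(** Stability under the left multiplications by q(m); it suffices to consider
elements of End Lambda(n), that is [supercentral] ones. *)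
Definition saturated Y := supercentral Y /\
  forall A, iota A * Y \in H /\ eps * iota A * Y \in H.

Definition central_in_H Y := supercentral Y /\ Y \in H.

Lemma saturated_Grassmann Y : Grassmann Y -> saturated Y.
Proof.
move=> LY; split=> [|A]; first exact: Grassmann_central LY.
have G0 := @coefM_normalizer _ _ _ _ S A 0 Y LY; have G1 := @coefM_normalizer _ _ _ _ S 0 A Y LY.
move: G0 G1; rewrite !linear0 mulr0 add0r addr0 => G0 G1.
by split; apply: G_H.
Qed.

(** Because [[a g, Y] = a [g, Y]] when [Y] supercommutes with q(m). *)
Lemma saturated_oc b i Y : saturated (gen b i) -> central_in_H Y ->
  saturated (oc (gen b i) Y).
Proof.
case=> _ sat [cY HY]; split=> [|A]; first exact: supercentral_oc.
have [HA HeA] := sat A; have [csA cse] := supercentral_sg cY; split.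
  have -> : iota A * oc (gen b i) Y = oc (iota A * gen b i) Y.
    by rewrite /oc mulrBr !mulrA csA.
  by apply: Hodd; rewrite // rmorphM /= sg_iota sg_gen mulrN.
have -> : eps * iota A * oc (gen b i) Y
    = eps * iota A * gen b i * Y - Y * (eps * iota A * gen b i).
  by rewrite /oc mulrBr !mulrA -[eps * iota A * sg Y]mulrA csA [eps * (_ * _)]mulrA cse sgK.
apply: Heven => //; rewrite !rmorphM /= sg_iota sg_gen sg_eps.
by rewrite mulrN !mulNr opprK.
Qed.

Lemma central_normalizer Y : supercentral Y -> normalizer Y -> central_in_H Y.
Proof. by move=> cY /G_H. Qed.

(** [[xi_i, d_i d_j] = d_j], and q(m) [xi_i] is in [H]. *)
Lemma saturated_second_order i j : i != j -> d i * d j \in H -> saturated (d j).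
Proof.
move=> nij Hij; have -> : d j = oc (xi i) (d i * d j).
  by rewrite oc_genM oc_gen /= eqxx (negPf nij) mulr0 subr0 mul1r.
apply: saturated_oc; first exact/saturated_Grassmann/Grassmann_gen.
by split=> //; apply: supercentralM; apply: supercentral_gen.
Qed.

(** [[d_j, xi_j d_i] = d_i], where [xi_j d_i] is a vector field. *)
Lemma saturated_all_d j : saturated (d j) -> forall i, saturated (d i).
Proof.
move=> satj i; have -> : d i = oc (d j) (xi j * d i).
  by rewrite oc_genM oc_gen /= eqxx mulr0 subr0 mul1r.
apply: saturated_oc => //; apply: central_normalizer; last exact/normalizer_d/Grassmann_gen.
by apply: supercentralM; apply: supercentral_gen.
Qed.

Lemma H_part01 X Y Z : sg Z = - Z ->
  sg X = X -> sg Y = - Y -> (X + Y) * Z \in H -> X * Z \in H /\ Y * Z \in H.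
Proof.
move=> sZ sX sY h; have := Hsg h; rewrite rmorphM rmorphD /= sX sY sZ => h'.
have two_div W : W + W \in H -> W \in H.
  by rewrite -mulr2n -scaler_nat => /(memvZ 2%:R^-1); rewrite scalerA mulVf ?scale1r.
split; apply: two_div.
  have -> : X * Z + X * Z = (X + Y) * Z - (X - Y) * - Z by ncring.
  exact: memvB.
have -> : Y * Z + Y * Z = (X + Y) * Z + (X - Y) * - Z by ncring.
exact: memvD.
Qed.

Lemma H_div (k : K) X : k != 0 -> k *: X \in H -> X \in H.
Proof. by move=> k0 /(memvZ k^-1); rewrite scalerA mulVf // scale1r. Qed.

(** The coefficients [a] such that [a d_i] is in [H] satisfy the hypotheses of
[queer_ideal_full].  The last of them, on a product of three matrices, comes from
bracketing first with q(m) [xi_i], which leaves [eps [b, a] xi_i d_i] in [H], and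
then with [c d_i]. *)
Lemma saturated_nonscalar i A B : (iota A + eps * iota B) * d i \in H ->
  ~ (exists k : K, iota A + eps * iota B = k%:A) -> saturated (d i).
Proof.
move=> HAB nscal.
have [HA HB] : iota A * d i \in H /\ eps * iota B * d i \in H.
  apply: H_part01 => //; rewrite ?sg_gen ?sg_iota //.
  by rewrite rmorphM /= sg_iota sg_eps mulNr.
have dA C : d i * iota C = iota C * d i by rewrite iota_gen.
have de : d i * eps = - (eps * d i) by rewrite eps_gen.
have Ae C : iota C * eps = eps * iota C by rewrite eps_iota.
have xA C : xi i * iota C = iota C * xi i by rewrite iota_gen.
have xe : xi i * eps = - (eps * xi i) by rewrite eps_gen.
have dd : d i * d i = 0 := gen_sq S true i.
have dxi : d i * xi i = 1 - xi i * d i.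
  by have := genM S true false i i; rewrite eqxx /= => /(canRL (addrK _)).
have [_ Hi] := saturated_Grassmann (Grassmann1 S); have [_ Hx] := saturated_Grassmann (Grassmann_gen S i).
have {}Hi C : iota C \in H /\ eps * iota C \in H.
  by have := Hi C; rewrite !mulr1.
have se C : sg (eps * iota C) = - (eps * iota C).
  by rewrite rmorphM /= sg_iota sg_eps mulNr.
have sd C : sg (iota C * d i) = - (iota C * d i).
  by rewrite rmorphM /= sg_iota sg_gen mulrN.
have sed C : sg (eps * iota C * d i) = eps * iota C * d i.
  by rewrite rmorphM /= se sg_gen mulrN mulNr opprK.
pose P0 C := iota C * d i \in H; pose P1 C := eps * iota C * d i \in H.
suff P01 C0 : P0 C0 /\ P1 C0 by split; first exact: supercentral_gen.
apply: (@queer_ideal_full K m P0 P1 two _ _ _ _ _ _ _ _ _ _ A B) => //.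
- by move=> C D PC PD; rewrite /P0 linearB mulrBl memvB.
- by move=> k C PC; rewrite /P0 linearZ -scalerAl memvZ.
- by move=> C D PC PD; rewrite /P1 linearB mulrBr mulrBl memvB.
- by move=> k C PC; rewrite /P1 linearZ -scalerAr -scalerAl memvZ.
- move=> C D PD; have := Heven (Hi C).1 PD (sg_iota S C); congr (_ \in H).
  transitivity (iota C * iota D * d i - iota D * (d i * iota C)); first by ncring.
  by rewrite dA linearB /= !iotaM; ncring.
- move=> C D PD; have := Heven (Hi C).1 PD (sg_iota S C); congr (_ \in H).
  transitivity (iota C * eps * iota D * d i - eps * iota D * (d i * iota C)); first by ncring.
  by rewrite dA Ae linearB /= !iotaM; ncring.
- move=> C D PD; have := Hodd (Hi C).2 PD (se C); congr (_ \in H); rewrite /oc sd.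
  transitivity (eps * iota C * iota D * d i + iota D * (d i * eps) * iota C); first by ncring.
  rewrite de; transitivity (eps * iota C * iota D * d i - iota D * eps * (d i * iota C)); first by ncring.
  by rewrite dA Ae linearB /= !iotaM; ncring.
- move=> C D PD; have := Hodd (Hi C).2 PD (se C); congr (_ \in H); rewrite /oc sed.
  transitivity (eps * (iota C * eps) * iota D * d i - eps * iota D * (d i * eps) * iota C); first by ncring.
  rewrite de Ae.
  transitivity (eps * eps * iota C * iota D * d i + eps * (iota D * eps) * (d i * iota C)); first by ncring.
  rewrite dA Ae.
  transitivity (eps * eps * iota C * iota D * d i + eps * eps * iota D * iota C * d i); first by ncring.
  by rewrite eps2 linearD /= !iotaM; ncring.
- move=> F C D PF PD; set X := C *m D - D *m C.
  have HX : eps * iota X * xi i * d i \in H.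
    have sx : sg (eps * iota C * xi i) = eps * iota C * xi i.
      by rewrite rmorphM /= se sg_gen mulrN mulNr opprK.
    have := memvB (Heven (Hx C).2 PD sx) (Hi (D *m C)).2; congr (_ \in H).
    transitivity (eps * iota C * (xi i * iota D) * d i
      - iota D * (d i * eps) * iota C * xi i - eps * iota (D *m C)); first by ncring.
    rewrite de xA.
    transitivity (eps * iota C * iota D * xi i * d i
      + iota D * eps * (d i * iota C) * xi i - eps * iota (D *m C)); first by ncring.
    rewrite dA Ae.
    transitivity (eps * iota C * iota D * xi i * d i
      + eps * iota D * iota C * (d i * xi i) - eps * iota (D *m C)); first by ncring.
    by rewrite dxi linearB /= !iotaM; ncring.
  have := Hodd PF HX (sd F); rewrite -memvN; congr (_ \in H).
  rewrite /oc !rmorphM /= sg_iota sg_eps !sg_gen.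
  transitivity (- (iota F * (d i * eps) * iota X * xi i * d i)
    - eps * iota X * xi i * (d i * iota F) * d i); first by ncring.
  rewrite de dA.
  transitivity (iota F * eps * (d i * iota X) * xi i * d i
    - eps * iota X * xi i * iota F * (d i * d i)); first by ncring.
  rewrite Ae dA dd.
  transitivity (eps * iota F * iota X * (d i * xi i) * d i); first by ncring.
  rewrite dxi iotaM.
  transitivity (eps * iota F * iota X * d i - eps * iota F * iota X * xi i * (d i * d i)); first by ncring.
  by rewrite dd; ncring.
- by rewrite /P0 iota1 mul1r; apply: Hgen.
have [/is_scalar_mxP[k Ak] | ] := boolP (is_scalar_mx A); [right | by left].
apply/eqP=> B0; case: nscal; exists k.
by rewrite B0 Ak linear0 mulr0 addr0 -scalemx1 linearZ /= iota1.
Qed.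

(** A singular vector has order at most two.  If its second order part is not zero,
then two Euler operators isolate a [d_i d_j]; otherwise one of them isolates a
first order term, whose coefficient is not scalar. *)
Lemma saturated_d : (exists Z, Z \in H /\ ~ normalizer Z) -> forall i, saturated (d i).
Proof.
case=> _ [/singular_vector h /h {h}[Z [HZ nGZ sing]]].
have [[i [j c_neq0]] | c0] := classic (exists i j, oc (xi i) (oc (xi j) Z) <> 0).
  (* The second order coefficient c lies in Lambda(n) and is killed by every d_l. *)
  set c := oc _ _ in c_neq0.
  have [k cE] : exists k : K, c = k%:A.
    apply: (Grassmann_scalar (normalizer_xi (sing false j) i)) => l.
    rewrite oc_anticomm [oc (d l) _]oc_anticomm linearN opprK.
    exact: Grassmann_xi (normalizer_xi (sing true l) j) i.
  have nij : i != j by apply/eqP=> eij; case: c_neq0; rewrite /c eij oc_sq.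
  have k0 : k != 0 by apply/eqP=> k0; case: c_neq0; rewrite cE k0 scale0r.
  apply: saturated_all_d (saturated_second_order nij _).
  set Y := oc (xi j) Z in c cE c_neq0 *.
  have HYd : Y * d j \in H by apply: weight_sym.
  have Hxd : xi i * d i \in H by apply/G_H/normalizer_d/Grassmann_gen.
  have sxd : sg (xi i * d i) = xi i * d i by rewrite rmorphM /= !sg_gen mulrN mulNr opprK.
  have comm : d j * (xi i * d i) = xi i * d i * d j.
    have dx : d j * xi i = - (xi i * d j).
      by apply/eqP; rewrite -addr_eq0 genM [j == i]eq_sym (negPf nij).
    have ddj : d j * d i = - (d i * d j) by apply/eqP; rewrite -addr_eq0 genM.
    by rewrite mulrA dx mulNr -(mulrA (xi i) (d j)) ddj mulrN opprK mulrA.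
  have := Heven Hxd HYd sxd.
  have -> : xi i * d i * (Y * d j) - Y * d j * (xi i * d i)
      = xi i * oc (d i) Y * d j - k *: (d i * d j).
    rewrite -[Y * d j * _]mulrA comm.
    transitivity ((xi i * d i * Y - Y * (xi i * d i)) * d j); first by ncring.
    by rewrite weightE -/c cE linearZ rmorph1 /= mulrBl -!scalerAl mul1r.
  move=> h; apply: (H_div k0); rewrite -memvN.
  rewrite -(addKr (xi i * oc (d i) Y * d j) (- _)) memvD // memvN.
  apply/G_H/normalizer_d/GrassmannM; first exact: Grassmann_gen.
  by rewrite /Y oc_anticomm; apply/GrassmannN/(normalizer_xi (sing true i)).
have {}c0 i j : oc (xi i) (oc (xi j) Z) = 0.
  by apply: NNPP => c_neq0; apply: c0; exists i, j.
have [i nLi] : exists i, ~ Grassmann (oc (xi i) Z).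
  apply: not_all_ex_not => LZ; apply: nGZ; split=> //.
  exact: (subvP H_Q).
have QZ : Z \in Q by apply: (subvP H_Q).
have [||j|A [B [L [LL LE]]]] := @symbol_split (oc (xi i) Z).
- by apply: queer_alg_oc; first exact: queer_alg_gen.
- by [].
- by rewrite oc_anticomm; apply/GrassmannN/(normalizer_xi (sing true j)).
have HLd := weight_sym (sing true i) HZ.
apply: (@saturated_all_d i); apply: (@saturated_nonscalar i A B).
  rewrite -(addrK L (_ + _)) -LE mulrBl memvB //.
  exact/G_H/normalizer_d.
case=> k kE; apply: nLi; rewrite LE kE; apply: GrassmannD => //.
exact/GrassmannZ/Grassmann1.
Qed.

(** ** Operators of higher order *)

Hypothesis sat_d : forall i, saturated (d i).

Lemma sat_gen b i : saturated (gen b i).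
Proof. by case: b; [exact: sat_d | exact/saturated_Grassmann/Grassmann_gen]. Qed.

Lemma saturated_cen X : saturated X -> [/\ supercentral X, X \in H & eps * X \in H].
Proof. by case=> cX /(_ 1%:M); rewrite iota1 mul1r mulr1 => -[HX HeX]. Qed.

(** For even [X], [[X, Y] + [eps X, eps Y] = 2 X Y]; for odd [X] the same holds with
a minus sign. *)
Lemma saturatedM X Y : sg X = X \/ sg X = - X ->
  saturated X -> saturated Y -> central_in_H (X * Y).
Proof.
move=> sX /saturated_cen[cX HX HeX] /saturated_cen[cY HY HeY].
split; first exact: supercentralM.
have two_div W : W + W \in H -> W \in H.
  by rewrite -mulr2n -scaler_nat; apply: H_div.
have [_ eX] := cX; have [_ eY] := cY; have [_ esY] := supercentral_sg cY.
rewrite sgK in esY; apply: two_div; case: sX => sX; rewrite sX in eX.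
  have seX : sg (eps * X) = - (eps * X) by rewrite rmorphM /= sg_eps sX mulNr.
  have := memvD (Heven HX HY sX) (Hodd HeX HeY seX); congr (_ \in H).
  rewrite /oc rmorphM /= sg_eps.
  transitivity (X * Y - Y * X + ((eps * X) * eps * Y + (eps * sg Y) * eps * X)).
    by ncring.
  rewrite eX esY.
  transitivity (X * Y - Y * X + X * (eps * eps) * Y + Y * (eps * eps) * X); first by ncring.
  by rewrite eps2; ncring.
have seX : sg (eps * X) = eps * X by rewrite rmorphM /= sg_eps sX mulrNN.
have := memvB (Hodd HX HY sX) (Heven HeX HeY seX); congr (_ \in H).
rewrite /oc.
transitivity (X * Y - sg Y * X - (eps * X) * eps * Y + (eps * Y) * eps * X); first by ncring.
rewrite eX eY.
transitivity (X * Y - sg Y * X + X * (eps * eps) * Y + sg Y * (eps * eps) * X); first by ncring.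
by rewrite eps2; ncring.
Qed.

Definition word b (w : seq 'I_n) : E := \prod_(i <- w) gen b i.

Lemma word_cons b i w : word b (i :: w) = gen b i * word b w.
Proof. exact: big_cons. Qed.

Lemma word_nil b : word b [::] = 1.
Proof. exact: big_nil. Qed.

Lemma word_rcons b i w : word b (rcons w i) = word b w * gen b i.
Proof. by rewrite /word -cats1 big_cat big_seq1. Qed.

Lemma Grassmann_word w : Grassmann (word false w).
Proof.
elim: w => [|i w IHw]; first by rewrite word_nil; apply: Grassmann1.
by rewrite word_cons; apply: GrassmannM => //; apply: Grassmann_gen.
Qed.

Lemma sg_word b w : sg (word b w) = word b w \/ sg (word b w) = - word b w.
Proof.
elim: w => [|i w IHw]; first by rewrite word_nil rmorph1; left.
rewrite word_cons rmorphM /= sg_gen mulNr; case: IHw => ->; first by right.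
by left; rewrite mulrN opprK.
Qed.

Lemma oc_word i w : oc (d i) (word true w) = 0.
Proof.
elim: w => [|j w IHw]; first by rewrite word_nil /oc rmorph1; ncring.
by rewrite word_cons oc_genM IHw /= mul0r mulr0 subr0.
Qed.

(** [[d_j, xi_j xi_i d_i] = xi_i d_i]: a second index is needed. *)
Lemma saturated_Euler i j : j != i -> saturated (xi i * d i).
Proof.
move=> nji; have -> : xi i * d i = oc (d j) (xi j * (xi i * d i)).
  by rewrite !oc_genM oc_gen eqxx (negPf nji) /= mul0r mulr0 subr0 mulr0 subr0 mul1r.
apply: saturated_oc => //; apply: central_normalizer.
  by do 2![apply: supercentralM; first exact: supercentral_gen]; apply: supercentral_gen.
exact/normalizer_xiM/normalizer_d/Grassmann_gen.
Qed.

(** By induction, [xi_i d_i] times the word [w] is in [H], and its bracket with [d_i]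
is [d_i w].  When there is a single index, the words of length two or more are
zero. *)
Lemma saturated_word w : saturated (word true w).
Proof.
elim: w => [|i w IHw]; first by rewrite word_nil; apply/saturated_Grassmann/Grassmann1.
have [j /= nji|all_i] := pickP (fun j => j != i); last first.
  case: w IHw => [|k w] IHw; first by rewrite word_cons word_nil mulr1.
  have -> : k = i by apply/eqP/negPn; rewrite all_i.
  rewrite !word_cons mulrA gen_sq mul0r -(scale0r 1); apply/saturated_Grassmann/GrassmannZ/Grassmann1.
rewrite word_cons; have -> : d i * word true w = oc (d i) (xi i * d i * word true w).
  by rewrite -mulrA !oc_genM oc_word eqxx /= mulr0 subr0 mul0r mulr0 subr0 mul1r.
apply: saturated_oc => //; apply: saturatedM => //; last exact: saturated_Euler nji.
by left; rewrite rmorphM /= !sg_gen mulrNN.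
Qed.

Lemma central_words v w : central_in_H (word false v * word true w).
Proof.
apply: saturatedM; [exact: sg_word | exact/saturated_Grassmann/Grassmann_word |].
exact: saturated_word.
Qed.

Lemma saturated_mulr X A B : saturated X -> X * (iota A + eps * iota B) \in H.
Proof.
case=> cX satX; have [HA _] := satX A; have [_ HB] := satX B.
have [csi cse] := supercentral_sg cX; rewrite mulrDr -(supercentral_iota cX) memvD //.
rewrite sgK in cse; rewrite mulrA -cse -mulrA -csi mulrA -memvN.
by have := Hsg HB; rewrite !rmorphM /= sg_eps sg_iota !mulNr.
Qed.

(** All of q(V) is spanned by the products [v w c], where [v] is a word in the xi_i,
[w] a word in the d_i and [c] is in q(m); the bracket of a generator with [v w c]
is a multiple by [c] of its bracket with [v w]. *)
Lemma odd_comm_in_H b i Z : Z \in Q -> oc (gen b i) Z \in H.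
Proof.
pose T Z := forall b i, oc (gen b i) Z \in H.
have TD X Y : T X -> T Y -> T (X + Y).
  by move=> TX TY c j; rewrite linearD; apply: memvD; [apply: TX | apply: TY].
suff TQ : forall Z, Z \in Q -> T Z by move=> /TQ.
have TQd : forall Z, Z \in Q /\ (forall i, oc (d i) Z = 0) ->
    forall v w, T (word false v * word true w * Z).
  apply: (@gen_ind _ _ _ _ S _ _ (gens n false)).
  - move=> X Y [QX X0] [QY Y0]; split=> [|j]; first exact: memvB.
    by rewrite linearB /= X0 Y0 subrr.
  - by move=> X Y TX TY v w; rewrite mulrDr; apply: TD.
  - move=> p Y /gensP[j ->] [QY Y0] /=.
    have Y1 k : oc (d k) (oc (xi j) Y) = 0 by rewrite oc_anticomm Y0 linear0 oppr0.
    have QY1 : oc (xi j) Y \in Q by apply: queer_alg_oc; first exact: queer_alg_gen.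
    split; split=> //; first by apply: queer_algM; first exact: queer_alg_gen.
    by move=> k; rewrite oc_genM Y1 /= mul0r mulr0 subr0.
  - move=> p Y /gensP[j ->] [QY Y0] /= TY v w.
    by rewrite mulrA -(mulrA (word _ v)) -word_rcons.
  move=> Y [QY Y0] Yxi v w; have [|A [B ->]] := coef_of_oc0 QY.
    by case=> // k; apply: (Yxi (false, k)); apply: mem_gens.
  move=> c j; rewrite ocM oc_coef mulr0 addr0.
  by apply/saturated_mulr/saturated_oc; [exact: sat_gen | exact: central_words].
suff TQw Y : Y \in Q -> forall v, T (word false v * Y).
  by move=> Y /TQw/(_ [::]); rewrite word_nil mul1r.
move: Y; apply: (@gen_ind _ _ _ _ S _ _ (gens n true)).
- by move=> X Y QX QY; apply: memvB.
- by move=> X Y TX TY v; rewrite mulrDr; apply: TD.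
- move=> p Y /gensP[j ->] QY /=.
  have QY1 : oc (d j) Y \in Q by apply: queer_alg_oc; first exact: queer_alg_gen.
  by split=> //; apply: queer_algM; first exact: queer_alg_gen.
- by move=> p Y /gensP[j ->] QY /= TY v; rewrite mulrA -word_rcons.
move=> Y QY Y0 v; have := TQd Y _ v [::]; rewrite word_nil mulr1; apply; split=> // j.
by apply: (Y0 (true, j)); apply: mem_gens.
Qed.

Lemma killed_in_H b i Z : Z \in Q -> oc (gen b i) Z = 0 -> Z \in H.
Proof.
move=> QZ /gen_homotopy ->; apply: odd_comm_in_H.
by apply: queer_algM => //; apply: queer_alg_gen.
Qed.

(** ** The top symbol *)

Definition euler (s : seq 'I_n) : E := \prod_(i <- s) (xi i * d i).

Lemma euler_rcons s i : euler (rcons s i) = euler s * (xi i * d i).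
Proof. by rewrite /euler -cats1 big_cat big_seq1. Qed.

Lemma sg_euler s : sg (euler s) = euler s.
Proof.
by rewrite /euler rmorph_prod; apply: eq_bigr => i _; rewrite rmorphM /= !sg_gen mulrNN.
Qed.

Lemma Q_euler s : euler s \in Q.
Proof.
rewrite /euler; elim/big_ind: _ => [|X Y|i _]; [exact: queer_alg1 | exact: queer_algM |].
by rewrite queer_algM ?queer_alg_gen.
Qed.

Lemma supercentral_euler s : supercentral (euler s).
Proof.
rewrite /euler; elim/big_ind: _ => [|X Y|i _]; [exact: supercentral1 | exact: supercentralM |].
by apply: supercentralM; apply: supercentral_gen.
Qed.

Lemma oc_euler s b i : i \notin s -> oc (gen b i) (euler s) = 0.
Proof.
rewrite /euler; elim: s => [_|j s IHs]; first by rewrite big_nil /oc rmorph1; ncring.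
rewrite inE negb_or big_cons => /andP[nij /IHs h].
rewrite ocM h mulr0 addr0 oc_genM oc_gen (negPf nij) !andbF.
by rewrite mul0r mulr0 subr0 mul0r.
Qed.

(** For each index, [Y] is [xi_i d_i [xi_i, [d_i, Y]]] up to elements that are killed
by [xi_i] or by [d_i], which are in [H] also after multiplication by the Euler
operators of the other indices. *)
Lemma reduce_euler s Z : uniq s -> Z \in Q -> exists Y,
  [/\ Y \in Q, forall i b, i \in s -> oc (gen b i) Y = 0 & Z - euler s * Y \in H].
Proof.
move=> + QZ; elim/last_ind: s => [_|s i IHs].
  by exists Z; split=> //; rewrite /euler big_nil mul1r subrr mem0v.
rewrite rcons_uniq => /andP[nis /IHs[Y [QY Y0 HY]]].
set Y1 := oc (d i) Y; set Y2 := oc (xi i) Y1.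
have QY1 : Y1 \in Q by apply: queer_alg_oc; first exact: queer_alg_gen.
have QY2 : Y2 \in Q by apply: queer_alg_oc; first exact: queer_alg_gen.
exists Y2; split=> //.
  move=> j b; rewrite mem_rcons inE => /predU1P[-> | sj].
    by case: b; [rewrite /Y2 oc_anticomm /Y1 oc_sq linear0 oppr0 | apply: oc_sq].
  by rewrite /Y2 oc_anticomm /Y1 [oc (gen b j) _]oc_anticomm Y0 // linear0 oppr0 linear0 oppr0.
have QO := Q_euler s.
have -> : Z - euler (rcons s i) * Y2
    = (Z - euler s * Y) + euler s * (Y - xi i * Y1) + euler s * xi i * (Y1 - d i * Y2).
  by rewrite euler_rcons; ncring.
have Qx := queer_alg_gen S false i; have Qd := queer_alg_gen S true i.
apply: memvD; first apply: memvD => //.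
  apply: (@killed_in_H true i); first by apply: queer_algM => //; apply: memvB => //; apply: queer_algM.
  rewrite ocM oc_euler // mul0r add0r linearB /= oc_genM eqxx /= mul1r oc_sq mulr0 subr0.
  by rewrite subrr mulr0.
apply: (@killed_in_H false i).
  by apply: queer_algM; [apply: queer_algM | apply: memvB => //; apply: queer_algM].
rewrite ocM ocM oc_euler // mul0r add0r oc_gen /= mulr0 mul0r add0r linearB /=.
by rewrite oc_genM eqxx /= mul1r oc_sq mulr0 subr0 subrr mulr0.
Qed.

(** With [W] the product of the Euler operators of the other indices, the bracket of
[a xi_i] and [b W d_i] is [[a, b] W xi_i d_i] up to sign and up to a multiple of
[W], which is killed by [xi_i]. *)
Lemma H_top_comm s i : i \notin s ->
  (forall A, euler (rcons s i) * iota A \in H) /\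
  (forall A B, euler (rcons s i) * (eps * iota (A *m B - B *m A)) \in H).
Proof.
move=> nis; set W := euler s.
have [WA We] := supercentral_euler s; rewrite sg_euler -/W in We; rewrite -/W in WA.
have Wg b : gen b i * W = W * gen b i.
  by have /oc_gen0P := oc_euler b nis; rewrite sg_euler.
have QW : W \in Q by apply: Q_euler.
have Qi A : iota A \in Q by apply: queer_alg_iota.
have Qe : eps \in Q by apply: queer_alg_eps.
have Qg b : gen b i \in Q by apply: queer_alg_gen.
have HWA A : iota A * W \in H.
  apply: (@killed_in_H true i); first exact: queer_algM.
  by rewrite ocM oc_euler // oc_iota mul0r mulr0 addr0.
have HeWA A : eps * iota A * W \in H.
  apply: (@killed_in_H true i); first by rewrite !queer_algM.
  by rewrite !ocM oc_euler // oc_iota oc_eps !(mul0r, mulr0, addr0).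
have HeY A : eps * iota A * (W * d i) \in H.
  apply: (@killed_in_H true i); first by rewrite !queer_algM.
  by rewrite !ocM oc_euler // oc_iota oc_eps oc_gen !(mul0r, mulr0, addr0).
have dx : d i * xi i = 1 - xi i * d i.
  by have := genM S true false i i; rewrite eqxx /= => /(canRL (addrK _)).
have de : d i * eps = - (eps * d i) by rewrite eps_gen.
have xe : xi i * eps = - (eps * xi i) by rewrite eps_gen.
have dA C : d i * iota C = iota C * d i by rewrite iota_gen.
have xA C : xi i * iota C = iota C * xi i by rewrite iota_gen.
have [_ satx] := saturated_Grassmann (Grassmann_gen S i).
have sY A : sg (eps * iota A * (W * d i)) = eps * iota A * (W * d i).
  by rewrite !rmorphM /= sg_eps sg_iota sg_euler sg_gen !(mulNr, mulrN) opprK.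
split=> [A|A B].
  have [_] := satx 1%:M; rewrite iota1 mulr1 => Hex.
  have sex : sg (eps * xi i) = eps * xi i by rewrite rmorphM /= sg_eps sg_gen mulrNN.
  apply: (@H_div (- 2%:R)); first by rewrite oppr_eq0.
  have := memvB (Heven Hex (HeY A) sex) (HWA A); congr (_ \in H).
  transitivity (eps * (xi i * eps) * iota A * W * d i
    - eps * iota A * W * (d i * eps) * xi i - iota A * W); first by ncring.
  rewrite xe de.
  transitivity (- (eps * eps * (xi i * iota A) * W * d i)
    + eps * iota A * (W * eps) * d i * xi i - iota A * W); first by ncring.
  rewrite -We xA.
  transitivity (- (eps * eps * iota A * (xi i * W) * d i)
    + eps * (iota A * eps) * W * (d i * xi i) - iota A * W); first by ncring.
  rewrite Wg dx eps_iota.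
  transitivity (- (eps * eps * iota A * W * xi i * d i)
    + eps * eps * iota A * W * (1 - xi i * d i) - iota A * W); first by ncring.
  rewrite eps2 scaleNr scaler_nat euler_rcons -/W.
  have -> : W * (xi i * d i) * iota A = iota A * W * (xi i * d i).
    by rewrite WA -!mulrA dA [xi i * _]mulrA xA -!mulrA.
  by rewrite mulr2n; ncring.
have [Hx _] := satx B.
have sx : sg (iota B * xi i) = - (iota B * xi i) by rewrite rmorphM /= sg_iota sg_gen mulrN.
have := memvD (Hodd Hx (HeY A) sx) (HeWA (A *m B)); congr (_ \in H).
rewrite /oc sY.
transitivity (iota B * (xi i * eps) * iota A * W * d i
  - eps * iota A * W * (d i * iota B) * xi i + eps * iota (A *m B) * W); first by ncring.
rewrite xe dA.
transitivity (- (iota B * eps * (xi i * iota A) * W * d i)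
  - eps * iota A * (W * iota B) * d i * xi i + eps * iota (A *m B) * W); first by ncring.
rewrite eps_iota xA -WA.
transitivity (- (eps * iota B * iota A * (xi i * W) * d i)
  - eps * iota A * iota B * W * (d i * xi i) + eps * iota (A *m B) * W); first by ncring.
rewrite Wg dx iotaM euler_rcons -/W.
have -> : W * (xi i * d i) * (eps * iota (A *m B - B *m A))
    = eps * iota (A *m B - B *m A) * W * (xi i * d i).
  transitivity (W * xi i * (d i * eps) * iota (A *m B - B *m A)); first by ncring.
  rewrite de; transitivity (- (W * (xi i * eps) * (d i * iota (A *m B - B *m A)))).
    by ncring.
  rewrite xe dA.
  transitivity (W * eps * (xi i * iota (A *m B - B *m A)) * d i); first by ncring.
  rewrite xA -We.
  transitivity (eps * (W * iota (A *m B - B *m A)) * xi i * d i); first by ncring.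
  by rewrite -WA; ncring.
by rewrite linearB /= !iotaM; ncring.
Qed.

(** Combining [reduce_euler] with [H_top_comm]: the only direction that brackets do
not reach is [eps] times a matrix of nonzero trace, on the product of all the
Euler operators. *)
Lemma H_codim1 (r0 : 'I_m) (i0 : 'I_n) :
  exists om, forall Z, Z \in Q -> exists k : K, Z - k *: om \in H.
Proof.
pose s := [seq i <- enum 'I_n | i != i0].
have nis : i0 \notin s by rewrite mem_filter eqxx.
have us : uniq (rcons s i0) by rewrite rcons_uniq nis filter_uniq ?enum_uniq.
have all_s i : i \in rcons s i0.
  by rewrite mem_rcons inE mem_filter mem_enum andbT; case: eqP.
have [HA HAB] := H_top_comm nis; set W := euler _ in HA HAB.
exists (W * (eps * iota (delta_mx r0 r0))) => Z QZ.
have [Y [QY Y0]] := reduce_euler us QZ; have [|A [B ->]] := coef_of_oc0 QY.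
  by move=> b i; apply: Y0.
rewrite -/W => HZ; exists (\tr B).
pose U C := W * (eps * iota C) \in H.
have : U (B - \tr B *: delta_mx r0 r0).
  apply: (@commutators_span K m U r0) => [C D UC UD|k C UC|C D]; last exact: HAB.
    by rewrite /U linearB !mulrBr memvB.
  by rewrite /U linearZ -!scalerAr memvZ.
have iE : iota (B - \tr B *: delta_mx r0 r0) = iota B - \tr B *: iota (delta_mx r0 r0).
  by rewrite linearB linearZ.
rewrite /U iE => HB.
have := memvD HZ (memvD (HA A) HB); congr (_ \in H).
transitivity (Z - W * (eps * (\tr B *: iota (delta_mx r0 r0)))); first by ncring.
by rewrite -!scalerAr.
Qed.

End Maximality.

(** * Endomorphism algebras *)

(** The endomorphisms of a nonzero space form a finite-dimensional unital algebra;
the type records that the space is nonzero, since a ring here has [1 != 0]. *)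
Definition endo (K : fieldType) (T : vectType K) (T_gt0 : (0 < dim T)%N) : Type :=
  'End(T).

Section Endo.
Variables (K : fieldType) (T : vectType K) (T_gt0 : (0 < dim T)%N).

HB.instance Definition _ := Vector.on (endo T_gt0).
HB.instance Definition _ := GRing.Zmodule_isNzRing.Build (endo T_gt0)
  (@comp_lfunA _ T T T T) (@comp_lfun1l _ T T) (@comp_lfun1r _ T T)
  (@comp_lfunDl _ T T T) (@comp_lfunDr _ T T T) (lfun1_neq0 T_gt0).
HB.instance Definition _ := GRing.Lmodule_isLalgebra.Build K (endo T_gt0)
  (fun k X Y => comp_lfunZl k X Y).
HB.instance Definition _ := GRing.Lalgebra_isAlgebra.Build K (endo T_gt0)
  (fun k X Y => comp_lfunZr k X Y).
HB.instance Definition _ := Algebra_isFalgebra.Build K (endo T_gt0).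

Lemma endoM (X Y : endo T_gt0) : X * Y = (X \o Y)%VF.
Proof. by []. Qed.
End Endo.

(** * The parity automorphism *)

Section Parity.
Variables (K : fieldType) (V : superspace K).
Implicit Types (X Y : 'End(V)) (a b : bool) (v : V).

Lemma lfun_part (W : vectType K) (X Y : 'Hom(V, W)) :
  (forall a v, v \in part V a -> X v = Y v) -> X = Y.
Proof.
move=> eqXY; apply/lfunP=> v; rewrite -(proj_sum v) !linear_sum.
by apply: eq_bigr => a _; apply: eqXY (mem_proj a v).
Qed.

Lemma parity_ind (P : 'End(V) -> Prop) :
  (forall X Y, P X -> P Y -> P (X + Y)) ->
  (forall b X, has_parity b X -> P X) -> forall X, P X.
Proof.
move=> PD Ppar X; rewrite -(op_part_sum X).
by apply: PD; apply: Ppar; apply: has_parity_part.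
Qed.

(** Locked, so that the rewriting rules for sums of operators do not unfold it. *)
Definition grading : 'End(V) := locked (proj V false - proj V true).

Lemma gradingE a v : v \in part V a -> grading v = (-1) ^+ a *: v.
Proof.
move=> va; rewrite /grading -lock add_lfunE opp_lfunE !(projE _ va).
by case: a {va}; rewrite /= ?expr1 ?expr0 ?scaleN1r ?scale1r ?sub0r ?subr0.
Qed.

Lemma gradingK v : grading (grading v) = v.
Proof.
suff /lfunP/(_ v) : (grading \o grading)%VF = \1%VF by rewrite comp_lfunE id_lfunE.
apply: lfun_part => a w wa; rewrite comp_lfunE id_lfunE !(gradingE wa) linearZ /=.
by rewrite (gradingE wa) scalerA -signr_addb addbb scale1r.
Qed.

Definition parity X : 'End(V) := (grading \o X \o grading)%VF.

Lemma has_parity_mem b X a v : has_parity b X -> v \in part V a -> X v \in part V (a (+) b).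
Proof. by move=> pX va; apply: (subvP (pX a)); apply: memv_img. Qed.

Lemma parity_part b X : has_parity b X -> parity X = (-1) ^+ b *: X.
Proof.
move=> pX; apply: lfun_part => a v va; rewrite !comp_lfunE scale_lfunE.
rewrite (gradingE va) !linearZ /= (gradingE (has_parity_mem pX va)) scalerA.
by rewrite signr_addb mulrA -expr2 sqrr_sign mul1r.
Qed.

Fact parity_is_linear : linear parity.
Proof.
by move=> k X Y; apply/lfunP=> v; rewrite !comp_lfunE !(add_lfunE, scale_lfunE) !comp_lfunE linearP.
Qed.

Lemma parityD X Y : parity (X + Y) = parity X + parity Y.
Proof. by have := parity_is_linear 1 X Y; rewrite !scale1r. Qed.

Lemma parityN X : parity (- X) = - parity X.
Proof. by apply/lfunP=> v; rewrite opp_lfunE !comp_lfunE opp_lfunE linearN. Qed.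

Lemma parityE X : parity X = op_part false X - op_part true X.
Proof.
rewrite -{1}(op_part_sum X) -[op_part false X]scale1r parity_is_linear scale1r.
by rewrite !(parity_part (has_parity_part _ _)) /= expr0 expr1 scale1r scaleN1r.
Qed.

Lemma parityM X Y : parity (X \o Y)%VF = (parity X \o parity Y)%VF.
Proof. by apply/lfunP=> v; rewrite !comp_lfunE gradingK. Qed.

Lemma parity1 : parity \1%VF = \1%VF.
Proof. by apply/lfunP=> v; rewrite !comp_lfunE !id_lfunE gradingK. Qed.

Lemma parityK : involutive parity.
Proof. by move=> X; apply/lfunP=> v; rewrite !comp_lfunE !gradingK. Qed.

Hypothesis two : (2%:R : K) != 0.

Lemma parityP b X : parity X = (-1) ^+ b *: X -> has_parity b X.
Proof.
rewrite parityE -{3}(op_part_sum X) => eqX.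
have X0 : op_part (~~ b) X = 0.
  apply/eqP; have : 2%:R *: op_part (~~ b) X = 0.
    rewrite scaler_nat mulr2n; case: b eqX => /=.
      rewrite expr1 scaleN1r opprD => /addIr eqX.
      by rewrite {1}eqX addNr.
    by rewrite expr0 scale1r => /addrI eqX; rewrite -{1}eqX addNr.
  by move/eqP; rewrite scaler_eq0 (negPf two).
suff -> : X = op_part b X by apply: has_parity_part.
rewrite -{1}(op_part_sum X); case: b X0 {eqX} => /= ->; first by rewrite add0r.
by rewrite addr0.
Qed.

(** The super bracket with a homogeneous operator, in the form used for [odd_comm]. *)
Lemma supercomm_parity a X Y : has_parity a X ->
  supercomm X Y = (X \o Y)%VF - ((if a then parity Y else Y) \o X)%VF.
Proof.
move=> pX; rewrite /supercomm (bigD1 a) //= [X in _ + X]big1 => [|c /negPf nca]; last first.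
  by apply: big1 => d _; rewrite (op_part_id _ pX) nca comp_lfun0r comp_lfun0l scaler0 subr0.
rewrite (op_part_id _ pX) eqxx sumrB addr0; congr (_ - _).
  by rewrite big_bool /= -comp_lfunDr addrC op_part_sum.
rewrite big_bool /=; case: a {pX} => /=; last first.
  by rewrite expr0 !scale1r -comp_lfunDl addrC op_part_sum.
by rewrite expr0 expr1 scale1r scaleN1r parityE -comp_lfunNl -comp_lfunDl addrC.
Qed.

Lemma supercomm_odd X J : has_parity true J ->
  supercomm X J = (X \o J)%VF - (J \o parity X)%VF.
Proof.
move=> pJ; rewrite -{1}(op_part_sum X) -[op_part false X]scale1r.
rewrite (supercomm_is_linear J 1) scale1r.
rewrite !(supercommE (has_parity_part _ _) pJ) /= expr0 expr1 scale1r scaleN1r opprK.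
by rewrite parityE comp_lfunDr comp_lfunNr opprD opprK addrACA -comp_lfunDl op_part_sum.
Qed.

Lemma queer_parityP J X : has_parity true J ->
  reflect ((X \o J)%VF = (J \o parity X)%VF) (X \in queer J).
Proof.
move=> pJ; apply: (iffP (queerP J X)); rewrite supercomm_odd //.
  by move/eqP; rewrite subr_eq0 => /eqP.
by move=> ->; rewrite subrr.
Qed.

End Parity.

(** * The structure of a queer algebra *)

(** The bracket of an odd [u b] with [c + u d] in q(m), where [u] is the odd
involution: its odd part is a commutator. *)
Lemma odd_bracketE (R : pzRingType) (u b c d : R) :
  u * u = 1 -> b * u = u * b -> c * u = u * c -> d * u = u * d ->
  u * b * (c + u * d) - (c - u * d) * (u * b) = (b * d + d * b) + u * (b * c - c * b).
Proof.
move=> uu bu cu du.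
transitivity (u * b * c + u * (b * u) * d - (c * u) * b + u * (d * u) * b); first by ncring.
rewrite bu cu du.
transitivity (u * b * c + (u * u) * b * d - u * c * b + (u * u) * d * b); first by ncring.
by rewrite uu; ncring.
Qed.

Section QueerStructure.
Variables (K : fieldType) (U : superspace K) (J : 'End(U)).
Hypotheses (J_odd : has_parity true J) (J_sq : (J \o J)%VF = - \1%VF).
Hypothesis two : (2%:R : K) != 0.
Implicit Types (X Y : 'End(U)).
Local Notation N := (\dim (part U false)).
Local Notation e := (tnth (queer_even U)).
Local Notation gr := (grading U).

Lemma queer_even_basis : basis_of (part U false) (queer_even U).
Proof. exact: vbasisP. Qed.

Lemma queer_even_mem k : e k \in part U false.
Proof. exact: basis_mem queer_even_basis (mem_tnth k _). Qed.

Lemma queer_even_coord v : v \in part U false ->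
  v = \sum_i coord (queer_even U) i v *: e i.
Proof.
move/(coord_basis queer_even_basis) => {1}->.
by apply: eq_bigr => i _; rewrite -tnth_nth.
Qed.

Lemma coord_queer_even i k : coord (queer_even U) i (e k) = (k == i)%:R.
Proof. by rewrite (tnth_nth 0) coord_free // (basis_free queer_even_basis). Qed.

Lemma gradingJ v : gr (J v) = - J (gr v).
Proof.
have := parity_part J_odd; move/lfunP/(_ (gr v)).
by rewrite !comp_lfunE gradingK expr1 scaleN1r opp_lfunE.
Qed.

Lemma queerE X : X \in queer J <-> forall v, X (J v) = J (parity X v).
Proof.
split=> [/(queer_parityP _ J_odd)/lfunP h v | h]; first by have := h v; rewrite !comp_lfunE.
by apply/(queer_parityP _ J_odd)/lfunP => v; rewrite !comp_lfunE h !comp_lfunE.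
Qed.

(** An element of q(U) is determined by its values on the even part, since the odd
part is [J U_0]. *)
Lemma queer_ext X Y : X \in queer J -> Y \in queer J ->
  (forall k, X (e k) = Y (e k)) -> X = Y.
Proof.
move=> QX QY eqXY; apply/eqP; rewrite -subr_eq0; apply/eqP; set Z := X - Y.
have QZ : Z \in queer J by apply: memvB.
have Z0 v : v \in part U false -> Z v = 0.
  move/queer_even_coord->; rewrite linear_sum big1 // => i _.
  by rewrite linearZ /= /Z add_lfunE opp_lfunE eqXY subrr scaler0.
apply: lfun_part => -[] v va; rewrite zero_lfunE; last exact: Z0.
have -> : v = - J (J v) by rewrite (J_invol J_sq) opprK.
rewrite linearN /= (proj1 (queerE Z) QZ) !comp_lfunE.
have J0 : J v \in part U false by apply: has_parity_mem J_odd va.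
by rewrite (gradingE J0) expr0 scale1r Z0 // !linear0 ?oppr0.
Qed.

Lemma queer_comp X Y : X \in queer J -> Y \in queer J -> (X \o Y)%VF \in queer J.
Proof.
move=> /queerE QX /queerE QY; apply/queerE => v.
by rewrite comp_lfunE QY QX parityM comp_lfunE.
Qed.

Lemma queer_parity X : X \in queer J -> parity X \in queer J.
Proof.
move=> /queerE QX; apply/queerE => v; rewrite parityK [parity X]/parity !comp_lfunE.
rewrite gradingJ linearN /= QX linearN /= gradingJ opprK.
by congr (J _); rewrite /parity !comp_lfunE !gradingK.
Qed.

Definition corner_fun (A : 'M[K]_N) v : U :=
  \sum_i (\sum_j A i j * coord (queer_even U) j (proj U false v)) *: e i.

Fact corner_fun_is_linear A : linear (corner_fun A).
Proof.
move=> k v w; rewrite /corner_fun scaler_sumr -big_split; apply: eq_bigr => i _ /=.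
rewrite scalerA -scalerDl; congr (_ *: _); rewrite mulr_sumr -big_split.
by apply: eq_bigr => j _ /=; rewrite !linearP mulrDr /= mulrCA.
Qed.

Definition corner A : 'End(U) := linfun (corner_fun A).

Lemma cornerE A v : corner A v = corner_fun A v.
Proof. exact: (linear_lfunE (corner_fun_is_linear A)). Qed.

Lemma corner_mem A v : corner A v \in part U false.
Proof. by rewrite cornerE memv_suml // => i _; rewrite memvZ ?queer_even_mem. Qed.

Lemma corner_odd A v : v \in part U true -> corner A v = 0.
Proof.
move=> v1; rewrite cornerE /corner_fun big1 // => i _.
by rewrite big1 ?scale0r // => j _; rewrite (projE false v1) linear0 mulr0.
Qed.

Lemma corner_even A k : corner A (e k) = \sum_i A i k *: e i.
Proof.
rewrite cornerE; apply: eq_bigr => i _; congr (_ *: _).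
rewrite (bigD1 k) //= big1 => [|j /negPf njk].
  by rewrite addr0 (proj_id (queer_even_mem k)) coord_queer_even eqxx mulr1.
by rewrite (proj_id (queer_even_mem k)) coord_queer_even eq_sym njk mulr0.
Qed.

(** The even element of q(U) that extends [A]: on the odd part [J U_0] it has to be
conjugate to [A] by [J]. *)
Definition queer_mx (A : 'M[K]_N) : 'End(U) := corner A - (J \o corner A \o J)%VF.

Lemma parity_corner A : parity (corner A) = corner A.
Proof.
rewrite (@parity_part _ _ false) ?expr0 ?scale1r // => a; apply/subvP=> _ /memv_imgP[v va ->].
by case: a va => va; rewrite ?corner_mem // corner_odd // mem0v.
Qed.

Lemma parity_queer_mx A : parity (queer_mx A) = queer_mx A.
Proof.
have -> : parity (queer_mx A) = parity (corner A) - parity (J \o corner A \o J)%VF.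
  by apply/lfunP=> v; rewrite !(comp_lfunE, add_lfunE, opp_lfunE) linearB.
rewrite !parityM parity_corner (parity_part J_odd) expr1 scaleN1r.
by rewrite comp_lfunNl !comp_lfunNr comp_lfunNl opprK.
Qed.

Lemma queer_mx_mem A : queer_mx A \in queer J.
Proof.
apply/queerE => v; rewrite parity_queer_mx /queer_mx !(add_lfunE, opp_lfunE, comp_lfunE) (J_invol J_sq).
by rewrite !(linearN, linearB) /= (J_invol J_sq) !opprK addrC.
Qed.

Lemma queer_mx_even A k : queer_mx A (e k) = \sum_i A i k *: e i.
Proof.
rewrite add_lfunE opp_lfunE !comp_lfunE corner_even corner_odd ?linear0 ?addr0 //.
exact: (has_parity_mem J_odd (queer_even_mem k)).
Qed.

Fact queer_mx_is_linear : linear queer_mx.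
Proof.
move=> k A B; apply: queer_ext; [exact: queer_mx_mem | by rewrite memvD ?memvZ ?queer_mx_mem |].
move=> l; rewrite [RHS]add_lfunE scale_lfunE !queer_mx_even scaler_sumr -big_split.
by apply: eq_bigr => i _; rewrite !mxE scalerDl scalerA.
Qed.

Lemma queer_mx1 : queer_mx 1%:M = \1%VF.
Proof.
apply: queer_ext => [||k]; first exact: queer_mx_mem.
  by apply/queerE => v; rewrite parity1 !id_lfunE.
rewrite queer_mx_even id_lfunE (bigD1 k) //= big1 => [|i /negPf nik].
  by rewrite mxE eqxx scale1r addr0.
by rewrite mxE nik scale0r.
Qed.

Lemma queer_mxM A B : queer_mx (A *m B) = (queer_mx A \o queer_mx B)%VF.
Proof.
apply: queer_ext => [||k]; [exact: queer_mx_mem | by apply: queer_comp; apply: queer_mx_mem |].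
rewrite comp_lfunE !queer_mx_even linear_sum /=.
under [RHS]eq_bigr => j _ do rewrite linearZ /= queer_mx_even scaler_sumr.
rewrite exchange_big; apply: eq_bigr => i _; rewrite mxE scaler_suml.
by apply: eq_bigr => j _; rewrite scalerA mulrC.
Qed.

(** [J] itself does not supercommute with [J], as [[J, J] = 2 J^2]; composing it with
the grading repairs the sign, and makes its square 1. *)
Definition queer_eps : 'End(U) := (J \o gr)%VF.

Lemma queer_epsE v : queer_eps v = J (gr v).
Proof. exact: comp_lfunE. Qed.

Lemma parity_queer_eps : parity queer_eps = - queer_eps.
Proof.
apply/lfunP=> v; rewrite opp_lfunE queer_epsE [LHS]comp_lfunE comp_lfunE queer_epsE gradingK.
by rewrite gradingJ.
Qed.

Lemma queer_eps2 : (queer_eps \o queer_eps)%VF = \1%VF.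
Proof.
by apply/lfunP=> v; rewrite comp_lfunE !queer_epsE gradingJ gradingK linearN /= (J_invol J_sq) opprK id_lfunE.
Qed.

Lemma queer_eps_mem : queer_eps \in queer J.
Proof.
apply/queerE => v; rewrite parity_queer_eps opp_lfunE !queer_epsE gradingJ.
by rewrite !linearN.
Qed.

Lemma queer_mx_queer_eps A : (queer_mx A \o queer_eps)%VF = (queer_eps \o queer_mx A)%VF.
Proof.
have /queerE QA := queer_mx_mem A; rewrite parity_queer_mx in QA.
apply/lfunP=> v; rewrite !comp_lfunE QA; congr (J _).
by rewrite -{1}(parity_queer_mx A) !comp_lfunE gradingK.
Qed.

Lemma queer_eps_odd : has_parity true queer_eps.
Proof. by apply: parityP; rewrite // parity_queer_eps expr1 scaleN1r. Qed.

Lemma queer_structure X : X \in queer J -> exists A B, X = queer_mx A + (queer_eps \o queer_mx B)%VF.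
Proof.
move=> QX; exists (\matrix_(i, j) coord (queer_even U) i (proj U false (X (e j)))).
exists (\matrix_(i, j) coord (queer_even U) i (proj U false (queer_eps (X (e j))))).
apply: queer_ext => // [|k].
  apply: memvD; first exact: queer_mx_mem.
  by apply: queer_comp; [exact: queer_eps_mem | exact: queer_mx_mem].
rewrite [RHS]add_lfunE comp_lfunE !queer_mx_even.
under eq_bigr => i _ do rewrite mxE.
rewrite -(queer_even_coord (mem_proj false _)).
under [X in queer_eps X]eq_bigr => i _ do rewrite mxE.
rewrite -(queer_even_coord (mem_proj false _)).
rewrite -[X in X = _]proj_sum big_bool addrC; congr (_ + _).
have -> : proj U false (queer_eps (X (e k))) = queer_eps (proj U true (X (e k))).
  rewrite -{1}(proj_sum (X (e k))) big_bool !linearD /=.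
  rewrite (projE false (has_parity_mem queer_eps_odd (mem_proj true _))) /=.
  by rewrite (projE false (has_parity_mem queer_eps_odd (mem_proj false _))) addr0.
by rewrite -(comp_lfunE queer_eps queer_eps) queer_eps2 id_lfunE.
Qed.

(** The basis of the odd part is [- J e_i = - eps e_i], whence the sign. *)
Lemma queer_trace_queer_mx A B : queer_trace J (queer_mx A + (queer_eps \o queer_mx B)%VF) = - \tr B.
Proof.
rewrite /queer_trace /mxtrace -sumrN; apply: eq_bigr => i _; rewrite mxE add_lfunE comp_lfunE.
have odd_basis := queer_odd_basis J_odd J_sq queer_even_basis.
have eqe l : queer_eps (e l) = - tnth (queer_odd J) l.
  by rewrite queer_epsE (gradingE (queer_even_mem l)) expr0 scale1r tnth_mktuple opprK.
rewrite linearD /= !queer_mx_even linear_sum /= big1 => [|l _]; last first.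
  by rewrite linearZ /= (projE true (queer_even_mem l)) scaler0.
rewrite add0r linear_sum linear_sum linear_sum (bigD1 i) //= big1 => [|l /negPf nli].
  rewrite addr0 !linearZ /= (projE true (has_parity_mem queer_eps_odd (queer_even_mem i))) /=.
  by rewrite eqe linearN /= (tnth_nth 0) coord_free ?(basis_free odd_basis) // eqxx mulrN mulr1.
rewrite !linearZ /= (projE true (has_parity_mem queer_eps_odd (queer_even_mem l))) /=.
by rewrite eqe linearN /= (tnth_nth 0) coord_free ?(basis_free odd_basis) // nli oppr0 mulr0.
Qed.

Lemma queer_trace_bracket (U_gt0 : (0 < dim U)%N) X Y : X \in queer J -> Y \in queer J ->
  parity X = - X -> queer_trace J ((X \o Y)%VF - (parity Y \o X)%VF) = 0.
Proof.
move=> QX QY sX.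
have [a [b XE]] := queer_structure QX.
have [c [d YE]] := queer_structure QY.
have sP p q : parity (queer_mx p + (queer_eps \o queer_mx q)%VF) = queer_mx p - (queer_eps \o queer_mx q)%VF.
  by rewrite parityD (parityM (queer_eps)) !parity_queer_mx // parity_queer_eps // comp_lfunNl.
have {}XE : X = (queer_eps \o queer_mx b)%VF.
  have a0 : queer_mx a = 0; last by rewrite XE a0 add0r.
  apply/eqP; have : 2%:R *: queer_mx a = 0.
    move: sX; rewrite XE sP opprD => /addIr qa.
    by rewrite scaler_nat mulr2n {1}qa addNr.
  by move/eqP; rewrite scaler_eq0 (negPf two).
have IM p q : (queer_mx p \o queer_mx q)%VF = queer_mx (p *m q) by rewrite queer_mxM.
have ID p q : queer_mx p + queer_mx q = queer_mx (p + q).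
  by have := queer_mx_is_linear 1 p q; rewrite !scale1r.
have IB p q : queer_mx p - queer_mx q = queer_mx (p - q).
  by rewrite addrC -scaleN1r -queer_mx_is_linear scaleN1r addrC.
have -> : (X \o Y)%VF - (parity Y \o X)%VF
    = queer_mx (b *m d + d *m b) + (queer_eps \o queer_mx (b *m c - c *m b))%VF.
  rewrite XE YE sP -ID -IB -!IM.
  exact: (@odd_bracketE (endo U_gt0) queer_eps (queer_mx b) (queer_mx c) (queer_mx d) queer_eps2
            (queer_mx_queer_eps b) (queer_mx_queer_eps c) (queer_mx_queer_eps d)).
rewrite queer_trace_queer_mx // raddfB /= mxtrace_mulC subrr oppr0 //.
Qed.

End QueerStructure.

(** * Creation and annihilation operators *)

Section Fock.
Variables (K : fieldType) (n : nat).
Implicit Types (S T : {set 'I_n}) (i j k : 'I_n) (b c : bool).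
Local Notation L := (Lambda K n).
Local Notation xi := (xi K).

Lemma Lambda_sum (phi : L) : phi = \sum_S (phi : {ffun {set 'I_n} -> K^o}) S *: (xi S : L).
Proof.
rewrite {1}(tensor_sum (phi : {ffun _ -> scalars K})); apply: eq_bigr => S _.
by apply/ffunP=> T; rewrite !ffunE; exact: mulrC.
Qed.

Lemma Lambda_xi_ind (P : L -> Prop) :
  (forall (k : K) phi psi, P phi -> P psi -> P (k *: phi + psi)) ->
  (forall S, P (xi S)) -> forall phi, P phi.
Proof.
move=> Plin Pxi phi; rewrite (Lambda_sum phi).
have P0 : P 0 by rewrite -(addNr (xi set0 : L)) -scaleN1r; apply: Plin.
elim/big_rec: _ => // S psi _; exact: Plin.
Qed.

(** Symmetric difference with a singleton: it lets the multiplication by xi_i and the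
derivation d_i be treated as two cases of a single formula. *)
Definition toggle i S := if i \in S then S :\ i else i |: S.

(** The sign for moving xi_i to its place in xi_S. *)
Definition fsign i S : K := \prod_(k in S) (-1) ^+ (k < i)%N.

Lemma in_toggle i S : (i \in toggle i S) = (i \notin S).
Proof. by rewrite /toggle; case: ifP => iS; rewrite !inE eqxx. Qed.

Lemma in_toggle_neq i j S : i != j -> (i \in toggle j S) = (i \in S).
Proof. by rewrite /toggle; case: ifP => jS nij; rewrite !inE ?nij ?(negPf nij). Qed.

Lemma toggleK i : involutive (toggle i).
Proof.
move=> S; rewrite {1}/toggle in_toggle /toggle; case: (boolP (i \in S)) => iS /=.
  by rewrite setD1K.
by rewrite setU1K.
Qed.

Lemma toggleC i j S : toggle i (toggle j S) = toggle j (toggle i S).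
Proof.
have [-> //|nij] := eqVneq i j; have nji : j != i by rewrite eq_sym.
apply/setP=> k; have [->|nki] := eqVneq k i.
  by rewrite in_toggle !(in_toggle_neq _ nij) in_toggle.
have [->|nkj] := eqVneq k j; first by rewrite in_toggle !(in_toggle_neq _ nji) in_toggle.
by rewrite !in_toggle_neq.
Qed.

Lemma odd_toggle i S : odd #|toggle i S| = ~~ odd #|S|.
Proof.
rewrite /toggle; case: ifP => iS; last by rewrite cardsU1 iS.
by rewrite [in RHS](cardsD1 i) iS /= negbK.
Qed.

Lemma fsignE i S : fsign i S * fsign i S = 1.
Proof. by rewrite -big_split big1 // => k _ /=; rewrite -expr2 sqrr_sign. Qed.

Lemma fsign_toggle i j S : fsign i (toggle j S) = (-1) ^+ (j < i)%N * fsign i S.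
Proof.
rewrite /toggle /fsign; case: ifP => jS; last by rewrite big_setU1 ?jS.
by rewrite [in RHS](big_setD1 j) //= mulrA -expr2 sqrr_sign mul1r.
Qed.

Lemma xi_signE S T : xi_sign K S T = \prod_(i in S) fsign i T.
Proof.
rewrite /xi_sign /fsign -sum1dep_card big_mkcondr /=.
rewrite pair_big /= -prodrXr; apply: eq_big => [[i j]|[i j] _] /=; first by rewrite in_setX.
by case: ifP.
Qed.

(** Multiplication by xi_i for [b = false], derivation d_i for [b = true]. *)
Definition fock_fun b i (phi : {ffun {set 'I_n} -> K^o}) : {ffun {set 'I_n} -> K^o} :=
  [ffun S : {set 'I_n} => if (i \in S) != b then fsign i S * phi (toggle i S) else 0].

Fact fock_fun_is_linear b i : linear (fock_fun b i).
Proof.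
move=> k phi psi; apply/ffunP=> S; rewrite !ffunE; case: ifP => _.
  by rewrite mulrDr; congr (_ + _); exact: mulrCA.
by rewrite scaler0 addr0.
Qed.

Definition fock b i : 'End(L) := linfun (fock_fun b i).

Lemma fock_xi b i S :
  fock b i (xi S) = if (i \in S) == b then fsign i S *: xi (toggle i S) else 0.
Proof.
rewrite (linear_lfunE (fock_fun_is_linear b i)); apply/ffunP=> T; rewrite !ffunE.
have [ST | nST] := eqVneq (toggle i T) S.
  rewrite -ST in_toggle fsign_toggle ltnn mul1r toggleK.
  by case: (i \in T) b => -[] /=; rewrite ffunE // ffunE eqxx.
rewrite mulr0 if_same; case: ifP => _; rewrite ffunE // ffunE.
case: eqP => [TS|_]; last by rewrite scaler0.
by case/eqP: nST; rewrite TS toggleK.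
Qed.

Lemma fockM b c i j :
  (fock b i \o fock c j)%VF + (fock c j \o fock b i)%VF
  = ((b != c) && (i == j))%:R *: \1%VF.
Proof.
apply: eq_on_xi => S; rewrite add_lfunE scale_lfunE id_lfunE !comp_lfunE !fock_xi.
have [<-|nij] := eqVneq i j.
  rewrite andbT.
  case: b c (i \in S) (in_toggle i S) (fsign_toggle i i S) => [] [] [] /= h1 h2;
  rewrite ?linear0 ?linearZ /= ?fock_xi ?h1 ?h2 ?ltnn ?mul1r /= ?scaler0 ?addr0 ?add0r
          ?scalerA ?fsignE ?toggleK ?scale1r ?scale0r //.
have nji : j != i by rewrite eq_sym.
rewrite andbF scale0r.
have := fsign_toggle i j S; have := fsign_toggle j i S.
case: ifP => jc; case: ifP => ib; rewrite ?linear0 ?linearZ /= ?fock_xi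
  ?in_toggle_neq ?jc ?ib ?scaler0 ?addr0 //.
move=> -> ->; rewrite toggleC !scalerA -scalerDl.
set X := xi _; suff -> : forall x y : K,
    x * ((-1) ^+ (j < i)%N * y) + y * ((-1) ^+ (i < j)%N * x) = 0 by rewrite scale0r.
move=> x y; case: ltngtP (nij) => [_|_|/val_inj ->]; last by rewrite eqxx.
  by rewrite /= expr0 expr1 mul1r mulN1r mulrN (mulrC y) addNr.
by rewrite /= expr0 expr1 mul1r mulN1r mulrN (mulrC y) subrr.
Qed.

Lemma lmul_xi1 i : lmul (xi [set i]) = fock false i.
Proof.
apply: eq_on_xi => S; rewrite lmulE gmul_xi fock_xi disjoints1.
have -> : ((i \in S) == false) = (i \notin S) by case: (i \in S).
by case: ifP => // niS; rewrite xi_signE big_set1 /toggle (negPf niS).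
Qed.

Lemma Lambda_gen_ind (P : L -> Prop) :
  (forall (k : K) phi psi, P phi -> P psi -> P (k *: phi + psi)) ->
  P (xi set0) -> (forall i phi, P phi -> P (fock false i phi)) -> forall phi, P phi.
Proof.
move=> Plin P1 Pgen; apply: Lambda_xi_ind => // S.
have P0 : P 0 by rewrite -(addNr (xi set0 : L)) -scaleN1r; apply: Plin.
have PZ (k : K) phi : P phi -> P (k *: phi) by move=> h; rewrite -[_ *: _]addr0; apply: Plin.
have [m] := ubnP #|S|; elim: m S => // m IHm S; rewrite ltnS => leS.
have [->//|/set0Pn[i iS]] := eqVneq S set0.
have ltS : (#|toggle i S| < m)%N.
  by apply: leq_trans leS; rewrite /toggle iS [X in (_ < X)%N](cardsD1 i) iS.
have := PZ (fsign i S) _ (Pgen i _ (IHm _ ltS)).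
rewrite fock_xi in_toggle iS eqxx fsign_toggle ltnn mul1r toggleK scalerA fsignE.
by rewrite scale1r.
Qed.

Lemma lmul_is_linear : linear (@lmul K n).
Proof.
move=> k phi psi; apply/lfunP=> chi.
by rewrite add_lfunE scale_lfunE !lmulE gmul_is_linear_l.
Qed.

Lemma lmul0 : @lmul K n 0 = 0.
Proof. by have := lmul_is_linear (-1) 0 0; rewrite scaler0 addr0 scaleN1r addNr. Qed.

Lemma lmul1 : @lmul K n (xi set0) = \1%VF.
Proof. by apply/lfunP=> phi; rewrite lmulE gmul1 id_lfunE. Qed.

(** Associativity of the Grassmann product when the first factor is a generator; the
general case [lmulM] follows, since Lambda(n) is generated by the xi_i. *)
Lemma lmul_fock i (phi : L) : lmul (fock false i phi) = (fock false i \o lmul phi)%VF.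
Proof.
move: phi; apply: Lambda_xi_ind => [k phi psi IH1 IH2|S].
  by rewrite linearP /= !lmul_is_linear IH1 IH2 comp_lfunDr comp_lfunZr.
apply: eq_on_xi => T; rewrite comp_lfunE !lmulE fock_xi gmul_xi.
have -> : ((i \in S) == false) = (i \notin S) by case: (i \in S).
have [iS|niS] /= := boolP (i \in S).
  rewrite -lmulE lmul0 zero_lfunE; case: ifP => dST; last by rewrite linear0.
  by rewrite linearZ /= fock_xi !inE iS /= scaler0.
have -> : gmul (fsign i S *: xi (toggle i S)) (xi T) = fsign i S *: gmul (xi (toggle i S)) (xi T) :> L.
  by rewrite -!lmulE -[_ *: _ in LHS]addr0 lmul_is_linear lmul0 addr0 scale_lfunE.
rewrite !gmul_xi.
have -> : [disjoint toggle i S & T] = (i \notin T) && [disjoint S & T].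
  by rewrite /toggle (negPf niS) -!setI_eq0 setIUl setU_eq0 !setI_eq0 disjoints1.
have [dST|] := boolP [disjoint S & T]; last by rewrite andbF /= !linear0.
rewrite andbT linearZ /= fock_xi inE (negPf niS) /=.
have [iT|niT] /= := boolP (i \in T); first by rewrite !scaler0.
have -> : toggle i S :|: T = toggle i (S :|: T).
  by rewrite /toggle inE (negPf niS) (negPf niT) setUA.
rewrite !scalerA; congr (_ *: _); rewrite !xi_signE.
rewrite {1}/toggle (negPf niS) big_setU1 //=.
have -> : fsign i (S :|: T) = fsign i S * fsign i T.
  rewrite /fsign -bigU //; apply: eq_bigl => k; by rewrite !inE.
by rewrite mulrA [RHS]mulrC.
Qed.

Lemma lmulM (phi psi : L) : @lmul K n (gmul phi psi) = (lmul phi \o lmul psi)%VF.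
Proof.
move: phi; apply: Lambda_gen_ind => [k phi chi IH1 IH2||i phi IH].
- have -> : gmul (k *: phi + chi) psi = k *: (gmul phi psi : L) + (gmul chi psi : L) :> L.
    exact: gmul_is_linear_l.
  by rewrite !lmul_is_linear IH1 IH2 comp_lfunDl comp_lfunZl.
- by rewrite gmul1 lmul1 comp_lfun1l.
by rewrite -lmulE !lmul_fock comp_lfunE lmul_fock lmulE IH comp_lfunA.
Qed.

Lemma parity_fock b i : parity (fock b i) = - fock b i.
Proof.
apply: eq_on_xi => S; rewrite opp_lfunE !comp_lfunE (gradingE (xi_part K S)).
rewrite linearZ /= fock_xi; case: ifP => _; last by rewrite scaler0 linear0 oppr0.
rewrite scalerA linearZ /= (gradingE (xi_part K _)) odd_toggle scalerA -scaleNr.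
congr (_ *: _); rewrite mulrAC -signr_addb; case: (odd _) => /=;
by rewrite expr1 mulN1r.
Qed.

Lemma parity_comp_fock i X : parity (fock false i \o X)%VF = - (fock false i \o parity X)%VF.
Proof. by rewrite parityM parity_fock comp_lfunNl. Qed.

Lemma lmul_fockC i (phi : L) :
  (fock false i \o lmul phi)%VF = (parity (lmul phi) \o fock false i)%VF.
Proof.
move: phi; apply: Lambda_gen_ind => [k phi psi IH1 IH2||j phi IH].
- rewrite lmul_is_linear parity_is_linear comp_lfunDr comp_lfunDl.
  by rewrite -comp_lfunZr -comp_lfunZl IH1 IH2.
- by rewrite lmul1 parity1 comp_lfun1r comp_lfun1l.
rewrite lmul_fock parity_comp_fock comp_lfunNl -comp_lfunA -IH !comp_lfunA.
rewrite -comp_lfunNl; congr (_ \o _)%VF; apply/eqP; rewrite -addr_eq0 fockM.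
by rewrite scale0r.
Qed.

Hypothesis two : (2%:R : K) != 0.

(** An operator is a superderivation as soon as it kills 1 and satisfies the Leibniz
rule for the product with each generator. *)
Lemma vect_of_commutators b (D : 'End(L)) (mu : 'I_n -> L) :
  has_parity b D -> D (xi set0) = 0 ->
  (forall i, (D \o fock false i)%VF
     = lmul (mu i) + (-1) ^+ b *: (fock false i \o D)%VF) ->
  D \in vect K n.
Proof.
move=> pD D1 Dxi; apply/vectP => a c phi psi phi_a; rewrite !(op_part_id _ pD).
case: eqP => [-> {c} | _]; last first.
  rewrite !zero_lfunE -lmulE lmul0 zero_lfunE add0r -[gmul phi _]lmulE linear0.
  by rewrite scaler0.
pose pb X := if b then parity X else X : 'End(L).
have pb_lin : linear pb by rewrite /pb; case: (b) => // k X Y; apply: parity_is_linear.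
have pb1 : pb \1%VF = \1%VF by rewrite /pb; case: (b); rewrite ?parity1.
have pbM i X : pb (fock false i \o X)%VF = (-1) ^+ b *: (fock false i \o pb X)%VF.
  rewrite /pb; case: (b); first by rewrite parity_comp_fock expr1 scaleN1r.
  by rewrite expr0 scale1r.
have main chi : (D \o lmul chi)%VF = lmul (D chi) + (pb (lmul chi) \o D)%VF.
  move: chi; apply: Lambda_gen_ind => [k chi chi' IH1 IH2||i chi IH].
  - rewrite linearP /= !lmul_is_linear pb_lin comp_lfunDr comp_lfunDl -comp_lfunZr IH1 IH2.
    by rewrite -comp_lfunZl scalerDr addrACA.
  - by rewrite D1 lmul0 lmul1 pb1 comp_lfun1r comp_lfun1l add0r.
  have Dchi : D (fock false i chi) = gmul (mu i) chi + (-1) ^+ b *: fock false i (D chi).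
    by rewrite -comp_lfunE Dxi add_lfunE scale_lfunE lmulE comp_lfunE.
  rewrite lmul_fock pbM Dchi comp_lfunA Dxi comp_lfunDl -comp_lfunZl -comp_lfunA IH.
  rewrite comp_lfunDr scalerDr addrA comp_lfunA -comp_lfunZl; congr (_ + _).
  rewrite -lmulM; have := lmul_is_linear ((-1) ^+ b) (fock false i (D chi)) (gmul (mu i) chi).
  by rewrite [X in lmul X]addrC [X in X = _ -> _]/= => ->; rewrite lmul_fock addrC.
have := main phi; move/lfunP/(_ psi); rewrite add_lfunE !comp_lfunE !lmulE => ->.
congr (_ + _); have /(@parity_part K _ _ _) := lmul_parity phi_a.
rewrite /pb; case: (b) => /= [->|_]; rewrite ?scale_lfunE lmulE //.
by rewrite expr0 scale1r.
Qed.

(** Vector fields [phi d_i]; it is enough to treat monomials, which are homogeneous. *)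
Lemma lmul_fock_vect (phi : L) i : (lmul phi \o fock true i)%VF \in vect K n.
Proof.
move: phi; apply: Lambda_xi_ind => [k phi psi IH1 IH2|S].
  by rewrite lmul_is_linear comp_lfunDl -comp_lfunZl memvD ?memvZ.
have pS := parity_part (lmul_parity (xi_part K S)).
have pF : parity (lmul (xi S) \o fock true i)%VF
    = (-1) ^+ (~~ odd #|S|) *: (lmul (xi S) \o fock true i)%VF.
  rewrite parityM parity_fock pS comp_lfunNr -comp_lfunZl -scaleNr.
  by case: (odd _); rewrite ?expr0 ?expr1 ?opprK.
apply: (@vect_of_commutators (~~ odd #|S|) _ (fun j => (i == j)%:R *: xi S)).
- exact: parityP.
- by rewrite comp_lfunE fock_xi inE linear0.
move=> j; have /(canRL (addrK _)) Fij := fockM true false i j.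
have swap : (lmul (xi S) \o fock false j)%VF
    = (-1) ^+ odd #|S| *: (fock false j \o lmul (xi S))%VF.
  by rewrite lmul_fockC pS -comp_lfunZl scalerA -expr2 sqrr_sign scale1r.
have lmulZ (k : K) (phi : L) : lmul (k *: phi) = k *: lmul phi.
  by rewrite -[k *: phi]addr0 lmul_is_linear lmul0 addr0.
rewrite -comp_lfunA Fij comp_lfunDr comp_lfunNr comp_lfunA swap lmulZ.
rewrite -comp_lfunZr comp_lfun1r -comp_lfunZl comp_lfunA; congr (_ + _).
by rewrite -scaleNr; case: (odd _); rewrite ?expr0 ?expr1 ?opprK.
Qed.

Lemma vect_commutator (D : 'End(L)) i : D \in vect K n -> exists mu : L,
  (fock false i \o D)%VF - (parity D \o fock false i)%VF = lmul mu.
Proof.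
move/vectP => Dv; pose x : L := xi [set i].
have part_x : x \in part L true by have := xi_part K [set i]; rewrite cards1.
have Db b : (op_part b D \o fock false i)%VF
    = lmul (op_part b D x) + (-1) ^+ b *: (fock false i \o op_part b D)%VF.
  apply/lfunP=> psi; have := Dv true b x psi part_x; rewrite andbT.
  by rewrite !(add_lfunE, scale_lfunE, comp_lfunE) -lmul_xi1 !lmulE.
exists (op_part true D x - op_part false D x).
have lmulB (phi psi : L) : lmul (phi - psi) = lmul phi - lmul psi.
  by rewrite addrC -scaleN1r lmul_is_linear scaleN1r addrC.
have cancel (G : zmodType) (u v s t : G) : u + v - (s + u - (t - v)) = t - s.
  by rewrite opprB [t - v]addrC [s + u]addrC opprD (addrACA (- v)) -opprD (addrC v) addNKr.
rewrite parityE -{1}(op_part_sum D) comp_lfunDr comp_lfunDl comp_lfunNl !Db.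
rewrite lmulB expr0 expr1 scale1r scaleN1r; exact: cancel.
Qed.

End Fock.

(** * Operators on the tensor product with a Grassmann algebra *)

Section Tensor.
Variables (K : fieldType) (U : superspace K) (n : nat).
Implicit Types (A B : 'End(U)) (X Y : 'End(Lambda K n)).
Local Notation L := (Lambda K n).
Local Notation V := (tensor_Lambda U n).
Local Notation xi := (xi K).

Lemma pure_part a (v : U) S : v \in part U a ->
  (pure v (xi S) : V) \in part V (a (+) odd #|S|).
Proof.
move=> va; apply/tensor_partP => T; rewrite !ffunE.
have [->|_] := eqVneq T S; last by rewrite scale0r mem0v.
by rewrite scale1r addbK.
Qed.

Lemma lfun_pure (W : vectType K) (f g : 'Hom(V, W)) :
  (forall a v S, v \in part U a -> f (pure v (xi S)) = g (pure v (xi S))) -> f = g.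
Proof.
move=> eq_fg; apply/lfunP=> w; rewrite (tensor_sum (w : {ffun _ -> U})) !linear_sum.
apply: eq_bigr => S _; set v := (w : {ffun _ -> U}) S.
rewrite -(proj_sum v); have -> : pure (\sum_a proj U a v) (monomial K S)
    = \sum_a pure (proj U a v) (monomial K S) :> V.
  by rewrite !big_bool; have := pure_is_linear_l (monomial K S) 1 (proj U true v) (proj U false v);
     rewrite !scale1r.
by rewrite !linear_sum; apply: eq_bigr => a _; apply: eq_fg (mem_proj a v).
Qed.

Lemma pureZr (v : U) (k : K) (psi : L) : pure v (k *: psi) = k *: pure v psi :> V.
Proof.
by apply/ffunP=> S; rewrite !ffunE scalerA.
Qed.

Lemma pureZl (v : U) (k : K) (psi : L) : pure (k *: v) psi = k *: pure v psi :> V.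
Proof. by apply/ffunP=> S; rewrite !ffunE !scalerA mulrC. Qed.

Lemma pureDr (v : U) (phi psi : L) : pure v (phi + psi) = pure v phi + pure v psi :> V.
Proof. by apply/ffunP=> S; rewrite !ffunE scalerDl. Qed.

Lemma pureDl (v w : U) (psi : L) : pure (v + w) psi = pure v psi + pure w psi :> V.
Proof. by apply/ffunP=> S; rewrite !ffunE scalerDr. Qed.

Lemma grading_pure_xi a (v : U) S : v \in part U a ->
  grading V (pure v (xi S)) = pure (grading U v) (grading L (xi S)).
Proof.
move=> va; rewrite (gradingE va) (gradingE (pure_part S va)) (gradingE (xi_part K S)).
by rewrite pureZl pureZr scalerA signr_addb.
Qed.

Lemma grading_pure (v : U) (psi : L) :
  grading V (pure v psi) = pure (grading U v) (grading L psi).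
Proof.
rewrite -(proj_sum v) big_bool linearD /= !pureDl linearD /=.
suff h a : grading V (pure (proj U a v) psi) = pure (grading U (proj U a v)) (grading L psi).
  by rewrite !h.
move: psi; apply: Lambda_xi_ind => [k phi psi IH1 IH2|S].
  by rewrite pureDr pureZr linearP /= IH1 IH2 linearP /= pureDr pureZr.
exact: grading_pure_xi (mem_proj a v).
Qed.

Lemma tens0r A : tens A (0 : 'End(L)) = 0.
Proof. by have := @tens_is_linear_r K U n A (-1) 0 0; rewrite scaler0 addr0 scaleN1r addNr. Qed.

Lemma tensZr A (k : K) X : tens A (k *: X) = k *: tens A X.
Proof. by have := @tens_is_linear_r K U n A k X 0; rewrite tens0r !addr0. Qed.

Lemma tensDr A X Y : tens A (X + Y) = tens A X + tens A Y.
Proof. by have := @tens_is_linear_r K U n A 1 X Y; rewrite !scale1r. Qed.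

Lemma tensDl A B X : tens (A + B) X = tens A X + tens B X.
Proof. by have := @tens_is_linear_l K U n X 1 A B; rewrite !scale1r. Qed.

Lemma has_parity_comp (W : superspace K) b c (X Y : 'End(W)) :
  has_parity b X -> has_parity c Y -> has_parity (c (+) b) (X \o Y)%VF.
Proof.
move=> pX pY a; apply/subvP=> _ /memv_imgP[v va ->]; rewrite comp_lfunE addbA.
exact: has_parity_mem pX (has_parity_mem pY va).
Qed.

(** The Koszul sign rule. *)
Lemma tens_comp A B X Y b c : has_parity b X -> has_parity c B ->
  (tens A X \o tens B Y)%VF = (-1) ^+ (b && c) *: tens (A \o B)%VF (X \o Y)%VF.
Proof.
move=> pX pB; move: Y; apply: parity_ind => [Y Z IHY IHZ|d Y pY].
  by rewrite (tensDr B) comp_lfunDr IHY IHZ comp_lfunDr (tensDr (A \o B)%VF) scalerDr.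
apply: lfun_pure => a v S va; rewrite scale_lfunE comp_lfunE.
rewrite (tensE _ _ va pY) (tensE _ _ va (has_parity_comp pX pY)) linearZ /=.
rewrite (tensE _ _ (has_parity_mem pB va) pX) !comp_lfunE !scalerA.
congr (_ *: _); rewrite -!signr_addb; congr (_ ^+ _).
by case: (a) (b) (c) (d) => [] [] [] [].
Qed.

Lemma one_even (W : superspace K) : has_parity false (\1%VF : 'End(W)).
Proof. by move=> a; rewrite addbF lim1g. Qed.

Lemma tens1 : tens (\1%VF : 'End(U)) (\1%VF : 'End(L)) = \1%VF.
Proof.
apply: lfun_pure => a v S va; rewrite (tensE _ _ va (one_even _)) andbF expr0.
by rewrite scale1r !id_lfunE.
Qed.

Lemma tens1M X Y : (tens (\1%VF : 'End(U)) X \o tens \1%VF Y)%VF = tens \1%VF (X \o Y)%VF.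
Proof.
move: X; apply: parity_ind => [X X' IH IH'|b X pX].
  by rewrite (tensDr \1%VF X) comp_lfunDl IH IH' comp_lfunDl (tensDr \1%VF (X \o Y)%VF).
by rewrite (tens_comp _ _ pX (one_even U)) andbF expr0 comp_lfun1l scale1r.
Qed.

Lemma tensM1 A B : (tens A (\1%VF : 'End(L)) \o tens B \1%VF)%VF = tens (A \o B)%VF \1%VF.
Proof.
move: B; apply: parity_ind => [B B' IH IH'|b B pB].
  by rewrite (tensDl B) comp_lfunDr IH IH' comp_lfunDr (tensDl (A \o B)%VF).
by rewrite (tens_comp _ _ (one_even L) pB) expr0 comp_lfun1l scale1r.
Qed.

Lemma parity_tens A X : parity (tens A X) = tens (parity A) (parity X).
Proof.
move: X; apply: parity_ind => [X Y IH IH'|b X pX].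
  by rewrite (tensDr A) (parityD X) (tensDr (parity A)) parityD IH IH'.
rewrite (parity_part pX) tensZr.
apply: lfun_pure => a v S va; rewrite scale_lfunE (tensE _ _ va pX).
rewrite !comp_lfunE grading_pure (gradingE va) (gradingE (xi_part K S)) pureZl pureZr.
rewrite !linearZ /= (tensE _ _ va pX) [grading V (_ *: _)]linearZ /= grading_pure.
rewrite (gradingE (has_parity_mem pX (xi_part K S))) pureZl pureZr !scalerA.
congr (_ *: _); rewrite -!signr_addb; congr (_ ^+ _).
by case: (a) (b) (odd _) => [] [] [].
Qed.

Lemma tens1_inj A : tens A (\1%VF : 'End(L)) = 0 -> A = 0.
Proof.
move=> A0; apply: lfun_part => a v va; rewrite zero_lfunE.
have := tensE A (xi set0) va (one_even L); rewrite A0 zero_lfunE andbF expr0 scale1r.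
move/ffunP/(_ set0); rewrite id_lfunE !ffunE eqxx scale1r => h; exact: esym.
Qed.

End Tensor.

(** * The queer superalgebra of a tensor product *)

Section Model.
Variables (K : fieldType) (U : superspace K) (n : nat) (J1 : 'End(U)).
Hypotheses (J1_odd : has_parity true J1) (J1_sq : (J1 \o J1)%VF = - \1%VF).
Hypothesis two : (2%:R : K) != 0.
Hypothesis U_gt0 : (0 < \dim (part U false))%N.
Local Notation L := (Lambda K n).
Local Notation V := (tensor_Lambda U n).
Local Notation xi0 := (xi K (set0 : {set 'I_n})).
Local Notation m := (\dim (part U false)).
Implicit Types (A B : 'End(U)) (X Y : 'End(L)) (Z : 'End(V)).

Definition JV : 'End(V) := tens J1 (\1%VF : 'End(L)).

Lemma tensNl A X : tens (- A) X = - tens A X.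
Proof.
have := @tens_is_linear_l K U n X (-1) A 0; rewrite addr0 !scaleN1r.
have -> : tens (0 : 'End(U)) X = 0; last by rewrite addr0.
by have := @tens_is_linear_l K U n X (-1) 0 0; rewrite scaler0 addr0 scaleN1r addNr.
Qed.

Lemma tensNr A X : tens A (- X) = - tens A X.
Proof. by rewrite -scaleN1r tensZr scaleN1r. Qed.

Lemma JV_odd : has_parity true JV.
Proof.
apply: parityP => //; rewrite parity_tens parity1 (parity_part J1_odd) expr1 !scaleN1r.
exact: tensNl.
Qed.

Lemma JV_sq : (JV \o JV)%VF = - \1%VF.
Proof. by rewrite /JV tensM1 J1_sq tensNl tens1. Qed.

Lemma pure_vac_eq0 (v : U) : (pure v xi0 : V) = 0 -> v = 0.
Proof. by move/ffunP/(_ set0); rewrite !ffunE eqxx scale1r. Qed.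

Lemma V_gt0 : (0 < dim V)%N.
Proof.
rewrite -dimvf lt0n dimv_eq0; apply/eqP=> V0.
pose k := Ordinal U_gt0; have : tnth (queer_even U) k == 0.
  by apply/eqP/pure_vac_eq0/eqP; rewrite -memv0 -V0 memvf.
rewrite (tnth_nth 0) => /eqP e0; have := basis_not0 (queer_even_basis U).
by move/(_ _ (mem_nth 0 _)); rewrite size_tuple => /(_ k (ltn_ord k)); rewrite e0 eqxx.
Qed.

Lemma tensor_even_gt0 : (0 < \dim (part V false))%N.
Proof.
pose k : 'I_m := Ordinal U_gt0.
have mem_k : (pure (tnth (queer_even U) k) xi0 : V) \in part V false.
  by have := @pure_part K U n false _ set0 (queer_even_mem k); rewrite cards0.
rewrite lt0n; apply/negP => /eqP/eqP; rewrite dimv_eq0 => /eqP V0.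
move: mem_k; rewrite V0 memv0 => /eqP/pure_vac_eq0 e0.
have := basis_not0 (queer_even_basis U) (mem_tnth k _).
by rewrite e0 eqxx.
Qed.

Local Notation E := (endo V_gt0).

Lemma tens_oddE A X (v : U) (psi : L) : has_parity true X ->
  tens A X (pure v psi) = pure (A (grading U v)) (X psi).
Proof.
move=> pX; rewrite -(proj_sum v) big_bool !linearD /= !pureDl !linearD /=.
suff h a : tens A X (pure (proj U a v) psi)
    = pure (A (grading U (proj U a v))) (X psi) by rewrite !h.
rewrite (tensE _ _ (mem_proj a v) pX) andbT (gradingE (mem_proj a v)).
by rewrite linearZ /= pureZl.
Qed.

Lemma fock_odd b (i : 'I_n) : has_parity true (fock K b i).
Proof. by apply: parityP => //; rewrite parity_fock expr1 scaleN1r. Qed.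

Definition gen_op b (i : 'I_n) : 'End(V) := tens \1%VF (fock K b i).

Lemma gen_op_tens b (i : 'I_n) A Y :
  (gen_op b i \o tens A Y)%VF = tens (parity A) (fock K b i \o Y)%VF.
Proof.
move: A; apply: parity_ind => [A A' IH IH'|c A pA].
  by rewrite (tensDl A) comp_lfunDr IH IH' parityD (tensDl (parity A)).
rewrite (tens_comp _ _ (fock_odd b i) pA) comp_lfun1l (parity_part pA) /=.
by case: c pA => _; rewrite ?expr1 ?expr0 ?scaleN1r ?scale1r ?tensNl.
Qed.

Lemma tens_gen_op A b (i : 'I_n) : (tens A (\1%VF : 'End(L)) \o gen_op b i)%VF = tens A (fock K b i).
Proof.
by rewrite (tens_comp _ _ (one_even L) (one_even U)) expr0 scale1r comp_lfun1r comp_lfun1l.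
Qed.

Lemma gen_op_coef A b (i : 'I_n) : (gen_op b i \o tens A \1%VF)%VF = (tens (parity A) \1%VF \o gen_op b i)%VF.
Proof. by rewrite gen_op_tens comp_lfun1r tens_gen_op. Qed.

Lemma tens1_queer X : tens \1%VF X \in queer JV.
Proof.
apply/queer_parityP; first exact: JV_odd.
rewrite parity_tens parity1; move: X; apply: parity_ind => [X X' IH IH'|b X pX].
  by rewrite (tensDr \1%VF X) comp_lfunDl IH IH' parityD (tensDr \1%VF (parity X)) comp_lfunDr.
rewrite (tens_comp _ _ pX J1_odd) (tens_comp _ _ (one_even L) (one_even U)) expr0 scale1r.
rewrite !comp_lfun1l !comp_lfun1r andbT (parity_part pX).
by case: b pX => _; rewrite ?expr1 ?expr0 ?scaleN1r ?scale1r ?tensNr.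
Qed.

Lemma tens_queer A : (tens A (\1%VF : 'End(L)) \in queer JV) = (A \in queer J1).
Proof.
apply/idP/idP => [/(queer_parityP _ JV_odd) | /(queer_parityP _ J1_odd) QA].
  rewrite parity_tens parity1 !tensM1 => /eqP; rewrite -subr_eq0 -tensNl -tensDl.
  by move=> /eqP/tens1_inj/eqP; rewrite subr_eq0 => /eqP/(queer_parityP _ J1_odd).
apply/queer_parityP; first exact: JV_odd.
by rewrite parity_tens parity1 !tensM1 QA.
Qed.

Lemma pure0r (v : U) : pure v (0 : L) = 0 :> V.
Proof. by apply/ffunP=> S; rewrite !ffunE scale0r. Qed.

(** ** The supercommutant of the generators *)

(** A vector that is killed by all the derivations does not involve the xi_i. *)
Lemma vacuum (w : V) : (forall i, gen_op true i w = 0) ->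
  w = pure ((w : {ffun _ -> U}) set0) xi0.
Proof.
move=> w0; apply/ffunP=> S; rewrite !ffunE.
have [->|/set0Pn[i iS]] := eqVneq S set0; first by rewrite scale1r.
rewrite scale0r; have wE : gen_op true i w
    = \sum_T pure (grading U ((w : {ffun _ -> U}) T)) (fock K true i (xi K T)) :> V.
  rewrite {1}(tensor_sum (w : {ffun _ -> U})) linear_sum; apply: eq_bigr => T _.
  by rewrite /gen_op /= tens_oddE ?id_lfunE //; apply: fock_odd.
have := w0 i; rewrite wE => /ffunP/(_ (toggle i S)); rewrite sum_ffunE (bigD1 S) //= big1.
  rewrite fock_xi iS eqxx !ffunE eqxx addr0 => h.
  have {}h : fsign K i S *: grading U ((w : {ffun _ -> U}) S) = 0.
    by rewrite -h; congr (_ *: _); rewrite -[RHS]/(_ * _) mulr1.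
  have : grading U (fsign K i S *: (fsign K i S *: grading U ((w : {ffun _ -> U}) S))) = 0.
    by rewrite h scaler0 linear0.
  by rewrite scalerA fsignE scale1r gradingK.
move=> T nTS; rewrite fock_xi; case: ifP => iT; rewrite !ffunE ?scale0r //.
case: eqP => [eT|_]; last by rewrite scaler0 scale0r.
by case/eqP: nTS; rewrite -[T](toggleK i) -eT toggleK.
Qed.

(** V is generated from V_1 by the xi_i.  Moving past a generator turns [Z] into
[parity Z], so the induction on the length of the monomial runs over all [Z] at
once. *)
Lemma commutant_vac Z : (forall i, (gen_op false i \o Z)%VF = (parity Z \o gen_op false i)%VF) ->
  (forall v, Z (pure v xi0) = 0) -> Z = 0.
Proof.
move=> Zxi Z0; apply: lfun_pure => a v S _; rewrite zero_lfunE.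
move: Z Zxi Z0 v; move: (xi K S : L).
apply: (@Lambda_gen_ind K n (fun psi : L => forall Z,
  (forall i, (gen_op false i \o Z)%VF = (parity Z \o gen_op false i)%VF) ->
  (forall v, Z (pure v xi0) = 0) -> forall v : U, Z (pure v psi) = 0)).
- move=> k phi psi IH1 IH2 Z Zxi Z0 v.
  by rewrite pureDr pureZr linearP /= (IH1 Z) // (IH2 Z) // scaler0 addr0.
- by move=> Z _.
move=> i psi IH Z Zxi Z0 v.
have sxi j : parity (gen_op false j) = - gen_op false j.
  by rewrite parity_tens parity1 parity_fock tensNr.
have Zxi' j : (gen_op false j \o parity Z)%VF = (Z \o gen_op false j)%VF.
  have := congr1 (@parity _ _) (Zxi j).
  rewrite (parityM (gen_op _ _) Z) (parityM (parity Z)) parityK sxi.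
  by rewrite comp_lfunNl comp_lfunNr => /oppr_inj.
have -> : pure v (fock K false i psi) = gen_op false i (pure (grading U v) psi) :> V.
  by rewrite /gen_op /= tens_oddE ?id_lfunE ?gradingK //; apply: fock_odd.
rewrite -comp_lfunE -Zxi' comp_lfunE.
suff -> : parity Z (pure (grading U v) psi) = 0 by rewrite linear0.
apply: (IH (parity Z)) => [j|w]; first by rewrite parityK Zxi'.
rewrite !comp_lfunE grading_pure (gradingE (xi_part K set0)) cards0 expr0 scale1r.
by rewrite Z0 linear0.
Qed.

(** An operator that supercommutes with the derivations preserves the space of the
vectors that they kill, which is V_1: this defines [A]. *)
Lemma coefficient Z : Z \in queer JV ->
  (forall b i, (gen_op b i \o Z)%VF = (parity Z \o gen_op b i)%VF) ->
  exists2 A, A \in queer J1 & Z = tens A \1%VF.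
Proof.
move=> QZ Zgen.
pose Af (v : U) : U := (Z (pure v xi0) : {ffun {set 'I_n} -> U}) set0.
have Af_lin : linear Af.
  move=> k v w; rewrite /Af -[k *: v + w]/(_ : U) pureDl pureZl linearP /=.
  by rewrite !ffunE.
pose A : 'End(U) := linfun Af; have AE v : A v = Af v by apply: linear_lfunE.
have Zvac v : Z (pure v xi0) = pure (A v) xi0.
  rewrite AE; apply: vacuum => i; rewrite -comp_lfunE Zgen comp_lfunE.
  rewrite /gen_op tens_oddE; last exact: fock_odd.
  by rewrite fock_xi inE /= pure0r linear0.
have ZA : Z = tens A \1%VF.
  apply/eqP; rewrite -subr_eq0; apply/eqP/commutant_vac => [i|v].
    rewrite comp_lfunDr comp_lfunNr Zgen gen_op_coef -comp_lfunNl -comp_lfunDl.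
    congr (_ \o _)%VF; rewrite parityD; congr (_ + _).
    by rewrite parityN parity_tens parity1.
  rewrite add_lfunE opp_lfunE Zvac.
  suff -> : tens A \1%VF (pure v xi0) = pure (A v) xi0 :> V by rewrite subrr.
  rewrite -(proj_sum v) big_bool /= pureDl !linearD /= pureDl.
  by rewrite !(tensE _ _ (mem_proj _ _) (one_even L)) !andbF expr0 !scale1r !id_lfunE.
by exists A => //; rewrite -tens_queer -ZA.
Qed.

(** ** The Clifford system of q(V) *)

Local Notation q_i := (queer_mx J1).
Local Notation q_e := (queer_eps J1).

Lemma tensZl (k : K) A X : tens (k *: A) X = k *: tens A X.
Proof.
have := @tens_is_linear_l K U n X k A 0; rewrite addr0 => ->.
by have := @tensNl 0 X; rewrite oppr0 => /eqP; rewrite -addr_eq0 -mulr2n -scaler_nat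
   scaler_eq0 (negPf two) /= => /eqP->; rewrite addr0.
Qed.

Definition iota_op (A : 'M[K]_m) : E := tens (q_i A) \1%VF.
Definition eps_op : E := tens q_e \1%VF.

Fact parity_is_monoid : @monoid_morphism E E (@parity K V).
Proof. by split=> [|X Y]; [exact: parity1 | exact: parityM]. Qed.

Fact iota_op_is_linear : linear iota_op.
Proof. by move=> k A B; rewrite /iota_op queer_mx_is_linear // tensDl tensZl. Qed.

Lemma gen_op_anticomm b c (i j : 'I_n) : (gen_op b i \o gen_op c j)%VF + (gen_op c j \o gen_op b i)%VF
  = ((b != c) && (i == j))%:R *: \1%VF.
Proof. by rewrite !tens1M -tensDr fockM tensZr tens1. Qed.

Definition model : queer_clifford E m n.
Proof.
apply: (@QueerClifford K E m n (@parity K V) gen_op iota_op eps_op (queer JV)).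
- exact: two.
- exact: parity_is_linear.
- exact: parity_is_monoid.
- exact: parityK.
- by move=> b i; rewrite parity_tens parity1 parity_fock tensNr.
- by move=> b c i j; rewrite -[LHS]/(_ + _ : 'End(V)) gen_op_anticomm -scaler_nat.
- exact: iota_op_is_linear.
- by rewrite /iota_op queer_mx1 // tens1.
- by move=> A B; rewrite /iota_op queer_mxM // -tensM1.
- by move=> A; rewrite /iota_op parity_tens parity_queer_mx // parity1.
- by move=> A b i; rewrite !endoM /iota_op gen_op_coef parity_queer_mx.
- by rewrite /eps_op parity_tens parity_queer_eps // parity1 tensNl.
- by rewrite endoM /eps_op tensM1 queer_eps2 // tens1.
- by move=> A; rewrite !endoM /iota_op /eps_op !tensM1 queer_mx_queer_eps.
- by move=> b i; rewrite !endoM /eps_op gen_op_coef parity_queer_eps // tensNl comp_lfunNl.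
- by move=> X Y; rewrite endoM; apply: queer_comp; apply: JV_odd.
- by move=> X; apply: queer_parity; apply: JV_odd.
- by move=> b i; apply: tens1_queer.
- by move=> A; rewrite tens_queer queer_mx_mem.
- by rewrite tens_queer queer_eps_mem.
move=> Z QZ Zgen; have [A QA ->] := coefficient QZ Zgen.
have [a [b ->]] := queer_structure J1_odd J1_sq two QA; exists a, b.
by rewrite tensDl -tensM1.
Defined.

(** ** The semidirect sum is the normalizer of the Grassmann algebra *)

Local Notation S := model.

Lemma model_oc (x Z : E) : odd_comm S x Z = (x \o Z)%VF - (parity Z \o x)%VF :> 'End(V).
Proof. by []. Qed.

Lemma Grassmann_lmul (phi : L) : Grassmann S (tens \1%VF (lmul phi) : E).
Proof.
move: phi; apply: Lambda_gen_ind => [k phi psi IH IH'||i phi IH].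
- rewrite lmul_is_linear tensDr tensZr; exact: GrassmannD (GrassmannZ k IH) IH'.
- by rewrite lmul1 tens1; apply: Grassmann1.
by rewrite lmul_fock -tens1M; apply: GrassmannM IH; apply: (Grassmann_gen S i).
Qed.

Lemma Grassmann_lmulP (Z : E) : Grassmann S Z -> exists phi : L, Z = tens \1%VF (lmul phi).
Proof.
move: Z; apply: Grassmann_ind => [X Y [phi ->] [psi ->]|k|i X _ [phi ->]].
- exists (phi + psi); rewrite -tensDr; congr (tens _ _).
  by have := lmul_is_linear 1 phi psi; rewrite !scale1r.
- exists (k *: (xi0 : L)); have := @lmul_is_linear K n k xi0 0.
  by rewrite addr0 lmul0 addr0 lmul1 => ->; rewrite tensZr tens1.
by exists (fock K false i phi); rewrite lmul_fock -tens1M.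
Qed.

Lemma tens_lmul A (phi : L) : tens A (lmul phi) = (tens A \1%VF \o tens \1%VF (lmul phi))%VF.
Proof.
by rewrite (tens_comp _ _ (one_even L) (one_even U)) expr0 scale1r comp_lfun1l comp_lfun1r.
Qed.

Lemma queer_vect_lmul A (phi : L) : A \in queer J1 ->
  tens A (lmul phi) \in (\sum_T (linfun (fun A => tens A (lmul (xi K T))) @: queer J1))%VS.
Proof.
move=> QA; move: phi; apply: Lambda_xi_ind => [k phi psi IH IH'|T].
  by rewrite lmul_is_linear tensDr tensZr memvD ?memvZ.
apply: (subvP (sumv_sup T _ (subvv _))) => //.
by rewrite -(linear_lfunE (@tens_is_linear_l K U n (lmul (xi K T)))) memv_img.
Qed.

Lemma queer_vect_vect (D : 'End(L)) : D \in vect K n -> tens \1%VF D \in queer_vect n J1.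
Proof.
move=> vD; rewrite -(linear_lfunE (@tens_is_linear_r K U n \1%VF)).
by apply: (subvP (addvSr _ _)); apply: memv_img.
Qed.

(** A vector field [D] satisfies [[xi_i, D] = - D xi_i] up to sign, and q(V_1) (x)
Lambda(n) supercommutes with the xi_i. *)
Lemma normalizer_queer_vect (Z : E) : Z \in queer_vect n J1 -> normalizer S Z.
Proof.
case/queer_vectP=> A [D [QA vD ->]]; apply: normalizerD.
  elim/big_ind: _ => [|X Y|T _]; [exact/Grassmann_normalizer/Grassmann0 | exact: normalizerD |].
  have [a [b AE]] := queer_structure J1_odd J1_sq two (QA T).
  rewrite tens_lmul AE tensDl -tensM1.
  exact: (@coefM_normalizer _ _ _ _ S a b _ (Grassmann_lmul (xi K T))).
split=> [|i]; first exact: tens1_queer.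
have [mu Dmu] := vect_commutator i vD.
have -> : odd_comm S (gen S false i) (tens \1%VF D : E) = tens \1%VF (lmul mu).
  by rewrite model_oc parity_tens parity1 !tens1M -tensNr -tensDr Dmu.
exact: Grassmann_lmul.
Qed.

(** With [l_i = [xi_i, Z]], the operator [Z - sum_i d_i l_i] supercommutes with the
xi_i, and [d_i l_i] is a vector field plus an element of Lambda(n). *)
Lemma queer_vect_normalizer (Z : E) : normalizer S Z -> Z \in queer_vect n J1.
Proof.
move=> GZ; pose l i := odd_comm S (gen S false i) Z.
have Ll i : Grassmann S (l i) by apply: normalizer_xi GZ i.
pose Z' := Z - \sum_i gen S true i * l i.
have QZ' : Z' \in queer_alg S.
  rewrite memvB ?(normalizerQ GZ) // memv_suml // => i _.
  by apply: queer_algM; [exact: queer_alg_gen | exact: GrassmannQ (Ll i)].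
have Z'0 j : odd_comm S (gen S false j) Z' = 0.
  rewrite linearB linear_sum /= (bigD1 j) //= big1 => [|i /negPf nij].
    by rewrite oc_genM eqxx mul1r (Grassmann_xi (Ll j)) mulr0 subr0 addr0 subrr.
  by rewrite oc_genM [j == i]eq_sym nij andbF (Grassmann_xi (Ll i)) mul0r mulr0 subr0.
rewrite -(subrK (\sum_i gen S true i * l i) Z) -/Z'; apply: memvD; last first.
  apply: memv_suml => i _; rewrite -(subrK (sg S (l i) * gen S true i) (_ * _)).
  rewrite -[_ - _]/(odd_comm S (gen S true i) (l i)); apply: memvD.
    have [phi ->] := Grassmann_lmulP (Grassmann_oc true i (Ll i)).
    apply: (subvP (addvSl _ _)); apply: queer_vect_lmul.
    by rewrite -tens_queer tens1; apply: (queer_alg1 S).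
  have [phi ->] := Grassmann_lmulP (Grassmann_sg (Ll i)).
  by rewrite endoM tens1M; apply/queer_vect_vect/lmul_fock_vect.
apply: (subvP (addvSl _ _)); set W := (\sum_T _)%VS.
apply: (@xi_kernel_ind _ _ _ _ S (fun X : E => (X : 'End(V)) \in W)) QZ' Z'0.
- by move=> X Y; apply: memvD.
- move=> a b; have -> : iota S a + eps S * iota S b
      = tens (q_i a + (q_e \o q_i b)%VF) (lmul xi0) by rewrite lmul1 tensDl -tensM1.
  apply: queer_vect_lmul; apply: memvD; first exact: queer_mx_mem.
  by apply: queer_comp => //; [exact: queer_eps_mem | exact: queer_mx_mem].
move=> i X /memv_sumP[F F_in ->]; rewrite mulr_sumr memv_suml // => T _.
have /memv_imgP[A QA ->] := F_in T isT.
rewrite (linear_lfunE (@tens_is_linear_l K U n (lmul (xi K T)))).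
rewrite endoM gen_op_tens -lmul_fock; apply: queer_vect_lmul.
exact: queer_parity.
Qed.

(** ** The queer trace *)

Lemma queer_trace_normalizer (i0 : 'I_n) (Z : 'End(V)) :
  normalizer S (Z : E) -> queer_trace JV Z = 0.
Proof.
move=> GZ; pose tau : 'Hom(E, K^o) := linfun (queer_trace JV).
have tauE (x : E) : tau x = queer_trace JV x by exact: (linear_lfunE (queer_trace_is_linear JV)).
rewrite -tauE; apply: (@trace_normalizer _ _ _ _ S tau i0) GZ => X Y QX QY sX.
by rewrite tauE; apply: (queer_trace_bracket JV_odd JV_sq two V_gt0).
Qed.

(** ** Maximality *)

Lemma Lie_closed_of_subsuperalgebra (H : {vspace 'End(V)}) :
  Lie_subsuperalgebra H -> Lie_closed S (H : {vspace E}).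
Proof.
case=> H_part H_comm; split=> [X HX|X Y HX HY sX|X Y HX HY sX].
- by rewrite -[sg S X]/(parity (X : 'End(V))) parityE memvB ?H_part.
- have pX : has_parity false (X : 'End(V)) by apply: parityP; rewrite // expr0 scale1r.
  by have := H_comm _ _ HX HY; rewrite (supercomm_parity _ pX).
have pX : has_parity true (X : 'End(V)) by apply: parityP; rewrite // expr1 scaleN1r.
by have := H_comm _ _ HX HY; rewrite (supercomm_parity _ pX).
Qed.

Lemma op_part_half b (X : E) : op_part b X = if b then part1 S X else part0 S X.
Proof.
have halve (x y : E) : x + x = y -> x = 2%:R^-1 *: y.
  by move=> <-; rewrite -mulr2n -scaler_nat scalerA mulVf ?scale1r.
have sX : sg S X = (op_part false X : E) - (op_part true X : E) by apply: parityE.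
have XE : (op_part false X : E) + (op_part true X : E) = X by apply: op_part_sum.
set x0 : E := op_part false X in sX XE *; set x1 : E := op_part true X in sX XE *.
case: b; apply: halve; rewrite sX.
  transitivity ((x0 + x1) - (x0 - x1)); last by rewrite XE.
  by rewrite opprB [x0 + x1]addrC addrACA subrr addr0.
transitivity ((x0 + x1) + (x0 - x1)); last by rewrite XE.
by rewrite addrACA subrr addr0.
Qed.

Lemma queer_vect_Lie : Lie_subsuperalgebra (queer_vect n J1).
Proof.
split=> [b X GX|X Y GX GY].
  apply: queer_vect_normalizer; rewrite op_part_half.
  by case: b; [apply: normalizer_part1 | apply: normalizer_part0]; apply: normalizer_queer_vect.
have {}GX := normalizer_queer_vect GX; have {}GY := normalizer_queer_vect GY.
have XE : X = 1 *: op_part false X + op_part true X by rewrite scale1r op_part_sum.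
rewrite XE supercomm_is_linear scale1r; apply: memvD; apply: queer_vect_normalizer.
  rewrite (supercomm_parity _ (has_parity_part false X)) (op_part_half false).
  by apply: normalizer_bracket_even => //; [exact: normalizer_part0 | exact: sg_part0].
rewrite (supercomm_parity _ (has_parity_part true X)) (op_part_half true).
by apply: normalizer_bracket_odd => //; [exact: normalizer_part1 | exact: sg_part1].
Qed.

Hypothesis dim_neq0 : (\dim (part V false))%:R != 0 :> K.

(** The subalgebra [H] has codimension at most one in q(V) and lies in the kernel of
the queer trace.  That form is not zero on q(V), as it takes the value [- dim V_0]
on the odd involution; so [H] is its kernel. *)
Theorem queer_vect_maximal (i0 : 'I_n) :
  maximal_Lie_subsuperalgebra (queer_vect n J1) (squeer JV).
Proof.
have JVo := JV_odd.
have G_L : (queer_vect n J1 <= squeer JV)%VS.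
  apply/subvP=> Z /normalizer_queer_vect GZ; apply/squeerP; split.
    exact/queerP/(normalizerQ GZ).
  exact: queer_trace_normalizer i0 _ GZ.
have L_Q : (squeer JV <= queer JV)%VS by apply: capvSl.
split=> //; first exact: queer_vect_Lie.
  apply/eqP=> GL; apply: (@eps_d_notin_normalizer _ _ _ _ S i0).
  have Qepsd : eps S * gen S true i0 \in queer_alg S.
    by apply: queer_algM; [exact: queer_alg_eps | exact: queer_alg_gen].
  apply: normalizer_queer_vect; rewrite GL; apply/squeerP; split; first exact/queerP.
  rewrite [_ * _](@gen_homotopy _ _ _ _ S true i0).
    apply: (queer_trace_bracket JV_odd JV_sq two V_gt0).
    - exact: (queer_alg_gen S true i0).
    - exact: (queer_algM (queer_alg_gen S false i0) Qepsd).
    - exact: (sg_gen S true i0).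
  by rewrite ocM oc_eps oc_gen mul0r mulr0 addr0.
move=> H /Lie_closed_of_subsuperalgebra H_lie G_H H_L H_neq.
have H_Q : (H <= queer_alg S)%VS by apply: subv_trans H_L L_Q.
have G_H' (Z : E) : normalizer S Z -> Z \in (H : {vspace E}).
  by move=> GZ; apply: (subvP G_H); apply: queer_vect_normalizer.
apply: contraNeq H_neq => H_neq_G; apply/eqP.
have nG : exists Z : E, Z \in (H : {vspace E}) /\ ~ normalizer S Z.
  apply: NNPP => h; case/eqP: H_neq_G; apply/eqP; rewrite eqEsubv G_H andbT.
  apply/subvP=> Z HZ; apply: queer_vect_normalizer; apply: NNPP => nGZ.
  by apply: h; exists Z.
have sat := saturated_d H_lie H_Q G_H' nG.
have [om Hom] := H_codim1 H_lie G_H' sat (Ordinal U_gt0) i0.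
apply/eqP; rewrite eqEsubv H_L /=; apply/subvP=> Z LZ.
have QZ : Z \in queer JV by apply: (subvP L_Q).
have [k HZ] := Hom Z QZ; have [k0|k_neq0] := eqVneq k 0.
  by move: HZ; rewrite k0 scale0r subr0.
have trD (X Y : 'End(V)) (a : K) : queer_trace JV (a *: X + Y) = a * queer_trace JV X + queer_trace JV Y.
  exact: queer_trace_is_linear.
have tr_om : queer_trace JV om = 0.
  have L_om : k *: om \in (squeer JV : {vspace E}).
    by rewrite -(subKr Z (k *: om)) memvB // (subvP H_L).
  case/squeerP: (L_om) => _; rewrite -[k *: om]addr0 trD.
  have -> : queer_trace JV 0 = 0.
    by have := trD 0 0 (-1); rewrite scaler0 addr0 mulN1r addNr.
  by rewrite addr0 => /eqP; rewrite mulf_eq0 (negPf k_neq0) => /eqP.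
have Qe : queer_eps JV \in queer JV by apply: queer_eps_mem => //; apply: JV_sq.
have [k' He] := Hom (queer_eps JV) Qe; have /squeerP[_] := subvP H_L _ He.
have -> : (queer_eps JV : E) - k' *: om = - k' *: om + (queer_eps JV : E) by rewrite scaleNr addrC.
rewrite trD tr_om mulr0 add0r.
have -> : queer_eps JV = queer_mx JV 0 + (queer_eps JV \o queer_mx JV 1%:M)%VF.
  have q0 : queer_mx JV 0 = 0.
    by have := queer_mx_is_linear JV_odd JV_sq (-1) 0 0; rewrite scaler0 addr0 scaleN1r addNr.
  by rewrite q0 add0r (queer_mx1 JV_odd JV_sq) comp_lfun1r.
rewrite (queer_trace_queer_mx JV_odd JV_sq two) mxtrace1 => /eqP.
by rewrite oppr_eq0 (negPf dim_neq0).
Qed.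

End Model.

Theorem theorem3p3 (R : realType) (m1 n : nat)
    (V1 : superspace (complex R)) (J1 : 'End(V1)) :
  (1 <= m1)%N -> (1 <= n)%N ->
  \dim (part V1 false) = m1 -> \dim (part V1 true) = m1 ->
  has_parity true J1 -> (J1 \o J1)%VF = - \1%VF ->
  maximal_Lie_subsuperalgebra (queer_vect n J1)
    (squeer (tens J1 (\1%VF : 'End(Lambda (complex R) n)))).
Proof.
move=> m1_gt0 n_gt0 dim_even _ J1_odd J1_sq.
have V1_gt0 : (0 < \dim (part V1 false))%N by rewrite dim_even.
have nat_neq0 k : (0 < k)%N -> (k%:R : complex R) != 0.
  by move=> k_gt0; rewrite Num.Theory.pnatr_eq0 -lt0n.
apply: (@queer_vect_maximal _ V1 n J1 J1_odd J1_sq) => //; last exact: Ordinal n_gt0.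
  exact: nat_neq0.
exact/nat_neq0/tensor_even_gt0.
Qed.
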